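(* Let $m\ge3$ be an odd integer and let $p_m:=(\phi^* )^{-1}(\tfrac\pi m)\in(1,\infty)$. Let $m'\ge2$ be an integer. Then there exists a curve $\gamma\in W^{2,p_m}_{\rm imm}(\mathbf{T}^1;\mathbb{R}^2)$ with a point of multiplicity $m'$ such that $\overline{\mathcal{B}}_{p_m}[\gamma]=\varpi_{p_m}^*(m')^{p_m}$ if and only if $m'$ is even or $m'\ge m$.
   Context: $\mathbf{T}^1=\mathbb{R}/\mathbb{Z}$. $W^{2,p}_{\rm imm}(\mathbf{T}^1;\mathbb{R}^2)$ denotes the $W^{2,p}$ maps $\mathbf{T}^1\to\mathbb{R}^2$ with nowhere vanishing derivative. $\mathcal{B}_p[\gamma]=\int_\gamma|k|^p\,ds$, $\mathcal{L}[\gamma]=\int_\gamma ds$, $\overline{\mathcal{B}}_p[\gamma]=\mathcal{L}[\gamma]^{p-1}\mathcal{B}_p[\gamma]$ ($k$ signed curvature, $s$ arclength). $\gamma$ has a point $P\in\mathbb{R}^2$ of multiplicity $m$ if $\gamma^{-1}(P)$ contains at least $m$ distinct points. For $p\in(1,\infty)$, $q\in[0,1)$, let $\mathrm{K}_{1,p}(q)=\int_0^{\pi/2}\frac{|\cos\theta|^{1-2/p}}{\sqrt{1-q^2\sin^2\theta}}d\theta$ and $\mathrm{E}_{1,p}(q)=\int_0^{\pi/2}\sqrt{1-q^2\sin^2\theta}\,|\cos\theta|^{1-2/p}d\theta$. $q^*=q^*(p)\in(0,1)$ is the unique solution of $2\mathrm{E}_{1,p}(q)=\mathrm{K}_{1,p}(q)$,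 $\phi^*(p)=\pi-2\arcsin(q^*(p))$, and $\varpi_p^*=2^{3p-1}(q^* )^{p-2}(2(q^* )^2-1)\mathrm{E}_{1,p}(q^* )^p>0$. The function $\phi^*$ is a continuous strictly decreasing bijection from $(1,\infty)$ onto $(0,\pi/2)$, so $p_m$ is the unique exponent with $\phi^*(p_m)=\frac\pi m$. *)

(* Defs.v *)
From HB Require Import structures.
From mathcomp Require Import all_boot all_order all_algebra.
From mathcomp Require Import all_classical all_reals all_analysis.
Set Implicit Arguments.
Unset Strict Implicit.
Unset Printing Implicit Defensive.
Import Order.TTheory GRing.Theory Num.Theory.
Import numFieldNormedType.Exports.
Local Open Scope classical_set_scope.
Local Open Scope ring_scope.

Local Notation mu := lebesgue_measure.

(* Functions on the circle R/Z are 1-periodic functions on R; a measurable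
   function on R/Z is only ever looked at on the fundamental domain [0, 1]. *)
Section circle_sobolev.
Context {R : realType}.
Implicit Types f g : R -> R.

Definition circle_measure : {measure set (measurableTypeR R) -> \bar R} :=
  mrestr (@lebesgue_measure R) (measurable_itv `[0%R, 1%R]).

Definition smooth_periodic (phi : R -> R) : Prop :=
  periodic phi 1 /\ forall (n : nat) (t : R), derivable (derive1n n phi) t 1.

Definition is_weak_deriv f g : Prop :=
  [/\ f \in Lfun circle_measure 1%:E,
      g \in Lfun circle_measure 1%:E &
      forall phi : R -> R, smooth_periodic phi ->
        \int[mu]_(t in `[0, 1]) (f t * derive1 phi t) =
        - \int[mu]_(t in `[0, 1]) (g t * phi t)].

(* A representative of the weak derivative, which is unique up to a.e. equality
   on [0, 1]. *)
Definition weak_deriv f : R -> R := xget (fun=> 0) [set g | is_weak_deriv f g].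

(* Membership in W^{2,p}(R/Z); [continuous f] selects the continuous
   representative, which is then automatically C^1. *)
Definition W2p (p : R) f : Prop :=
  [/\ periodic f 1, continuous f, f \in Lfun circle_measure p%:E &
      exists g h : R -> R,
        [/\ g \in Lfun circle_measure p%:E, h \in Lfun circle_measure p%:E,
            is_weak_deriv f g & is_weak_deriv g h]].

End circle_sobolev.

Section curves.
Context {R : realType}.
Implicit Types (c : R -> 'rV[R]_2) (p : R).

Definition component c (i : 'I_2) : R -> R := fun t => c t 0 i.

(* The library norm on 'rV[R]_2 is the sup norm. *)
Definition euclidean_norm (v : 'rV[R]_2) : R :=
  Num.sqrt (\sum_(i < 2) v 0 i ^+ 2).

Definition velocity c (t : R) : 'rV[R]_2 := \row_(i < 2) derive1 (component c i) t.

Definition speed c (t : R) : R := euclidean_norm (velocity c t).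

(* The second derivative is only an L^p function, hence the weak derivative of
   the (classical) first derivative. *)
Definition acceleration c (t : R) : 'rV[R]_2 :=
  \row_(i < 2) weak_deriv (derive1 (component c i)) t.

Definition W2p_imm p c : Prop :=
  (forall i, W2p p (component c i)) /\ (forall t, velocity c t != 0).

Definition curvature c (t : R) : R :=
  (velocity c t 0 0 * acceleration c t 0 1 -
   velocity c t 0 1 * acceleration c t 0 0) / speed c t ^+ 3.

Definition curve_length c : \bar R :=
  (\int[mu]_(t in `[0%R, 1%R]) (speed c t)%:E)%E.

Definition bending_energy p c : \bar R :=
  (\int[mu]_(t in `[0%R, 1%R]) (`|curvature c t| `^ p * speed c t)%:E)%E.

Definition normalized_bending_energy p c : \bar R :=
  (curve_length c `^ (p - 1) * bending_energy p c)%E.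

(* [0, 1[ is a set of representatives of R/Z. *)
Definition has_multiplicity c (P : 'rV[R]_2) (m : nat) : Prop :=
  (`I_m #<= (`[0%R, 1%R[ `&` [set t | c t = P]))%card.

End curves.

Section elliptic_constants.
Context {R : realType}.
Implicit Types p q : R.

Definition ellK1 p q : R :=
  \int[mu]_(t in `[0, pi / 2])
    (`|cos t| `^ (1 - 2 / p) / Num.sqrt (1 - q ^+ 2 * sin t ^+ 2)).

Definition ellE1 p q : R :=
  \int[mu]_(t in `[0, pi / 2])
    (Num.sqrt (1 - q ^+ 2 * sin t ^+ 2) * `|cos t| `^ (1 - 2 / p)).

Definition q_star p : R :=
  xget 0 [set q | 0 < q < 1 /\ 2 * ellE1 p q = ellK1 p q].

Definition phi_star p : R := pi - 2 * asin (q_star p).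

Definition varpi_star p : R :=
  2 `^ (3 * p - 1) * q_star p `^ (p - 2) * (2 * q_star p ^+ 2 - 1) *
  ellE1 p (q_star p) `^ p.

End elliptic_constants.

(* Main.v *)
(* Write r = 1 - 1/p and cut the curve at m' parameters over the multiple point
   into m' leaves, that is, closed arcs.  Let theta be the tangent angle and nu the
   speed of a leaf: nu cos (theta - beta) has zero integral for every beta.  Hence
   Young's inequality may be applied with the weight lam (1 + y cos (theta - beta)),
   where beta is the midpoint of the range of theta and y makes the weight vanish at
   its extremities; this bounds (energy + (p - 1) lam length) of the leaf from below
   by 2 p lam^r times the integral over [0, pi] of max (0, 1 + y cos)^r.  Expressed
   through elliptic integrals, the latter is least exactly for the modulus q_star,
   where its value is varpi_star^(1/p) / 2 and the leaf turns by 2 (pi - phi_star)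
   in absolute value.  Summing over the leaves and optimizing lam gives the lower
   bound varpi_star m'^p, with equality only if every leaf turns by
   +- 2 (pi - pi / m).  The total turning is a multiple of 2 pi, so m divides the sum
   of the m' signs: m' is even, or the sum is odd, hence nonzero, and m <= m'.
   Conversely the curvature of the optimal leaf vanishes at its ends, so copies and
   mirror images of it can be glued, with signs summing to 0 or to m. *)
Require Import Defs.
From mathcomp Require Import all_boot all_order all_algebra.
From mathcomp Require Import all_classical all_reals all_analysis.
From mathcomp Require Import measurable_realfun zify ring lra.
Import Order.TTheory GRing.Theory Num.Theory.
Import numFieldNormedType.Exports.
Local Open Scope classical_set_scope.
Local Open Scope ring_scope.
Set Implicit Arguments.
Unset Strict Implicit.
Unset Printing Implicit Defensive.


(** * Integrals over segments *)

Section segment_integral.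
Context {R : realType}.
Implicit Types (f g h F : R -> R) (a b c x : R).

(** The weight 1 + y cos is dictated by the Euler-Lagrange equation: on a free elastica |k|^p is an
    affine function of the cosine of the tangent angle, where the constant term comes from the
    length constraint and the cosine term from the closing constraint. Equality in Young's
    inequality reproduces this law, so the bound is attained by the elastica itself. The angle of a
    leaf need not be monotone. Only the variation between its extreme values enters the bound, so
    equality also tells that the extremes are reached at the two ends. Two degenerate cases shape
    the argument. An angle range shorter than pi cannot close up, and a range of at least 2 pi
    leaves only y = 1, which corresponds to the modulus 1 outside the domain of the elliptic
    integrals and is reached by comparison with y near 1. The other obstacle is regularity: second
    derivatives are arbitrary representatives in L^p. All calculus on the given curve therefore goes
    through absolutely continuous functions, and the weak derivatives are first identified with
    derivatives in that sense. *)

Definition L1 a b f := lebesgue_measure.-integrable `[a, b] (EFin \o f).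
Definition seg_int a b f : R := \int[lebesgue_measure]_(t in `[a, b]) f t.

Lemma eq_L1 a b f g : {in `[a, b], f =1 g} -> L1 a b f -> L1 a b g.
Proof.
move=> fg; apply: eq_integrable => // x; rewrite inE/= => xab.
by rewrite /= fg.
Qed.

Lemma L1S a b a' b' f : a <= a' -> b' <= b -> L1 a b f -> L1 a' b' f.
Proof.
move=> aa bb; apply: integrableS => //.
by move=> x /=; rewrite !in_itv/= => /andP[/(le_trans aa) -> /le_trans ->].
Qed.

Lemma L1D a b f g : L1 a b f -> L1 a b g -> L1 a b (fun x => f x + g x).
Proof.
move=> fi gi; have := @integrableD _ _ _ lebesgue_measure `[a, b] _ _ _ fi gi.
by apply; exact: measurable_itv.
Qed.

Lemma L1Zl a b k f : L1 a b f -> L1 a b (fun x => k * f x).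
Proof.
move=> fi; have := @integrableZl _ _ _ lebesgue_measure `[a, b] _ k _ fi.
by apply; exact: measurable_itv.
Qed.

Lemma L1N a b f : L1 a b f -> L1 a b (fun x => - f x).
Proof.
move=> /(L1Zl (-1)); apply: eq_L1 => x _; exact: mulN1r.
Qed.

Lemma L1B a b f g : L1 a b f -> L1 a b g -> L1 a b (fun x => f x - g x).
Proof. by move=> fi /L1N; exact: L1D. Qed.

Lemma L1_norm a b f : L1 a b f -> L1 a b (fun x => `|f x|).
Proof. exact: integrable_norm. Qed.

Lemma L1_cont a b f : {within `[a, b], continuous f} -> L1 a b f.
Proof.
move=> cf; apply: continuous_compact_integrable => //.
exact: segment_compact.
Qed.

Lemma L1_measurable a b f : L1 a b f -> measurable_fun `[a, b] f.
Proof. by move=> /integrableP[/measurable_EFinP]. Qed.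

Lemma cont_measurable a b f : {within `[a, b], continuous f} ->
  measurable_fun `[a, b] f.
Proof. by move=> /L1_cont /L1_measurable. Qed.

Lemma cont_bounded a b f : {within `[a, b], continuous f} ->
  exists M : R, 0 < M /\ forall x, x \in `[a, b] -> `|f x| <= M.
Proof.
move=> cf.
have /compact_bounded[M [_ mrt]] := continuous_compact cf (@segment_compact R a b).
exists (`|M| + 1); split; first by rewrite ltr_wpDl.
move=> x xab; apply: mrt; last by exists x.
by rewrite (le_lt_trans (ler_norm _))// ltrDl.
Qed.

Lemma L1_contM a b f g : {within `[a, b], continuous f} -> L1 a b g ->
  L1 a b (fun x => f x * g x).
Proof.
move=> cf gi; have := @integrableMr _ _ _ lebesgue_measure `[a, b] _ f _ _ _ gi.
apply; first exact: measurable_itv.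
  exact: cont_measurable.
have [M [M0 Mf]] := cont_bounded cf.
exists M; split; rewrite ?num_real// => y My x /=xab.
by rewrite (le_trans (Mf _ xab))// ltW.
Qed.

Lemma eq_seg_int a b f g : {in `[a, b], f =1 g} -> seg_int a b f = seg_int a b g.
Proof. by move=> fg; apply: eq_Rintegral => x; rewrite inE/=; exact: fg. Qed.

Lemma seg_intD a b f g : L1 a b f -> L1 a b g ->
  seg_int a b (fun x => f x + g x) = seg_int a b f + seg_int a b g.
Proof. by move=> fi gi; rewrite /seg_int RintegralD//. Qed.

Lemma seg_intZl a b k f : L1 a b f ->
  seg_int a b (fun x => k * f x) = k * seg_int a b f.
Proof. by move=> fi; rewrite /seg_int RintegralZl//. Qed.

Lemma seg_intN a b f : L1 a b f ->
  seg_int a b (fun x => - f x) = - seg_int a b f.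
Proof.
move=> fi; rewrite -mulN1r -seg_intZl//; apply: eq_seg_int => x _.
by rewrite mulN1r.
Qed.

Lemma seg_intB a b f g : L1 a b f -> L1 a b g ->
  seg_int a b (fun x => f x - g x) = seg_int a b f - seg_int a b g.
Proof. by move=> fi gi; rewrite /seg_int RintegralB//. Qed.

Lemma seg_int_aa a f : seg_int a a f = 0.
Proof. by rewrite /seg_int set_itv1 Rintegral_set1. Qed.

Lemma seg_int_cst a b k : a <= b -> seg_int a b (fun=> k) = k * (b - a).
Proof.
move=> ab; rewrite /seg_int Rintegral_cst//= lebesgue_measure_itv/=.
move: ab; rewrite le_eqVlt lte_fin => /predU1P[->|ab].
  by rewrite ltxx subrr.
by rewrite ab.
Qed.

Lemma seg_int_split a b c f : a <= c -> c <= b -> L1 a b f ->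
  seg_int a b f = seg_int a c f + seg_int c b f.
Proof.
move=> ac cb fi; rewrite /seg_int -[in X in _ = _ + X]Rintegral_itv_obnd_cbnd.
  by rewrite -(@Rintegral_itvB _ f (BLeft a) (BRight b) c)// subrKC.
apply: integrableS fi => //.
by move=> x/=; rewrite !in_itv/= => /andP[/ltW/(le_trans ac) -> ->].
Qed.

Lemma seg_int_ge0 a b f : (forall x, x \in `[a, b] -> 0 <= f x) ->
  0 <= seg_int a b f.
Proof. by move=> f0; apply: Rintegral_ge0 => x; exact: f0. Qed.

Lemma le_seg_int a b f g : L1 a b f -> L1 a b g ->
  (forall x, x \in `[a, b] -> f x <= g x) -> seg_int a b f <= seg_int a b g.
Proof. by move=> fi gi fg; apply: le_Rintegral. Qed.

Lemma seg_int_norm a b f : L1 a b f ->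
  `|seg_int a b f| <= seg_int a b (fun x => `|f x|).
Proof. by move=> fi; apply: le_normr_Rintegral. Qed.

Lemma within_cont_subset a b a' b' f : a <= a' -> b' <= b ->
  {within `[a, b], continuous f} -> {within `[a', b'], continuous f}.
Proof.
move=> aa bb; apply: continuous_subspaceW => x /=.
by rewrite !in_itv/= => /andP[/(le_trans aa) -> /le_trans ->].
Qed.

Lemma seg_int_cont a b f : a <= b -> L1 a b f ->
  {within `[a, b], continuous (fun x => seg_int a x f)}.
Proof. exact: parameterized_integral_continuous. Qed.

Lemma within_contD (A : set R) f g :
  {within A, continuous f} -> {within A, continuous g} ->
  {within A, continuous (fun x => f x + g x)}.
Proof.
move=> /subspace_continuousP cf /subspace_continuousP cg.
by apply/subspace_continuousP => x Ax; apply: cvgD; [exact: cf|exact: cg].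
Qed.

Lemma within_contM (A : set R) f g :
  {within A, continuous f} -> {within A, continuous g} ->
  {within A, continuous (fun x => f x * g x)}.
Proof.
move=> /subspace_continuousP cf /subspace_continuousP cg.
by apply/subspace_continuousP => x Ax; apply: cvgM; [exact: cf|exact: cg].
Qed.

Lemma within_cont_cst (A : set R) (k : R) : {within A, continuous (fun=> k)}.
Proof. by apply: continuous_subspaceT => x; exact: cvg_cst. Qed.

Lemma within_contN (A : set R) f :
  {within A, continuous f} -> {within A, continuous (fun x => - f x)}.
Proof.
move=> /subspace_continuousP cf.
by apply/subspace_continuousP => x Ax; apply: cvgN; exact: cf.
Qed.

Lemma within_contB (A : set R) f g :
  {within A, continuous f} -> {within A, continuous g} ->
  {within A, continuous (fun x => f x - g x)}.
Proof. by move=> cf /within_contN; exact: within_contD. Qed.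

Lemma within_cont_comp (A : set R) f (g : R -> R) :
  continuous g -> {within A, continuous f} ->
  {within A, continuous (fun x => g (f x))}.
Proof.
move=> cg /subspace_continuousP cf.
apply/subspace_continuousP => x Ax.
by apply: (@cvg_comp _ _ _ f g); [exact: cf|exact: cg].
Qed.

Lemma within_cont_comp_at (A : set R) f (g : R -> R) :
  (forall x, A x -> {for f x, continuous g}) -> {within A, continuous f} ->
  {within A, continuous (fun x => g (f x))}.
Proof.
move=> cg /subspace_continuousP cf.
apply/subspace_continuousP => x Ax.
by apply: (@cvg_comp _ _ _ f g); [exact: cf|exact: cg].
Qed.

Lemma within_cont_eq (A : set R) f g : (forall x, A x -> f x = g x) ->
  {within A, continuous f} -> {within A, continuous g}.
Proof.
by move=> fg; apply: subspace_eq_continuous => x xA; apply: fg; exact: set_mem.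
Qed.

Lemma within_continuousT (A : set R) f : continuous f -> {within A, continuous f}.
Proof. by move=> cf; exact: continuous_subspaceT. Qed.

Lemma continuous_L1 a b f : continuous f -> L1 a b f.
Proof. by move=> cf; apply/L1_cont/within_continuousT. Qed.

Lemma within_contP a b f x : {within `[a, b], continuous f} ->
  x \in `]a, b[ -> {for x, continuous f}.
Proof.
move=> cf xab; have ab : a < b by move: xab; rewrite in_itv/= => /andP[/lt_trans]; apply.
by have /(continuous_within_itvP _ ab)[+ _ _] := cf; exact.
Qed.

Lemma within_cont_oo a b f : a < b -> {within `[a, b], continuous f} ->
  {in `]a, b[, forall x, derivable f x 1} -> derivable_oo_LRcontinuous f a b.
Proof.
by move=> ab /(continuous_within_itvP _ ab)[_ fa fb] df; split.
Qed.

Lemma seg_int_FTC2 a b f F : a <= b -> {within `[a, b], continuous f} ->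
  {within `[a, b], continuous F} ->
  (forall x, x \in `]a, b[ -> is_derive x 1 F (f x)) ->
  seg_int a b f = F b - F a.
Proof.
rewrite le_eqVlt => /predU1P[->|ab] cf cF dF; first by rewrite seg_int_aa subrr.
rewrite /seg_int /Rintegral (@continuous_FTC2 _ f F)//.
  by apply: within_cont_oo => // x /dF [].
by move=> x /dF /@derive_val; rewrite derive1E.
Qed.

Lemma seg_int_FTC1 a b f x : {within `[a, b], continuous f} -> x \in `]a, b[ ->
  is_derive x 1 (fun y => seg_int a y f) (f x).
Proof.
move=> cf xab; have := xab; rewrite in_itv/= => /andP[ax xb].
have [|D1 D2] := @continuous_FTC1_closed R f a x b xb (L1_cont cf) ax.
  exact: within_contP cf xab.
by apply: DeriveDef => //; rewrite -derive1E.
Qed.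

Lemma seg_int_gt0 a b f : a < b -> {within `[a, b], continuous f} ->
  (forall x, x \in `]a, b[ -> 0 < f x) -> 0 < seg_int a b f.
Proof.
move=> ab cf f0.
have cF := seg_int_cont (ltW ab) (L1_cont cf).
have [||c cab /=] := @MVT R (fun y => seg_int a y f) f a b ab.
- by move=> x xab; apply: seg_int_FTC1 cf xab.
- exact: cF.
rewrite seg_int_aa subr0 => ->.
by rewrite mulr_gt0 ?subr_gt0// f0.
Qed.

Lemma lebesgue_measure_shift (k : R) (A : set R) : measurable A ->
  pushforward lebesgue_measure ((fun x => x + k) : _ -> measurableTypeR R) A =
  lebesgue_measure A.
Proof.
move=> mA; have mk : measurable_fun [set: measurableTypeR R]
    ((fun x => x + k) : _ -> measurableTypeR R).
  exact: measurable_funD.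
apply/esym/lebesgue_measure_unique => //= _ [[x y]] _ <-.
rewrite /pushforward (_ : _ @^-1` _ = `]x - k, y - k]%classic); last first.
  by apply/seteqP; split => t /=; rewrite !in_itv/= ltrBlDr lerBrDr.
rewrite !lebesgue_measure_itv/= !lte_fin ltrD2r; case: ifPn => // _.
by rewrite -!EFinD; congr EFin; lra.
Qed.

Lemma preimage_shift (k a b : R) :
  (fun x => x + k) @^-1` `[a + k, b + k] = `[a, b]%classic.
Proof.
by apply/seteqP; split => t /=; rewrite !in_itv/= !lerD2r.
Qed.

Lemma L1_shift k a b f : L1 (a + k) (b + k) f -> L1 a b (fun x => f (x + k)).
Proof.
move=> fi; have mk : measurable_fun [set: measurableTypeR R]
    ((fun x => x + k) : _ -> measurableTypeR R).
  exact: measurable_funD.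
have mf := L1_measurable fi.
apply/integrableP; split.
  apply/measurable_EFinP; rewrite -(preimage_shift k).
  apply: (measurable_comp (F := `[a + k, b + k])) => //.
    by move=> _ [t tab <-].
  by apply: measurable_funD => //; exact: measurable_id.
move/integrableP : (fi) => [_]; apply: le_lt_trans.
rewrite -[X in (_ <= X)%E](_ : (\int[pushforward lebesgue_measure
    ((fun x => (x + k)%R) : measurableTypeR R -> measurableTypeR R)]_(y in `[(a + k)%R, (b + k)%R]) `|f y|%:E = _)%E).
  rewrite ge0_integral_pushforward//=; first by rewrite preimage_shift.
  by apply/measurable_EFinP; apply: measurableT_comp.
by apply: eq_measure_integral => //= A mA AS; exact: lebesgue_measure_shift.
Qed.

Lemma seg_int_shift k a b f : L1 (a + k) (b + k) f ->
  seg_int a b (fun x => f (x + k)) = seg_int (a + k) (b + k) f.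
Proof.
move=> fi; have mk : measurable_fun [set: measurableTypeR R]
    ((fun x => x + k) : _ -> measurableTypeR R).
  exact: measurable_funD.
(* The change of variables by pushforward is applied to a function measurable on the whole line, so
   [f] is cut off outside the segment. *)
pose g := f \_ `[a + k, b + k].
have mg : measurable_fun [set: measurableTypeR R] g.
  by apply/(measurable_restrictT _ _).1 => //; exact: L1_measurable.
have fg : {in `[a + k, b + k], f =1 g}.
  by move=> x xab; rewrite /g patchE mem_set.
have gi : L1 (a + k) (b + k) g by exact: eq_L1 fi.
rewrite (eq_seg_int fg) (@eq_seg_int a b _ (fun x => g (x + k))); last first.
  by move=> x xab; apply: fg; move: xab; rewrite !in_itv/= !lerD2r.
rewrite /seg_int /Rintegral; congr fine.
rewrite -(preimage_shift k).
rewrite -(@integral_pushforward _ _ (measurableTypeR R) (measurableTypeR R) R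
  (fun x => x + k) _ lebesgue_measure `[a + k, b + k] (EFin \o g))//.
- by apply: eq_measure_integral => //= A mA AS; exact: lebesgue_measure_shift.
- by apply/measurable_EFinP.
- by rewrite preimage_shift; exact: L1_shift gi.
Qed.

End segment_integral.

(** * Absolutely continuous functions *)

Section absolutely_continuous.
Context {R : realType}.
Implicit Types (f g h F : R -> R) (a b c x : R).

(* Cousin's lemma. *)
Lemma segment_ind (P : R -> R -> Prop) a b : a <= b ->
  (forall s t u, s <= t -> t <= u -> P s t -> P t u -> P s u) ->
  (forall x, x \in `[a, b] -> exists2 d : R, 0 < d &
     forall s t, a <= s -> x - d < s -> s <= x -> x <= t -> t < x + d -> t <= b ->
     P s t) ->
  P a b.
Proof.
move=> ab Ptrans Ploc.
pose S := [set t | t \in `[a, b] /\ P a t].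
have Sa : S a.
  split; first by rewrite in_itv/= lexx.
  have [|d d0 +] := Ploc a; first by rewrite in_itv/= lexx.
  by apply; rewrite ?ltrDl ?ltrBlDr ?ltrDl.
have ubS : ubound S b by move=> t [+ _]; rewrite in_itv/= => /andP[].
have supS : has_sup S by split; [exists a|exists b].
set c := sup S.
have ac : a <= c by apply: ub_le_sup => //; case: supS.
have cb : c <= b by apply: ge_sup => //; exists a.
have cab : c \in `[a, b] by rewrite in_itv/= ac.
have [d d0 dP] := Ploc _ cab.
have [s Ss cds] := sup_adherent d0 supS.
have sc : s <= c by apply: ub_le_sup => //; case: supS.
case: Ss => sab Pas; have := sab; rewrite in_itv/= => /andP[as_ sb].
have Pac : P a c.
  apply: (Ptrans _ s) => //; apply: dP => //.
  by rewrite ltrDl.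
move: cb; rewrite le_eqVlt => /predU1P[<-//|cb].
pose t := Num.min b (c + d / 2).
have ct : c < t by rewrite lt_min cb ltrDl divr_gt0.
have tb : t <= b by rewrite ge_min lexx.
have : S t.
  split; first by rewrite in_itv/= (le_trans ac (ltW ct)).
  apply: (Ptrans _ c) => //; first exact: ltW.
  apply: dP => //; first by rewrite ltrBlDr ltrDl.
    exact: ltW.
  by rewrite gt_min; apply/orP; right; lra.
by move/(ub_le_sup (proj2 supS)) => /(lt_le_trans ct); rewrite ltxx.
Qed.

(* [AC a b f g]: f is absolutely continuous on [a, b] with a.e. derivative g. *)
Definition AC a b f g := L1 a b g /\
  forall x, x \in `[a, b] -> f x = f a + seg_int a x g.

Lemma AC_L1 a b f g : AC a b f g -> L1 a b g. Proof. by case. Qed.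

Lemma AC_diff a b s t f g : AC a b f g -> a <= s -> s <= t -> t <= b ->
  f t - f s = seg_int s t g.
Proof.
move=> [gi fE] as_ st tb.
rewrite (fE t) ?in_itv/= ?(le_trans as_)// (fE s) ?in_itv/= ?as_ ?(le_trans st)//.
rewrite (@seg_int_split _ a t s)//; last exact: L1S gi.
by ring.
Qed.

Lemma AC_sub a b a' b' f g : a <= a' -> b' <= b -> AC a b f g -> AC a' b' f g.
Proof.
move=> aa bb fg; split; first exact: L1S (AC_L1 fg).
move=> x; rewrite in_itv/= => /andP[ax xb].
by rewrite -(AC_diff fg aa ax) ?(le_trans xb)// subrKC.
Qed.

Lemma AC_ext a b f g f' g' : {in `[a, b], f =1 f'} -> {in `[a, b], g =1 g'} ->
  AC a b f g -> AC a b f' g'.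
Proof.
move=> ff gg [gi fE]; split; first exact: eq_L1 gi.
move=> x xab; have := xab; rewrite in_itv/= => /andP[ax xb].
rewrite -(ff x)// -(ff a); last by rewrite in_itv/= lexx (le_trans ax).
rewrite fE//; congr (_ + _).
apply: eq_seg_int => t; rewrite in_itv/= => /andP[at_ tx]; apply: gg.
by rewrite in_itv/= at_ (le_trans tx).
Qed.

Lemma AC_cont a b f g : a <= b -> AC a b f g -> {within `[a, b], continuous f}.
Proof.
move=> ab [gi fE].
apply: (within_cont_eq (f := fun x => f a + seg_int a x g)).
  by move=> x /= xab; rewrite -fE.
by apply: within_contD; [exact: within_cont_cst|exact: seg_int_cont].
Qed.

Lemma AC_int a b g k : L1 a b g -> AC a b (fun x => k + seg_int a x g) g.
Proof. by move=> gi; split => // x xab; rewrite seg_int_aa addr0. Qed.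

Lemma C1_AC a b f g : {within `[a, b], continuous g} ->
  {within `[a, b], continuous f} ->
  (forall x, x \in `]a, b[ -> is_derive x 1 f (g x)) -> AC a b f g.
Proof.
move=> cg cf df; split; first exact: L1_cont.
move=> x; rewrite in_itv/= => /andP[ax xb]; suff -> : seg_int a x g = f x - f a by rewrite subrKC.
apply: seg_int_FTC2 => //.
- exact: within_cont_subset cg.
- exact: within_cont_subset cf.
- move=> y; rewrite in_itv/= => /andP[ay yx]; apply: df.
  by rewrite in_itv/= ay (lt_le_trans yx).
Qed.

Lemma ACD a b f g f' g' : AC a b f f' -> AC a b g g' ->
  AC a b (fun x => f x + g x) (fun x => f' x + g' x).
Proof.
move=> [fi fE] [gi gE]; split; first exact: L1D.
move=> x xab; have /andP[ax xb]: a <= x <= b by rewrite in_itv in xab.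
by rewrite seg_intD ?(fE x xab) ?(gE x xab)//; [ring|exact: L1S fi|exact: L1S gi].
Qed.

Lemma ACZ a b k f f' : AC a b f f' ->
  AC a b (fun x => k * f x) (fun x => k * f' x).
Proof.
move=> [fi fE]; split; first exact: L1Zl.
move=> x xab; have /andP[ax xb]: a <= x <= b by rewrite in_itv in xab.
by rewrite seg_intZl ?(fE x xab)//; [ring|exact: L1S fi].
Qed.

Lemma ACB a b f g f' g' : AC a b f f' -> AC a b g g' ->
  AC a b (fun x => f x - g x) (fun x => f' x - g' x).
Proof.
move=> ff /(ACZ (-1)) /(ACD ff).
by apply: AC_ext => x _; rewrite mulN1r.
Qed.

Lemma MVT_between F f (u v : R) : (forall x, is_derive x 1 F (f x)) ->
  exists c, [/\ Num.min u v <= c, c <= Num.max u v & F v - F u = f c * (v - u)].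
Proof.
move=> dF.
have cF w z : {within `[w, z], continuous F}.
  apply: within_continuousT => x; apply: differentiable_continuous.
  by apply/derivable1_diffP; exact: ex_derive.
have [uv|vu] := leP u v.
  have [c] := @MVT_segment _ F f u v uv (fun x _ => dF x) (cF _ _).
  by rewrite in_itv/= => /andP[? ?] ?; exists c.
have [c] := @MVT_segment _ F f v u (ltW vu) (fun x _ => dF x) (cF _ _).
rewrite in_itv/= => /andP[? ?] FE; exists c; split => //.
by rewrite -[LHS]opprB FE; ring.
Qed.

(** * The chain rule along an absolutely continuous function *)

Section chain_rule.
Variables (F f theta kappa : R -> R) (a b : R).
Hypothesis ab : a <= b.
Hypothesis dF : forall x, is_derive x 1 F (f x).
Hypothesis cf : continuous f.
Hypothesis acT : AC a b theta kappa.

Let cT := AC_cont ab acT.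
Let cfT : {within `[a, b], continuous (fun x => f (theta x))}.
Proof. exact: within_cont_comp cT. Qed.
Let fki : L1 a b (fun x => f (theta x) * kappa x).
Proof. exact: L1_contM cfT (AC_L1 acT). Qed.

(** The mean value theorem writes the increment of [F] as [f c] times the increment of [theta], that
    is, as the integral of [f c * kappa]. Near [x] both [f c] and [f (theta y)] are within e / 2 of
    [f (theta x)]. *)
Let chain_local e : 0 < e ->
  forall x, x \in `[a, b] -> exists2 d : R, 0 < d &
     forall s t, a <= s -> x - d < s -> s <= x -> x <= t -> t < x + d -> t <= b ->
  `| F (theta t) - F (theta s) - seg_int s t (fun x => f (theta x) * kappa x) |
    <= e * seg_int s t (fun x => `|kappa x|).
Proof.
move=> e0 x xab.
have e20 : 0 < e / 2 by rewrite divr_gt0.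
have cfx : f y @[y --> theta x] --> f (theta x) by exact: cf.
have /cvgrPdist_le /(_ _ e20) /nbhs_ballP[d' /= d'0 d'P] := cfx.
have /subspace_continuousP /(_ x xab) /cvgrPdist_lt /(_ _ d'0) := cT.
move=> /nbhs_ballP[d /= d0 dP].
exists d => // s t as_ xds sx xt txd tb.
have st := le_trans sx xt.
have near y : s <= y -> y <= t -> `|theta x - theta y| < d'.
  move=> sy yt; apply: dP; last by rewrite /= in_itv/= (le_trans as_)// (le_trans yt).
  rewrite /ball/= ltr_distlC; apply/andP; split; lra.
have [c [mc cM FE]] := MVT_between (theta s) (theta t) dF.
have cx : `|theta x - c| < d'.
  have := near s (lexx _) st; have := near t st (lexx _).
  rewrite !ltr_distlC => /andP[t1 t2] /andP[s1 s2].
  move: mc cM; rewrite ge_min le_max => /orP[] ? /orP[] ?; apply/andP; split; lra.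
rewrite FE (AC_diff acT as_ st tb).
have ki : L1 s t kappa by exact: L1S (AC_L1 acT).
rewrite -seg_intZl// -seg_intB; [|exact: L1Zl|exact: L1S fki].
apply: (le_trans (seg_int_norm _)).
  by apply: L1B; [exact: L1Zl|exact: L1S fki].
rewrite -seg_intZl; last exact: L1_norm.
apply: le_seg_int.
- by apply: L1_norm; apply: L1B; [exact: L1Zl|exact: L1S fki].
- by apply: L1Zl; exact: L1_norm.
- move=> y; rewrite in_itv/= => /andP[sy yt].
  rewrite -mulrBl normrM ler_wpM2r//.
  have h1 := d'P _ cx.
  have h2 := d'P _ (near _ sy yt).
  rewrite -[f c - _](subrKA (f (theta x))) (le_trans (ler_normD _ _))//.
  rewrite (splitr e) lerD//.
  by rewrite distrC.
Qed.

(** The local error bound is additive over adjacent segments, so Cousin's lemma makes it global. The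
    error is then at most [e * K] for every positive [e], hence zero. *)
Lemma AC_chain : F (theta b) - F (theta a) =
  seg_int a b (fun x => f (theta x) * kappa x).
Proof.
set D := fun s t => F (theta t) - F (theta s) -
  seg_int s t (fun x => f (theta x) * kappa x).
set K := seg_int a b (fun x => `|kappa x|).
have Dle e : 0 < e -> `|D a b| <= e * K.
  move=> e0.
  pose P s t := a <= s -> t <= b -> `|D s t| <= e * seg_int s t (fun x => `|kappa x|).
  suff: P a b by apply.
  apply: segment_ind => //.
  - move=> s t u st tu Pst Ptu as_ ub.
    rewrite (@seg_int_split _ s u t)//; last first.
      exact: L1S (L1_norm (AC_L1 acT)).
    rewrite mulrDr (le_trans _ (lerD (Pst _ _) (Ptu _ _)))//; last 2 first.
      exact: le_trans ub.
      exact: le_trans as_ st.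
    rewrite (_ : D s u = D s t + D t u) ?ler_normD//.
    rewrite /D (@seg_int_split _ s u t)//; first by ring.
    exact: L1S fki.
  - move=> x xab; have [d d0 dP] := chain_local e0 xab.
    by exists d => // s t ? ? ? ? ? ? _ _; apply: dP.
have K0 : 0 <= K by apply: seg_int_ge0.
suff : `|D a b| <= 0.
  by rewrite normr_le0 => /eqP /eqP; rewrite /D subr_eq0 => /eqP.
apply/ler_addgt0Pl => e e0; rewrite addr0.
have K1 : 0 < K + 1 by rewrite ltr_wpDl.
have := Dle (e / (K + 1)); rewrite divr_gt0// => /(_ isT) /le_trans; apply.
by rewrite mulrAC ler_pdivrMr// ler_pM2l// lerDl.
Qed.

End chain_rule.

Lemma AC_comp F f theta kappa a b : (forall x, is_derive x 1 F (f x)) ->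
  continuous f -> a <= b -> AC a b theta kappa ->
  AC a b (fun x => F (theta x)) (fun x => f (theta x) * kappa x).
Proof.
move=> dF cf ab acT; split.
  by apply: L1_contM (AC_L1 acT); apply: within_cont_comp (AC_cont ab acT).
move=> x; rewrite in_itv/= => /andP[ax xb].
rewrite -(@AC_chain F f)//; first by rewrite subrKC.
exact: AC_sub acT.
Qed.

(** Polarization, fg = ((f + g)^2 - (f - g)^2) / 4, reduces products to the chain rule for the
    square. *)
Lemma ACM a b f g f' g' : a <= b -> AC a b f f' -> AC a b g g' ->
  AC a b (fun x => f x * g x) (fun x => f' x * g x + f x * g' x).
Proof.
move=> ab acf acg.
have dsq x : is_derive x 1 (fun x : R => x ^+ 2) (2 * x).
  by apply: is_derive_eq; rewrite /GRing.scale/=; ring.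
have csq : continuous (fun x : R => 2 * x).
  by move=> x; apply: cvgM; [exact: cvg_cst|exact: cvg_id].
have := ACZ (4^-1) (ACB (AC_comp dsq csq ab (ACD acf acg))
  (AC_comp dsq csq ab (ACB acf acg))).
by apply: AC_ext => x _; field.
Qed.

Lemma AC0_cst a b f x : AC a b f (fun=> 0) -> x \in `[a, b] -> f x = f a.
Proof.
move=> [_ fE] xab; rewrite fE// seg_int_cst ?mul0r ?addr0//.
by move: xab; rewrite in_itv/= => /andP[].
Qed.

End absolutely_continuous.

(** * The lemma of du Bois-Reymond for trigonometric test functions *)

Section real_derivatives.
Context {R : realType}.
Implicit Types (f g F : R -> R) (x y t u k l : R).

Lemma der_eq f x l l' : is_derive x 1 f l -> l = l' -> is_derive x 1 f l'.
Proof. by move=> df <-. Qed.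

Lemma der_cst k x : is_derive x 1 (fun=> k) 0.
Proof. exact: is_derive_cst. Qed.

Lemma der_id x : is_derive x 1 (fun t : R => t) 1.
Proof. exact: is_derive_id. Qed.

Lemma derD f g x l m : is_derive x 1 f l -> is_derive x 1 g m ->
  is_derive x 1 (fun t => f t + g t) (l + m).
Proof. by move=> df dg; exact: (@is_deriveD _ _ _ f g). Qed.

Lemma derN f x l : is_derive x 1 f l -> is_derive x 1 (fun t => - f t) (- l).
Proof. by move=> df; exact: (@is_deriveN _ _ _ f). Qed.

Lemma derB f g x l m : is_derive x 1 f l -> is_derive x 1 g m ->
  is_derive x 1 (fun t => f t - g t) (l - m).
Proof. by move=> df dg; exact: (@is_deriveB _ _ _ f g). Qed.

Lemma derM f g x l m : is_derive x 1 f l -> is_derive x 1 g m ->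
  is_derive x 1 (fun t => f t * g t) (l * g x + f x * m).
Proof.
move=> df dg; have -> : l * g x + f x * m = f x * m + g x * l by ring.
exact: (@is_deriveM _ _ f g x 1 l m df dg).
Qed.

Lemma derZ k f x l : is_derive x 1 f l ->
  is_derive x 1 (fun t => k * f t) (k * l).
Proof. by move=> df; exact: (@is_deriveZ _ _ _ f k). Qed.

Lemma der_comp f g x l m : is_derive (g x) 1 f l -> is_derive x 1 g m ->
  is_derive x 1 (fun t => f (g t)) (l * m).
Proof. by move=> df dg; exact: (@is_derive1_comp _ f g). Qed.

Lemma derV f x l : f x != 0 -> is_derive x 1 f l ->
  is_derive x 1 (fun t => (f t)^-1) (- (f x) ^- 2 * l).
Proof. by move=> f0 df; exact: (@is_deriveV _ f). Qed.

Lemma der_cont f x l : is_derive x 1 f l -> {for x, continuous f}.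
Proof.
by move=> [df _]; apply: differentiable_continuous; exact/derivable1_diffP.
Qed.

End real_derivatives.

Section primitives.
Context {R : realType}.
Implicit Types (f F : R -> R) (x y t u k : R).

Lemma is_derive_continuous F f : (forall x, is_derive x 1 F (f x)) -> continuous F.
Proof.
move=> dF x; apply: differentiable_continuous.
by apply/derivable1_diffP; exact: ex_derive.
Qed.

Lemma continuous_primitive f : continuous f ->
  exists2 F : R -> R, F 0 = 0 & forall x, is_derive x 1 F (f x).
Proof.
move=> cf.
have cw a b : {within `[a, b], continuous f} by exact: within_continuousT.
have fi a b : L1 a b f by exact: L1_cont.
(* [seg_int] is not oriented and vanishes when its bounds are reversed, hence the case distinction.
   Differentiability is inherited from the integral started at [- M], which differs from [F] by a
   constant near [x]. *)
pose F x := if 0 <= x then seg_int 0 x f else - seg_int x 0 f.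
exists F; first by rewrite /F lexx seg_int_aa.
move=> x; pose M := `|x| + 1.
have xM : x \in `](- M), M[.
  by rewrite in_itv/= -ltr_norml /M ltrDl.
have M0 : 0 < M by rewrite /M ltr_wpDl.
have := seg_int_FTC1 (cw (- M) M) xM => dG.
have E : \forall y \near x, seg_int (- M) y f - seg_int (- M) 0 f = F y.
  near=> y.
  have /andP[My yM] : - M < y < M.
    suff : y \in `](- M), M[ by rewrite in_itv.
    by near: y; exact: near_in_itvoo.
  rewrite /F; case: ifPn => y0.
    by rewrite (@seg_int_split _ _ y 0)//; [ring|lra].
  rewrite -ltNge in y0.
  by rewrite (@seg_int_split _ _ 0 y)//; [ring|lra|lra].
have dH : is_derive x 1 (fun y => seg_int (- M) y f - seg_int (- M) 0 f) (f x).
  by apply: (der_eq (derB dG (der_cst _ _))); rewrite subr0.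
exact: near_eq_is_derive dH.
Unshelve. all: by end_near. Qed.

End primitives.

(** * Trigonometric polynomials as periodic test functions *)

Section trigonometric_polynomials.
Context {R : realType}.
Implicit Types (f F phi psi : R -> R) (x y t u k : R).

(** Products are included so that the powers of one kernel stay in the class. It is also stable
    under differentiation, which makes its members smooth. *)
Inductive trig_poly : (R -> R) -> Prop :=
| trig_cst k : trig_poly (fun=> k)
| trig_cos : trig_poly (fun t => cos (2 * pi * t))
| trig_sin : trig_poly (fun t => sin (2 * pi * t))
| trigD f g : trig_poly f -> trig_poly g -> trig_poly (fun t => f t + g t)
| trigM f g : trig_poly f -> trig_poly g -> trig_poly (fun t => f t * g t).

Lemma trig_derive f : trig_poly f ->
  exists2 f', trig_poly f' & forall x, is_derive x 1 f (f' x).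
Proof.
elim=> {f} [k|||f g _ [f' tf df] _ [g' tg dg]|f g tf [f' tf' df] tg [g' tg' dg]].
- by exists (fun=> 0); [exact: trig_cst|move=> x; exact: is_derive_cst].
- exists (fun t => - (2 * pi) * sin (2 * pi * t)).
    by apply: trigM; [exact: trig_cst|exact: trig_sin].
  move=> x; apply: (der_eq (der_comp (g := fun t => 2 * pi * t) (is_derive_cos _) (derZ _ (der_id _)))).
  by ring.
- exists (fun t => (2 * pi) * cos (2 * pi * t)).
    by apply: trigM; [exact: trig_cst|exact: trig_cos].
  move=> x; apply: (der_eq (der_comp (g := fun t => 2 * pi * t) (is_derive_sin _) (derZ _ (der_id _)))).
  by ring.
- by exists (fun t => f' t + g' t); [exact: trigD|move=> x; exact: derD].
- exists (fun t => f' t * g t + f t * g' t); first by apply: trigD; exact: trigM.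
  by move=> x; exact: derM.
Qed.

Lemma trig_periodic f : trig_poly f -> periodic f 1.
Proof.
elim=> {f} [k|||f g _ pf _ pg|f g _ pf _ pg] u //.
- by rewrite (_ : 2 * pi * (u + 1) = 2 * pi * u + pi *+ 2) ?cosD2pi//; ring.
- by rewrite (_ : 2 * pi * (u + 1) = 2 * pi * u + pi *+ 2) ?sinD2pi//; ring.
- by rewrite pf pg.
- by rewrite pf pg.
Qed.

Lemma smooth_periodic_primitive phi psi : periodic phi 1 -> smooth_periodic psi ->
  (forall x, is_derive x 1 phi (psi x)) -> smooth_periodic phi.
Proof.
move=> pphi [ppsi spsi] dphi; split => // -[|n] t.
  by rewrite /derive1n/=; exact: ex_derive.
have -> : derive1n n.+1 phi = derive1n n psi.
  rewrite /derive1n iterSr; congr iter; apply/funext => x.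
  by rewrite derive1E; exact: derive_val.
exact: spsi.
Qed.

Lemma trig_derive1n f n : trig_poly f -> trig_poly (derive1n n f).
Proof.
elim: n f => // n IH f /trig_derive[f' tf df]; rewrite /derive1n iterSr.
rewrite (_ : derive1 f = f'); first exact: IH.
by apply/funext => x; rewrite derive1E; exact: derive_val.
Qed.

Lemma trig_smooth f : trig_poly f -> smooth_periodic f.
Proof.
move=> tf; split; first exact: trig_periodic.
by move=> n t; have [f' _ df] := trig_derive (trig_derive1n n tf); exact: ex_derive.
Qed.

Lemma trig_continuous f : trig_poly f -> continuous f.
Proof. by move=> /trig_derive[f' _ df]; exact: is_derive_continuous df. Qed.

Lemma trigX f n : trig_poly f -> trig_poly (fun t => f t ^+ n).
Proof.
move=> tf; elim: n => [|n IH]; first exact: trig_cst.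
rewrite (_ : (fun _ => _) = (fun t => f t * f t ^+ n)); first exact: trigM.
by apply/funext => t; rewrite exprS.
Qed.

Lemma smooth_periodic_derive psi : smooth_periodic psi ->
  forall x, is_derive x 1 psi (derive1 psi x).
Proof.
move=> [_ d] x; apply: DeriveDef; first exact: (d 0%N).
by rewrite derive1E.
Qed.

Lemma smooth_periodic_derive_continuous psi : smooth_periodic psi ->
  continuous (derive1 psi).
Proof.
move=> [_ d] x; apply: differentiable_continuous; apply/derivable1_diffP.
exact: (d 1%N).
Qed.

Lemma smooth_periodic_continuous psi : smooth_periodic psi -> continuous psi.
Proof. by move=> /smooth_periodic_derive /is_derive_continuous. Qed.

Lemma primitive_translate F psi T u : periodic psi T -> (forall x, is_derive x 1 F (psi x)) ->
  F (u + T) - F u = F T - F 0.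
Proof.
move=> pf dF; rewrite -[X in F X - F 0]add0r.
apply: (@is_derive_0_is_cst R (fun x => F (x + T) - F x) u 0) => y.
apply: (der_eq (derB (der_comp (g := fun t => t + T) (dF _) (derD (der_id y) (der_cst _ _))) (dF y))).
by rewrite addr0 mulr1 pf subrr.
Qed.

Lemma primitive_shift psi F u : continuous psi -> periodic psi 1 ->
  (forall x, is_derive x 1 F (psi x)) -> F (u + 1) - F u = seg_int 0 1 psi.
Proof.
move=> cp pp dF; rewrite (primitive_translate u pp dF).
apply/esym/seg_int_FTC2 => //; first exact: within_continuousT.
by apply: within_continuousT; exact: is_derive_continuous dF.
Qed.

(** The zero mean of [psi] makes its primitives periodic, and the constant of integration is spent
    on a zero mean again, so that the lemma can be iterated. *)
Lemma smooth_zero_mean_primitive psi : smooth_periodic psi -> seg_int 0 1 psi = 0 ->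
  exists phi, [/\ smooth_periodic phi, seg_int 0 1 phi = 0 &
    forall x, is_derive x 1 phi (psi x)].
Proof.
move=> sp psi0; have cp := smooth_periodic_continuous sp.
have [F F0 dF] := continuous_primitive cp.
have cF := is_derive_continuous dF.
pose phi x := F x - seg_int 0 1 F.
have dphi x : is_derive x 1 phi (psi x).
  by apply: (der_eq (derB (dF x) (der_cst _ _))); rewrite subr0.
have pphi : periodic phi 1.
  move=> u; have := primitive_shift u cp sp.1 dF; rewrite psi0 => E.
  by rewrite /phi -[F (u + 1)](subrK (F u)) E add0r.
exists phi; split => //; first exact: smooth_periodic_primitive dphi.
rewrite /phi seg_intB; [|exact: continuous_L1..|].
- by rewrite [X in _ - X]seg_int_cst// subr0 mulr1 subrr.
- by apply: continuous_L1 => x; exact: cvg_cst.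
Qed.

End trigonometric_polynomials.

(** * Continuous functions orthogonal to trigonometric polynomials *)

Section dubois_reymond.
Context {R : realType}.
Implicit Types (f g h F phi psi w : R -> R) (x y t u k d tau : R).

Lemma ler_cos x y : 0 <= x -> x <= pi -> 0 <= y -> y <= pi ->
  (cos x <= cos y) = (y <= x).
Proof. by move=> *; rewrite !leNgt ltr_cos// in_itv/=; apply/andP. Qed.

Lemma ler_cos_scale x y : 0 <= x -> x <= y -> y <= 1 / 2 ->
  cos (2 * pi * y) <= cos (2 * pi * x).
Proof. by have pi0 := @pi_gt0 R; move=> *; rewrite ler_cos; nra. Qed.

Lemma cos_dist_scale x y : `|x| <= y -> y <= 1 / 2 ->
  cos (2 * pi * y) <= cos (2 * pi * x).
Proof.
move=> xy y2; rewrite -[leRHS]cos_norm normrM ger0_norm ?ler_cos_scale//.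
by rewrite mulr_ge0// pi_ge0.
Qed.

(** The bounds on [tau] keep |t - tau| below 1 - d, so that t and tau are at least d apart on the
    circle as well. Beyond 1 / 2 the cosine is reflected. *)
Lemma periodic_kernel tau d t : 0 < d -> d < tau -> tau < 1 - d -> t \in `[0, 1] ->
  d <= `|t - tau| -> cos (2 * pi * (t - tau)) <= cos (2 * pi * d).
Proof.
move=> d0 dtau taud; rewrite in_itv/= => /andP[t0 t1] dt.
have pi0 := @pi_gt0 R.
rewrite -cos_norm normrM ger0_norm; last by nra.
set s := `|t - tau| in dt *.
have s1 : s <= 1 - d by rewrite /s ler_norml; apply/andP; split; lra.
have [s2|s2] := leP s (1 / 2).
  by rewrite ler_cos; nra.
rewrite -[leLHS]cosN -cosD2pi (_ : - (2 * pi * s) + pi *+ 2 = 2 * pi * (1 - s)); last by ring.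
by rewrite ler_cos; nra.
Qed.

(** If [F tau] were positive, the powers of a kernel that exceeds 1 only near [tau] would have
    integrals against [F] growing at least linearly in the exponent, by Bernoulli's inequality,
    whereas orthogonality keeps them all zero. *)
Lemma orth_trig_le0 F tau : {within `[0, 1], continuous F} ->
  (forall psi, trig_poly psi -> seg_int 0 1 (fun t => F t * psi t) = 0) ->
  tau \in `]0, 1[ -> F tau <= 0.
Proof.
move=> cF orth tau01; rewrite leNgt; apply/negP => Ft0.
have pi0 := @pi_gt0 R.
have cFt : F y @[y --> tau] --> F tau by exact: (within_contP cF tau01).
have e0 : 0 < F tau / 2 by rewrite divr_gt0.
have /cvgrPdist_le /(_ _ e0) /nbhs_ballP[d1 /= d10 d1P] := cFt.
have /andP[tau0 tau1] : 0 < tau < 1 by move: tau01; rewrite in_itv.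
pose d := Num.min (d1 / 2) (Num.min (tau / 2) ((1 - tau) / 2)).
have d0 : 0 < d by rewrite !lt_min !divr_gt0 ?subr_gt0.
have dd1 : d < d1 by rewrite /d gt_min; apply/orP; left; lra.
have dt0 : d < tau by rewrite /d !gt_min; apply/orP; right; apply/orP; left; lra.
have dt1 : d < 1 - tau by rewrite /d !gt_min; apply/orP; right; apply/orP; right; lra.
clearbody d.
set e := F tau / 2 in e0 d1P.
have Fe y : `|y - tau| <= d -> e <= F y.
  move=> yd; have := d1P y; rewrite /ball/= distrC (le_lt_trans yd dd1) => /(_ isT).
  rewrite /e ler_norml => /andP[? ?]; lra.
(* This is 1 - cos (2 pi d) + cos (2 pi (t - tau)) in expanded form. The constant puts the level 1
   exactly at distance d from tau. *)
pose psi t := (1 - cos (2 * pi * d)) +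
  (cos (2 * pi * tau) * cos (2 * pi * t) + sin (2 * pi * tau) * sin (2 * pi * t)).
have psiE t : psi t = 1 - cos (2 * pi * d) + cos (2 * pi * (t - tau)).
  by rewrite /psi mulrBr cosB; ring.
have tpsi : trig_poly psi.
  apply: trigD; first exact: trig_cst.
  by apply: trigD; apply: trigM; solve [exact: trig_cst|exact: trig_cos|exact: trig_sin].
have taud : tau < 1 - d by move: dt1; clear; rewrite ltrBrDl ltrBrDr.
have psi_far t : t \in `[0, 1] -> d <= `|t - tau| -> `|psi t| <= 1.
  move=> t01 td; have h := periodic_kernel d0 dt0 taud t01 td.
  rewrite psiE ler_norml; apply/andP; split; last lra.
  have := cos_geN1 (2 * pi * (t - tau)); have := cos_le1 (2 * pi * d); lra.
have d12 : d < 1 / 2 by lra.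
have psi_near t : `|t - tau| <= d -> 1 <= psi t.
  move=> td; rewrite psiE.
  have := cos_dist_scale td (ltW d12); lra.
pose eta := cos (2 * pi * (d / 2)) - cos (2 * pi * d).
have eta0 : 0 < eta.
  by rewrite subr_gt0 ltr_cos// ?in_itv/=; [nra|apply/andP; split; nra..].
have psi_mid t : `|t - tau| <= d / 2 -> 1 + eta <= psi t.
  move=> td; rewrite psiE /eta.
  have := cos_dist_scale td (_ : d / 2 <= 1 / 2); lra.
have [M [M0 FM]] := cont_bounded cF.
have G_lb n t : t \in `[0, 1] -> - M <= F t * psi t ^+ n.
  move=> t01; have [td|td] := leP `|t - tau| d.
    have := Fe _ td; have := psi_near _ td => p1 Fe1.
    have : 0 <= F t * psi t ^+ n by rewrite mulr_ge0 ?exprn_ge0//; lra.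
    lra.
  have : `|F t * psi t ^+ n| <= M * 1.
    rewrite normrM ler_pM// ?FM// normrX exprn_ile1//.
    by apply: psi_far => //; exact: ltW.
  by rewrite mulr1 ler_norml => /andP[].
have G_mid n t : `|t - tau| <= d / 2 -> e * (1 + n%:R * eta) <= F t * psi t ^+ n.
  move=> td; apply: ler_pM => //; first lra.
  - by rewrite addr_ge0// mulr_ge0//; lra.
  - by apply: Fe; lra.
  - apply: (@le_trans _ _ ((1 + eta) ^+ n)).
      elim: n => [|n IH]; first by rewrite mul0r addr0 expr0.
      rewrite exprS -natr1.
      have : (1 + eta) * (1 + n%:R * eta) <= (1 + eta) * (1 + eta) ^+ n.
        by rewrite ler_pM2l//; lra.
      have : 0 <= n%:R * eta * eta by rewrite !mulr_ge0//; lra.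
      lra.
    by apply: lerXn2r; rewrite ?nnegrE; [lra|have := psi_mid _ td; lra|exact: psi_mid].
(* Only the middle segment, of length [d], carries the growth. The two outer ones have total length
   1 - d and cost at most [M]. *)
have big n : e * (1 + n%:R * eta) * d - M <= 0.
  have := orth _ (trigX n tpsi) => <-.
  have Gi : L1 0 1 (fun t => F t * psi t ^+ n).
    apply: L1_contM => //; apply: continuous_L1.
    exact: trig_continuous (trigX n tpsi).
  have l1 : 0 <= tau - d / 2 by lra.
  have l2 : tau - d / 2 <= tau + d / 2 by lra.
  have l3 : tau + d / 2 <= 1 by lra.
  rewrite (@seg_int_split _ 0 1 (tau - d / 2))//; last by lra.
  rewrite (@seg_int_split _ (tau - d / 2) 1 (tau + d / 2))//; last by apply: L1S Gi; lra.
  have ci k a b : L1 a b (fun=> k) by apply: continuous_L1 => x; exact: cvg_cst.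
  have i1 : - M * (tau - d / 2 - 0) <= seg_int 0 (tau - d / 2) (fun t => F t * psi t ^+ n).
    rewrite -seg_int_cst//; apply: le_seg_int => //; first by apply: L1S Gi; lra.
    by move=> t; rewrite in_itv/= => /andP[? ?]; apply: G_lb; rewrite in_itv/=; apply/andP; split; lra.
  have i2 : e * (1 + n%:R * eta) * (tau + d / 2 - (tau - d / 2)) <=
      seg_int (tau - d / 2) (tau + d / 2) (fun t => F t * psi t ^+ n).
    rewrite -seg_int_cst//; apply: le_seg_int => //; first by apply: L1S Gi; lra.
    move=> t; rewrite in_itv/= => /andP[? ?]; apply: G_mid.
    by rewrite ler_norml; apply/andP; split; lra.
  have i3 : - M * (1 - (tau + d / 2)) <= seg_int (tau + d / 2) 1 (fun t => F t * psi t ^+ n).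
    rewrite -seg_int_cst//; apply: le_seg_int => //; first by apply: L1S Gi; lra.
    by move=> t; rewrite in_itv/= => /andP[? ?]; apply: G_lb; rewrite in_itv/=; apply/andP; split; lra.
  have : 0 <= M * d by rewrite mulr_ge0// ltW.
  move: i1 i2 i3; set A := seg_int _ _ _; set B := seg_int _ _ _; set C := seg_int _ _ _.
  move: (e * _) => E; lra.
have ede : 0 < e * eta * d by rewrite !mulr_gt0.
have := big (Num.bound (M / (e * eta * d))).
have := archi_boundP (ltW (divr_gt0 M0 ede)).
rewrite ltr_pdivrMr// => h1 h2.
have : 0 < e * d by rewrite mulr_gt0.
lra.
Qed.

Lemma orth_trig_eq0 F : {within `[0, 1], continuous F} ->
  (forall psi, trig_poly psi -> seg_int 0 1 (fun t => F t * psi t) = 0) ->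
  forall t, t \in `]0, 1[ -> F t = 0.
Proof.
move=> cF orth t t01; apply/eqP; rewrite eq_le orth_trig_le0//=.
rewrite -oppr_le0; apply: (@orth_trig_le0 (fun t => - F t)) => //.
  exact: within_contN.
move=> psi tpsi; rewrite (@eq_seg_int _ _ _ _ (fun t => - (F t * psi t))); last first.
  by move=> x _; rewrite mulNr.
rewrite seg_intN ?orth ?oppr0//.
by apply: L1_contM => //; apply: continuous_L1; exact: trig_continuous.
Qed.

Lemma within_cont_eq_itv f k : {within `[0, 1], continuous f} ->
  (forall t, t \in `]0, 1[ -> f t = k) -> forall t, t \in `[0, 1] -> f t = k.
Proof.
move=> /(continuous_within_itvP _ ltr01)[_ f0 f1] fk t.
rewrite in_itv/= => /andP[]; rewrite le_eqVlt => /predU1P[<- _|t0].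
  apply: (cvg_unique _ f0) => //.
  apply: cvg_near_cst; near=> x; apply: fk; rewrite in_itv/=; apply/andP; split.
    by near: x; exact: nbhs_right_gt.
  by near: x; exact: nbhs_right_lt.
rewrite le_eqVlt => /predU1P[->|t1]; last by apply: fk; rewrite in_itv/= t0.
apply: (cvg_unique _ f1) => //.
apply: cvg_near_cst; near=> x; apply: fk; rewrite in_itv/=; apply/andP; split.
  by near: x; exact: nbhs_left_gt.
by near: x; exact: nbhs_left_lt.
Unshelve. all: by end_near. Qed.

(** Once its mean is subtracted, [F] is orthogonal to the constants too, hence to every
    trigonometric polynomial. *)
Lemma orth_zero_mean_cst F : {within `[0, 1], continuous F} ->
  (forall psi, trig_poly psi -> seg_int 0 1 psi = 0 ->
     seg_int 0 1 (fun t => F t * psi t) = 0) ->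
  forall t, t \in `[0, 1] -> F t = F 0.
Proof.
move=> cF orth.
set m := seg_int 0 1 F.
have ci k a b : L1 a b (fun=> k) by apply: continuous_L1 => x; exact: cvg_cst.
have E : forall t, t \in `]0, 1[ -> F t - m = 0.
  apply: (@orth_trig_eq0 (fun t => F t - m)).
    by apply: within_contB => //; exact: within_cont_cst.
  move=> psi tpsi; set c := seg_int 0 1 psi.
  have pi_ : L1 0 1 psi by apply: continuous_L1; exact: trig_continuous.
  have tp0 : trig_poly (fun t => psi t + - c) by apply: trigD => //; exact: trig_cst.
  have p0 : seg_int 0 1 (fun t => psi t + - c) = 0.
    by rewrite seg_intD// seg_int_cst// subr0 mulr1 subrr.
  have Fi : L1 0 1 F by exact: L1_cont.
  have Fpi : L1 0 1 (fun t => F t * (psi t + - c)).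
    by apply: L1_contM => //; apply: L1D.
  rewrite (@eq_seg_int _ _ _ _ (fun t => F t * (psi t + - c) + (c * F t + - m * psi t))); last first.
    by move=> t _; ring.
  rewrite seg_intD//; last by apply: L1D; exact: L1Zl.
  rewrite orth// seg_intD; [|exact: L1Zl..].
  by rewrite !seg_intZl// -/m -/c; ring.
move=> t t01.
have Fm : forall t, t \in `[0, 1] -> F t = m.
  by apply: within_cont_eq_itv => // s /E /eqP; rewrite subr_eq0 => /eqP.
by rewrite !Fm// in_itv/= lexx ler01.
Qed.

End dubois_reymond.

(** * Sobolev functions on the circle *)

Section periodic_functions.
Context {R : realType}.
Implicit Types (f g h F phi psi w : R -> R) (x y t u k : R) (n : int).

Lemma periodic_int f t n : periodic f 1 -> f (t + n%:~R) = f t.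
Proof.
move=> pf; case: n => n.
  rewrite -pmulrn; elim: n => [|n IH]; first by rewrite addr0.
  by rewrite -natr1 addrA pf.
rewrite NegzE mulrNz -pmulrn; elim: n => [|n IH]; first by rewrite -[RHS]pf -[in RHS](subrK 1 t) pf.
by rewrite -[LHS]pf -natr1 opprD addrA subrK.
Qed.

Lemma periodic_frac f t : periodic f 1 -> f t = f (t - (Num.floor t)%:~R).
Proof. by move=> pf; rewrite -mulrNz periodic_int. Qed.

Lemma frac_itv t : t - (Num.floor t)%:~R \in `[0, 1[.
Proof.
have := floor_itv t; rewrite rmorphD/= in_itv/= => /andP[? ?].
by apply/andP; split; lra.
Qed.

Lemma periodic_eq f g : periodic f 1 -> periodic g 1 ->
  (forall t, t \in `[0, 1] -> f t = g t) -> f = g.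
Proof.
move=> pf pg fg; apply/funext => t.
rewrite (periodic_frac _ pf) (periodic_frac _ pg); apply: fg.
by have := frac_itv t; rewrite !in_itv/= => /andP[-> /ltW].
Qed.

Lemma continuous_int_segments f :
  (forall n, {within `[n%:~R, n%:~R + 1], continuous f}) -> continuous f.
Proof.
move=> cf x; have /andP[nx xn] := floor_itv x.
set n := Num.floor x in nx xn; rewrite rmorphD/= in xn.
move: nx; rewrite le_eqVlt => /predU1P[nx|nx]; last first.
  by apply: (within_contP (cf n)); rewrite in_itv/= nx.
apply/left_right_continuousP; split.
  have /(continuous_within_itvP _ _)[|_ _] := cf (n - 1); first by rewrite ltrDl.
  by rewrite rmorphB/= subrK nx.
have /(continuous_within_itvP _ _)[|_ + _] := cf n; first by rewrite ltrDl.
by rewrite nx.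
Qed.

Definition periodic_ext f t := f (t - (Num.floor t)%:~R).

Lemma periodic_ext_periodic f : periodic (periodic_ext f) 1.
Proof.
move=> t; rewrite /periodic_ext floorDrz ?rpred1// floor1 rmorphD/=.
by congr f; ring.
Qed.

Lemma periodic_ext_seg f n t : f 0 = f 1 -> n%:~R <= t -> t <= n%:~R + 1 ->
  periodic_ext f t = f (t - n%:~R).
Proof.
move=> f01 nt; rewrite le_eqVlt => /predU1P[->|tn].
  rewrite /periodic_ext (@floor_def _ _ (n + 1)); last first.
    by rewrite !rmorphD/= lexx ltrDl ltr01.
  by rewrite rmorphD/= subrr f01; congr f; ring.
rewrite /periodic_ext (@floor_def _ _ n)//.
by rewrite nt rmorphD.
Qed.

Lemma periodic_ext_continuous f : f 0 = f 1 -> {within `[0, 1], continuous f} ->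
  continuous (periodic_ext f).
Proof.
move=> f01 cf; apply: continuous_int_segments => n.
apply: (within_cont_eq (f := fun t => f (t - n%:~R))).
  by move=> t /=; rewrite in_itv/= => /andP[nt tn]; rewrite (periodic_ext_seg f01 nt tn).
apply/subspace_continuousP => t tn.
move/subspace_continuousP : cf => /(_ (t - n%:~R)) cf.
have tn' : `[0, 1]%classic (t - n%:~R).
  by move: tn; rewrite /= !in_itv/= => /andP[? ?]; apply/andP; split; lra.
apply: cvg_comp (cf tn').
move=> A /= /nbhs_ballP[e e0 eA]; apply/nbhs_ballP; exists e => // s /= ts sn.
apply: eA.
  by move: ts; rewrite /ball/= (_ : t - n%:~R - (s - n%:~R) = t - s)//; ring.
by move: sn; rewrite /= !in_itv/= => /andP[? ?]; apply/andP; split; lra.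
Qed.

Lemma periodic_bounded f : periodic f 1 -> continuous f ->
  exists2 M : R, 0 < M & forall t, `|f t| <= M.
Proof.
move=> pf cf.
have [M [M0 fM]] := cont_bounded (within_continuousT (A := `[0, 1]) cf).
exists M => // t; rewrite (periodic_frac _ pf); apply: fM.
by have := frac_itv t; rewrite !in_itv/= => /andP[-> /ltW].
Qed.

End periodic_functions.

(** * Weak derivatives and C^1 representatives on the circle *)

Section circle_Lp.
Context {R : realType}.
Implicit Types (f g h F phi psi w V : R -> R) (x y t u k p : R).

Lemma Lfun1_L1 f : f \in Lfun (@circle_measure R) 1%:E -> L1 0 1 f.
Proof.
move=> /Lfun1_integrable fi.
have mf : measurable_fun [set: R] f by move/integrableP : fi => [/measurable_EFinP].
apply/integrableP; split.
  by apply/measurable_EFinP; exact: measurable_funTS.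
have /integrableP[_] := fi; apply: le_lt_trans.
rewrite (_ : (\int[lebesgue_measure]_(x in `[0%R, 1%R]) _ =
    \int[@circle_measure R]_(x in `[0%R, 1%R]) `|(EFin \o f) x|)%E); last first.
  apply: eq_measure_integral => A mA A01.
  by rewrite /circle_measure/= /mrestr setIidl.
apply: ge0_subset_integral => //.
by apply/measurable_EFinP; exact: measurableT_comp.
Qed.

Lemma periodic_Lfun p f : 1 <= p -> periodic f 1 -> continuous f ->
  f \in Lfun (@circle_measure R) p%:E.
Proof.
move=> p1 pf cf.
have mf : measurable_fun [set: R] f by exact: continuous_measurable_fun.
have [M M0 fM] := periodic_bounded pf cf.
apply/andP; split; rewrite inE//= /finite_norm.
rewrite unlock; apply: poweR_lty.
have ci : (@circle_measure R).-integrable setT (EFin \o (fun x => `|f x| `^ p)).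
  apply: measurable_bounded_integrable => //.
  - rewrite /circle_measure/= /mrestr/= setTI lebesgue_measure_itv/= lte_fin ltr01.
    by rewrite -EFinD ltry.
  - apply: (measurableT_comp (measurable_powR _)) => //.
    exact: measurableT_comp.
  exists (M `^ p); split; rewrite ?num_real// => y My x _ /=.
  rewrite ger0_norm ?powR_ge0// (le_trans _ (ltW My))//.
  by apply: ge0_ler_powR; rewrite ?nnegrE ?fM//; lra.
have /integrableP[_] := ci; apply: le_lt_trans.
rewrite le_eqVlt; apply/orP; left; apply/eqP; apply: eq_integral => x _ /=.
by rewrite [in RHS]ger0_norm ?powR_ge0.
Qed.

(** Integration by parts gives the primitive [W] of [w] the same pairing as [f] with every
    derivative of a test function. Zero-mean trigonometric polynomials are such derivatives, so
    [f - W] is constant. *)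
Lemma weak_deriv_AC f w : {within `[0, 1], continuous f} -> is_weak_deriv f w ->
  AC 0 1 f w.
Proof.
move=> cf [_ /Lfun1_L1 wi wd].
have wd' phi : smooth_periodic phi ->
    seg_int 0 1 (fun t => f t * derive1 phi t) = - seg_int 0 1 (fun t => w t * phi t).
  exact: wd.
pose W x := 0 + seg_int 0 x w.
have acW : AC 0 1 W w by exact: AC_int.
have cW := AC_cont ler01 acW.
(* The constant test function shows that [w] has zero mean, which makes the boundary term at 1
   vanish below. *)
have w0 : seg_int 0 1 w = 0.
  have := wd' _ (trig_smooth (trig_cst 1)).
  rewrite (@eq_seg_int _ _ _ _ (fun=> 0)); last first.
    by move=> t _; rewrite derive1_cst mulr0.
  rewrite seg_int_cst// mul0r => /esym/eqP; rewrite oppr_eq0 => /eqP h0; rewrite -[RHS]h0.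
  by apply: eq_seg_int => t _; rewrite mulr1.
have fW : forall t, t \in `[0, 1] -> f t - W t = f 0 - W 0.
  apply: (@orth_zero_mean_cst R (fun t => f t - W t)).
    exact: within_contB.
  move=> psi tpsi psi0.
  have [phi [sphi _ dphi]] := smooth_zero_mean_primitive (trig_smooth tpsi) psi0.
  have cpsi := trig_continuous tpsi.
  have cphi := smooth_periodic_continuous sphi.
  have phiE : derive1 phi = psi.
    by apply/funext => x; rewrite derive1E; exact: derive_val.
  have acphi : AC 0 1 phi psi.
    by apply: C1_AC => //; exact: within_continuousT.
  have [_ /(_ 1)] := ACM ler01 acW acphi.
  rewrite in_itv/= lexx ler01 => /(_ isT).
  have W1 : W 1 = 0 by rewrite /W w0 addr0.
  have W0 : W 0 = 0 by rewrite /W seg_int_aa addr0.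
  have Wi : L1 0 1 (fun t => W t * psi t).
    by apply: L1_contM => //; exact: continuous_L1.
  have wphi : L1 0 1 (fun t => w t * phi t).
    have := L1_contM (within_continuousT (A := `[0, 1]) cphi) wi.
    by apply: eq_L1 => t _; rewrite mulrC.
  rewrite W1 W0 !mul0r add0r seg_intD// => /esym/eqP; rewrite addrC addr_eq0 => /eqP E.
  have fi : L1 0 1 (fun t => f t * psi t).
    by apply: L1_contM => //; exact: continuous_L1.
  rewrite (@eq_seg_int _ _ _ _ (fun t => f t * psi t - W t * psi t)); last first.
    by move=> t _; rewrite mulrBl.
  by rewrite seg_intB// E -phiE wd' ?subrr.
split => // t t01; have := fW t t01.
rewrite /W seg_int_aa !add0r subr0 => <-; by rewrite subrK.
Qed.

Lemma AC_weak_deriv f w : f \in Lfun (@circle_measure R) 1%:E ->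
  w \in Lfun (@circle_measure R) 1%:E -> AC 0 1 f w -> f 0 = f 1 -> is_weak_deriv f w.
Proof.
move=> fL wL acf f01; split => // phi sphi.
have cphi := smooth_periodic_continuous sphi.
have cphi' := smooth_periodic_derive_continuous sphi.
have acphi : AC 0 1 phi (derive1 phi).
  apply: C1_AC; [exact: within_continuousT..|].
  by move=> x _; exact: smooth_periodic_derive.
have [_ /(_ 1)] := ACM ler01 acf acphi.
rewrite in_itv/= lexx ler01 => /(_ isT).
have phi01 : phi 1 = phi 0 by rewrite -[X in phi X = _](add0r 1) sphi.1.
have cf := AC_cont ler01 acf.
have i1 : L1 0 1 (fun t => f t * derive1 phi t).
  by apply: L1_contM => //; exact: continuous_L1.
have i2 : L1 0 1 (fun t => w t * phi t).
  have := L1_contM (within_continuousT (A := `[0, 1]) cphi) (AC_L1 acf).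
  by apply: eq_L1 => t _; rewrite mulrC.
rewrite seg_intD// -f01 phi01 -[LHS]addr0 => /addrI /esym/eqP.
rewrite addr_eq0 => /eqP h.
rewrite -[LHS]/(seg_int 0 1 (fun t => f t * derive1 phi t)).
by rewrite -[X in _ = - X]/(seg_int 0 1 (fun t => w t * phi t)) h opprK.
Qed.

Lemma weak_derivP f w : is_weak_deriv f w -> is_weak_deriv f (weak_deriv f).
Proof. by move=> fw; rewrite /weak_deriv; apply: xgetPex; exists w. Qed.

(** The second weak derivative [h] is integrated twice, with constants that keep each primitive
    periodic. The result [G] and [f] have the same pairing with second derivatives of test
    functions, so they differ by a constant, everywhere because both are continuous. *)
Lemma W2p_C1 p f : 1 <= p -> W2p p f -> exists V : R -> R,
  [/\ continuous V, periodic V 1, forall x, is_derive x 1 f (V x) &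
      AC 0 1 V (weak_deriv (derive1 f))].
Proof.
move=> p1 [pf cf _ [g [h [_ _ [fL gL fg] [_ hL gh]]]]].
have hi := Lfun1_L1 hL.
have fg' phi : smooth_periodic phi ->
    seg_int 0 1 (fun t => f t * derive1 phi t) = - seg_int 0 1 (fun t => g t * phi t).
  exact: fg.
have gh' phi : smooth_periodic phi ->
    seg_int 0 1 (fun t => g t * derive1 phi t) = - seg_int 0 1 (fun t => h t * phi t).
  exact: gh.
have h0 : seg_int 0 1 h = 0.
  have := gh' _ (trig_smooth (trig_cst 1)).
  rewrite (@eq_seg_int _ _ _ _ (fun=> 0)); last first.
    by move=> t _; rewrite derive1_cst mulr0.
  rewrite seg_int_cst// mul0r => /esym/eqP; rewrite oppr_eq0 => /eqP h0; rewrite -[RHS]h0.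
  by apply: eq_seg_int => t _; rewrite mulr1.
(* Subtracting the mean [m] gives [V] a zero integral over the circle, which is what makes its
   primitive [G] periodic. *)
pose m := seg_int 0 1 (fun x => seg_int 0 x h).
pose H x := - m + seg_int 0 x h.
have acH : AC 0 1 H h by exact: AC_int.
have cH := AC_cont ler01 acH.
have H01 : H 0 = H 1 by rewrite /H h0 seg_int_aa.
pose V := periodic_ext H.
have cV : continuous V by exact: periodic_ext_continuous.
have pV : periodic V 1 by exact: periodic_ext_periodic.
have VH t : t \in `[0, 1] -> V t = H t.
  rewrite in_itv/= => /andP[t0 t1].
  rewrite /V (@periodic_ext_seg _ H 0 t)//; last by rewrite add0r.
  by rewrite subr0.
have V0 : seg_int 0 1 V = 0.
  rewrite (eq_seg_int VH) /H seg_intD; first by rewrite seg_int_cst// -/m; ring.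
    by apply: continuous_L1 => x; exact: cvg_cst.
  apply: L1_cont; exact: seg_int_cont.
have acV : AC 0 1 V h by apply: AC_ext acH => // t /VH.
have [G G0 dG] := continuous_primitive cV.
have cG := is_derive_continuous dG.
have pG : periodic G 1.
  move=> u; apply/eqP; rewrite -subr_eq0; apply/eqP.
  by rewrite (primitive_shift u cV pV dG).
have acG : AC 0 1 G V by apply: C1_AC => //; exact: within_continuousT.
have ei A : continuous A -> L1 0 1 A by exact: continuous_L1.
have fG : forall t, t \in `[0, 1] -> f t - G t = f 0 - G 0.
  apply: (@orth_zero_mean_cst R (fun t => f t - G t)).
    by apply: within_contB; exact: within_continuousT.
  move=> psi tpsi psi0.
  have [phi1 [sphi1 phi10 dphi1]] := smooth_zero_mean_primitive (trig_smooth tpsi) psi0.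
  have [phi [sphi _ dphi]] := smooth_zero_mean_primitive sphi1 phi10.
  have cpsi := trig_continuous tpsi.
  have cphi := smooth_periodic_continuous sphi.
  have cphi1 := smooth_periodic_continuous sphi1.
  have phi1E : derive1 phi1 = psi.
    by apply/funext => x; rewrite derive1E; exact: derive_val.
  have phiE : derive1 phi = phi1.
    by apply/funext => x; rewrite derive1E; exact: derive_val.
  have gVL : is_weak_deriv G V.
    apply: AC_weak_deriv => //; try exact: periodic_Lfun.
    by rewrite -[X in _ = G X](add0r 1) pG.
  have VhL : is_weak_deriv V h.
    apply: AC_weak_deriv => //; try exact: periodic_Lfun.
    by rewrite -[X in _ = V X](add0r 1) pV.
  have E1 : seg_int 0 1 (fun t => f t * psi t) = seg_int 0 1 (fun t => h t * phi t).
    by rewrite -phi1E fg'// -phiE gh'// opprK.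
  have E2 : seg_int 0 1 (fun t => G t * psi t) = seg_int 0 1 (fun t => h t * phi t).
    have [_ _ w1] := gVL; have [_ _ w2] := VhL.
    have w1' : seg_int 0 1 (fun t => G t * derive1 phi1 t) =
      - seg_int 0 1 (fun t => V t * phi1 t) by exact: w1.
    have w2' : seg_int 0 1 (fun t => V t * derive1 phi t) =
      - seg_int 0 1 (fun t => h t * phi t) by exact: w2.
    by rewrite -phi1E w1' -phiE w2' opprK.
  rewrite (@eq_seg_int _ _ _ _ (fun t => f t * psi t - G t * psi t)); last first.
    by move=> t _; rewrite mulrBl.
  by rewrite seg_intB ?E1 ?E2 ?subrr//; apply: ei => x; apply: cvgM;
    [exact: cf|exact: cpsi|exact: cG|exact: cpsi].
have fE : f = (fun t => G t + (f 0 - G 0)).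
  apply: periodic_eq => //; first by move=> t; rewrite pG.
  by move=> t /fG <-; rewrite addrC subrK.
have df x : is_derive x 1 f (V x).
  by rewrite fE; apply: (der_eq (derD (dG x) (der_cst _ _))); rewrite addr0.
have f'E : derive1 f = V.
  by apply/funext => x; rewrite derive1E; exact: derive_val.
exists V; split => //; rewrite f'E.
apply: weak_deriv_AC; first exact: within_continuousT.
(* [weak_deriv] is a choice; exhibiting [h] ensures that it selects an actual weak derivative and
   not the default value. *)
apply: (@weak_derivP _ h); apply: AC_weak_deriv => //; first exact: periodic_Lfun.
by rewrite -[X in _ = V X](add0r 1) pV.
Qed.

End circle_Lp.

(** * Elliptic integrals *)

Section improper_integrals.
Context {R : realType}.
Implicit Types (f g F : R -> R) (a b x y : R).

Lemma L1_EFin a b f : L1 a b f ->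
  (\int[lebesgue_measure]_(x in `[a, b]) (f x)%:E)%E = (seg_int a b f)%:E.
Proof.
move=> fi; rewrite /seg_int /Rintegral fineK//.
by apply: integrable_fin_num fi.
Qed.

(* [f b] is irrelevant, so [f] may blow up at [b]. *)
Lemma improper_FTC2 a b f F : a < b -> {within `[a, b], continuous F} ->
  (forall x, x \in `[a, b[ -> {for x, continuous f}) ->
  (forall x, x \in `[a, b[ -> 0 <= f x) ->
  (forall x, x \in `]a, b[ -> is_derive x 1 F (f x)) ->
  L1 a b f /\ seg_int a b f = F b - F a.
Proof.
move=> ab cF cf f0 dF.
(* The bounds [c n] increase to [b] from below. On each [[a, c n]] the usual theorem applies, and
   monotone convergence passes to the limit. *)
pose c (n : nat) := b - (b - a) / n.+1%:R.
have ba0 : 0 < b - a by rewrite subr_gt0.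
have ac n : a <= c n.
  by rewrite /c lerBrDr addrC -lerBrDr ler_pdivrMr// ler_peMr ?ler1n// ltW.
have cb n : c n < b by rewrite /c ltrBlDr ltrDl divr_gt0.
have c_nd (n n' : nat) : (n <= n')%N -> c n <= c n'.
  by move=> nn; rewrite /c lerB// ler_pM2l// lef_pV2 ?posrE// ler_nat ltnS.
have cfn n : {within `[a, c n], continuous f}.
  apply/subspace_continuousP => x; rewrite /= in_itv/= => /andP[ax xc].
  apply: cvg_within_filter; apply: cf; rewrite in_itv/= ax/=.
  exact: le_lt_trans (cb n).
have sub n : `[a, c n]%classic `<=` `[a, b[%classic.
  by move=> x /=; rewrite !in_itv/= => /andP[-> /le_lt_trans]; apply.
have mfo : measurable_fun `[a, b[ f.
  apply: subspace_continuous_measurable_fun => //.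
  by apply/subspace_continuousP => x xab; apply: cvg_within_filter; exact: cf.
have bigU : \bigcup_n `[a, c n]%classic = `[a, b[%classic.
  apply/seteqP; split => [x [n _]|x /=]; first exact: sub.
  rewrite in_itv/= => /andP[ax xb].
  have bx0 : 0 < b - x by rewrite subr_gt0.
  exists (Num.bound ((b - a) / (b - x))) => //=; rewrite in_itv/= ax/= /c.
  rewrite lerBrDr addrC -lerBrDr ler_pdivrMr//.
  have := archi_boundP (ltW (divr_gt0 ba0 bx0)).
  rewrite ltr_pdivrMr// => /ltW/le_trans; apply.
  by rewrite mulrC ler_pM2l// ler_nat.
have cvgI := @ge0_nondecreasing_set_cvg_integral _ (measurableTypeR R) R (fun n => `[a, c n]%classic)
  (EFin \o f) lebesgue_measure.
have {}cvgI : (\int[lebesgue_measure]_(x in `[a, c n]) (EFin \o f) x)%E @[n --> \oo]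
    --> (\int[lebesgue_measure]_(x in `[a, b[) (EFin \o f) x)%E.
  rewrite -bigU; apply: cvgI => //.
  - move=> n n' nn; rewrite subsetEset; apply: subset_itvl; rewrite bnd_simp.
    exact: c_nd.
  - by move=> n; apply/measurable_EFinP; exact: measurable_funS (sub n) mfo.
  - by move=> n x /sub xab; rewrite lee_fin f0.
have In n : (\int[lebesgue_measure]_(x in `[a, c n]) (EFin \o f) x = (F (c n) - F a)%:E)%E.
  have <- : seg_int a (c n) f = F (c n) - F a; last by apply: L1_EFin; exact: L1_cont.
  apply: seg_int_FTC2 => //.
    by apply: within_cont_subset cF => //; exact: ltW.
  move=> x; rewrite in_itv/= => /andP[ax xc]; apply: dF.
  by rewrite in_itv/= ax (lt_trans xc).
have Fc : (F (c n) - F a)%:E @[n --> \oo] --> (F b - F a)%:E.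
  apply: cvg_EFin; first exact: nearW.
  apply: cvgB; last exact: cvg_cst.
  have /(continuous_within_itvP _ ab)[_ _ Fb] := cF.
  have /cvg_at_leftP := Fb; apply; split; first exact: cb.
  rewrite -[X in _ --> X]subr0; apply: cvgB; first exact: cvg_cst.
  rewrite -[X in _ --> X](mulr0 (b - a)); apply: cvgM; first exact: cvg_cst.
  exact: cvg_harmonic.
have E : (\int[lebesgue_measure]_(x in `[a, b[) (EFin \o f) x = (F b - F a)%:E)%E.
  have h : (fun n => \int[lebesgue_measure]_(x in `[a, c n]) (EFin \o f) x)%E =
    (fun n => (F (c n) - F a)%:E) by apply/funext.
  by move: cvgI; rewrite h => cvgI; exact: cvg_unique cvgI Fc.
have mfc : measurable_fun `[a, b] f by apply/measurable_fun_itv_bndo_bndcP.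
have E' : (\int[lebesgue_measure]_(x in `[a, b]) (EFin \o f) x = (F b - F a)%:E)%E.
  by rewrite -integral_itv_bndo_bndc//; apply/measurable_EFinP.
split; last by rewrite /seg_int /Rintegral E'.
apply/integrableP; split; first exact/measurable_EFinP.
have -> : (\int[lebesgue_measure]_(x in `[a, b]) `|(EFin \o f) x| =
    \int[lebesgue_measure]_(x in `[a, b]) (EFin \o f) x)%E; last by rewrite E' ltry.
have mfE : measurable_fun `[a, b[ (EFin \o f) by apply/measurable_EFinP.
have mnfE : measurable_fun `[a, b[ (fun x => `|(EFin \o f) x|)%E.
  exact: measurableT_comp.
rewrite -!integral_itv_bndo_bndc//.
by apply: eq_integral => x; rewrite inE/= => xab; rewrite ger0_norm// f0.
Qed.

Lemma continuous_norm_powR (r : R) : 0 < r -> continuous (fun x : R => `|x| `^ r).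
Proof.
move=> r0 x; have [->|x0] := eqVneq x 0; last first.
  have nx0 : 0 < `|x| by rewrite normr_gt0.
  apply: (@cvg_comp _ _ _ (fun y => `|y|) (fun y => y `^ r) _ (nbhs `|x|)).
    exact: (cvg_norm cvg_id).
  apply: (@differentiable_continuous _ _ _ `|x| (fun y => y `^ r)); apply/derivable1_diffP.
  by have [] := is_derive1_powR r nx0.
apply/cvgrPdist_lt => e e0 /=; apply/nbhs_ballP; exists (e `^ r^-1) => /=.
  exact: powR_gt0.
move=> y; rewrite /ball/= sub0r normrN normr0 powR0 ?gt_eqF// sub0r normrN.
move=> ye; rewrite ger0_norm ?powR_ge0//.
have -> : e = (e `^ r^-1) `^ r by rewrite -powRrM mulVf ?gt_eqF// powRr1// ltW.
by rewrite gt0_ltr_powR// nnegrE// powR_ge0.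
Qed.

End improper_integrals.

Section elliptic_integrands.
Context {R : realType}.
Implicit Types (q r s t x : R).

Definition dn q t : R := Num.sqrt (1 - q ^+ 2 * sin t ^+ 2).

Lemma dn_arg_gt0 q t : 0 <= q -> q < 1 -> 0 < 1 - q ^+ 2 * sin t ^+ 2.
Proof.
move=> q0 q1; have s1 : sin t ^+ 2 <= 1 by have := cos2Dsin2 t; nra.
have s0 := sqr_ge0 (sin t); nra.
Qed.

Lemma dn_gt0 q t : 0 <= q -> q < 1 -> 0 < dn q t.
Proof. by move=> q0 q1; rewrite sqrtr_gt0 dn_arg_gt0. Qed.

Lemma dn_sqr q t : 0 <= q -> q < 1 -> dn q t ^+ 2 = 1 - q ^+ 2 * sin t ^+ 2.
Proof. by move=> q0 q1; rewrite sqr_sqrtr// ltW// dn_arg_gt0. Qed.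

Lemma derX2 (f : R -> R) x l : is_derive x 1 f l ->
  is_derive x 1 (fun t => f t ^+ 2) (2 * f x * l).
Proof.
move=> df; rewrite (_ : (fun _ => _) = (fun t => f t * f t)).
  by apply: (der_eq (derM df df)); ring.
by apply/funext => t; rewrite expr2.
Qed.

Lemma der_dn_t q t : 0 <= q -> q < 1 ->
  is_derive t 1 (dn q) (- q ^+ 2 * sin t * cos t / dn q t).
Proof.
move=> q0 q1; have d0 := dn_gt0 t q0 q1.
have dg : is_derive t 1 (fun t => 1 - q ^+ 2 * sin t ^+ 2) (0 - q ^+ 2 * (2 * sin t * cos t)).
  exact: derB (der_cst _ _) (derZ _ (derX2 (is_derive_sin t))).
apply: (der_eq (der_comp (g := fun t => 1 - q ^+ 2 * sin t ^+ 2)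
  (is_derive1_sqrt (dn_arg_gt0 t q0 q1)) dg)).
by rewrite -/(dn q t); field; rewrite gt_eqF.
Qed.

Lemma der_dn_q q t : 0 <= q -> q < 1 ->
  is_derive q 1 (fun q => dn q t) (- q * sin t ^+ 2 / dn q t).
Proof.
move=> q0 q1; have d0 := dn_gt0 t q0 q1.
have dg : is_derive q 1 (fun q => 1 - sin t ^+ 2 * q ^+ 2) (0 - sin t ^+ 2 * (2 * q * 1)).
  exact: derB (der_cst _ _) (derZ _ (derX2 (der_id q))).
have := der_comp (f := Num.sqrt) (g := (fun q => 1 - sin t ^+ 2 * q ^+ 2)) (l := (2 * dn q t)^-1) _ dg.
rewrite (mulrC (sin t ^+ 2)) => /(_ (is_derive1_sqrt (dn_arg_gt0 t q0 q1))) d.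
rewrite (_ : (fun q => dn q t) = (fun q => Num.sqrt (1 - sin t ^+ 2 * q ^+ 2))).
  by apply: (der_eq d); field; rewrite gt_eqF.
by apply/funext => u; rewrite /dn (mulrC (sin t ^+ 2)).
Qed.

Lemma dn_continuous q : 0 <= q -> q < 1 -> continuous (dn q).
Proof. by move=> q0 q1; apply: is_derive_continuous => t; exact: der_dn_t. Qed.

Lemma cos_powR_continuous s : 0 < s -> continuous (fun t : R => `|cos t| `^ s).
Proof.
move=> s0 t; apply: (@cvg_comp _ _ _ cos (fun x => `|x| `^ s)).
  exact: continuous_cos.
exact: continuous_norm_powR.
Qed.

Lemma cos_gt0_itv t : t \in `](- (pi / 2)), (pi / 2)[ -> 0 < cos t.
Proof. by rewrite in_itv/=; exact: cos_gt0_pihalf. Qed.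

Lemma der_cos_powR s t : t \in `](- (pi / 2)), (pi / 2)[ ->
  is_derive t 1 (fun t : R => `|cos t| `^ s) (s * `|cos t| `^ (s - 1) * - sin t).
Proof.
move=> tpi; have c0 := cos_gt0_itv tpi.
rewrite (gtr0_norm c0).
have d := der_comp (is_derive1_powR s c0) (is_derive_cos t).
apply: near_eq_is_derive d.
near=> u; rewrite gtr0_norm//; apply: cos_gt0_itv.
by near: u; exact: near_in_itvoo.
Unshelve. all: by end_near. Qed.

(** For r = 1 - 1/p, [ek] is the integrand of K_{1,p}, unbounded near pi / 2 when p < 2. [ej] raises
    the exponent of the cosine by 2 and is continuous for every r > 0. *)
Definition ek r q t := `|cos t| `^ (2 * r - 1) / dn q t.
Definition ej r q t := `|cos t| `^ (2 * r + 1) / dn q t.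

Lemma cos_powR_shift1 r t : cos t != 0 ->
  `|cos t| `^ (2 * r) = `|cos t| `^ (2 * r - 1) * `|cos t|.
Proof.
move=> c0; have n0 : `|cos t| != 0 by rewrite normr_eq0.
rewrite -[X in _ = _ * X]powRr1// -powRD ?n0 ?implybT//.
by congr powR; ring.
Qed.

Lemma cos_powR_shift2 r t : 0 < r ->
  `|cos t| `^ (2 * r + 1) = `|cos t| `^ (2 * r - 1) * cos t ^+ 2.
Proof.
move=> r0; have [->|c0] := eqVneq (cos t) 0.
  by rewrite expr0n/= mulr0 normr0 powR0// gt_eqF// addr_gt0// mulr_gt0.
have n0 : `|cos t| != 0 by rewrite normr_eq0.
rewrite -[X in _ = _ * X]real_normK ?num_real// -powR_mulrn// -powRD ?n0 ?implybT//.
by congr powR; ring.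
Qed.

End elliptic_integrands.

Section arc_length.
Context {R : realType}.
Variables (q r : R).
Hypotheses (q0 : 0 <= q) (q1 : q < 1) (r0 : 0 < r) (r1 : r < 1).
Implicit Types (s t x : R).

Let F t := `|cos t| `^ (2 * r) * sin t / dn q t.
Let N' t := `|cos t| `^ (2 * r + 1) *
  ((2 * r + 1) / dn q t + q ^+ 2 * sin t ^+ 2 / dn q t ^+ 3).

Let dnN t : dn q t != 0. Proof. by rewrite gt_eqF// dn_gt0. Qed.

Let dnV_cont : continuous (fun t => (dn q t)^-1).
Proof. by move=> t; apply: cvgV => //; exact: dn_continuous. Qed.

Let r20 : 0 < 2 * r. Proof. by rewrite mulr_gt0. Qed.
Let r210 : 0 < 2 * r + 1. Proof. by rewrite addr_gt0. Qed.

Lemma dn_num_cont :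
  continuous (fun t => (2 * r + 1) / dn q t + q ^+ 2 * sin t ^+ 2 / dn q t ^+ 3).
Proof.
move=> t; apply: cvgD; first by apply: cvgM; [exact: cvg_cst|exact: dnV_cont].
apply: cvgM.
  apply: cvgM; first exact: cvg_cst.
  by apply: cvgM; exact: continuous_sin.
have -> : (fun t => (dn q t ^+ 3)^-1) = (fun t => (dn q t)^-1 * (dn q t)^-1 * (dn q t)^-1).
  by apply/funext => u; rewrite -!invfM !exprS expr0 mulr1 mulrA.
have -> : (dn q t ^+ 3)^-1 = (dn q t)^-1 * (dn q t)^-1 * (dn q t)^-1.
  by rewrite -!invfM !exprS expr0 mulr1 mulrA.
by apply: cvgM; [apply: cvgM|]; exact: dnV_cont.
Qed.

Let cN' : continuous N'.
Proof.
by move=> t; apply: cvgM; [exact: cos_powR_continuous|exact: dn_num_cont].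
Qed.

Let cF : continuous F.
Proof.
move=> t; apply: cvgM; last exact: dnV_cont.
by apply: cvgM; [exact: cos_powR_continuous|exact: continuous_sin].
Qed.

Let dF t : t \in `](- (pi / 2)), (pi / 2)[ ->
  is_derive t 1 F (N' t - 2 * r * ek r q t).
Proof.
move=> tpi; have c0 := cos_gt0_itv tpi; have d0 := dnN t.
have d := derM (derM (der_cos_powR (2 * r) tpi) (is_derive_sin t))
  (derV d0 (der_dn_t t q0 q1)).
apply: (der_eq d).
have E1 := @cos_powR_shift1 R r t (lt0r_neq0 c0); have E2 := @cos_powR_shift2 R r t r0.
rewrite /N' /ek E1 E2 (gtr0_norm c0); set C := _ `^ _.
have -> : sin t ^+ 2 = 1 - cos t ^+ 2 by rewrite sin2cos2.
have s2 : sin t * sin t = 1 - cos t ^+ 2 by rewrite -expr2 sin2cos2.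
transitivity (C / dn q t * (- 2 * r * (sin t * sin t) + cos t ^+ 2) +
  C * cos t ^+ 2 * q ^+ 2 * (sin t * sin t) / dn q t ^+ 3).
  by field.
by rewrite s2; field.
Qed.

(* Integrating the derivative of [cos^2r sin / dn] rewrites the possibly singular
   integrand [ek] in terms of continuous ones. *)
Lemma arc_length_primitive : exists S : R -> R,
  [/\ continuous S, forall t, S (- t) = - S t,
      forall t, t \in `](- (pi / 2)), (pi / 2)[ -> is_derive t 1 S (ek r q t) &
      2 * r * S (pi / 2) = seg_int 0 (pi / 2) N'].
Proof.
have [N N0 dN] := continuous_primitive cN'.
have cN := is_derive_continuous dN.
have Nodd t : N (- t) = - N t.
  have : N t + N (- t) = N 0 + N (- 0).
    apply: (@is_derive_0_is_cst R (fun t => N t + N (- t)) t 0) => x.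
    apply: (der_eq (derD (dN x) (der_comp (dN _) (derN (der_id x))))).
    have -> : N' (- x) = N' x by rewrite /N' cosN /dn sinN sqrrN.
    by ring.
  by rewrite oppr0 N0 addr0 => /eqP; rewrite addrC addr_eq0 => /eqP.
have r2N : 2 * r != 0 by rewrite gt_eqF.
exists (fun t => (2 * r)^-1 * (N t - F t)); split.
- move=> t; apply: cvgM; first exact: cvg_cst.
  by apply: cvgB; [exact: cN|exact: cF].
- move=> t; have -> : F (- t) = - F t.
    by rewrite /F cosN sinN /dn sinN sqrrN mulrN mulNr.
  by rewrite Nodd -opprD mulrN.
- move=> t tpi; apply: (der_eq (derZ _ (derB (dN t) (dF tpi)))); field.
  by rewrite gt_eqF.
- rewrite mulrA divff// mul1r /F cos_pihalf normr0 powR0 ?gt_eqF// !mul0r subr0.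
  suff -> : seg_int 0 (pi / 2) N' = N (pi / 2) - N 0 by rewrite N0 subr0.
  apply: seg_int_FTC2 => //; first by rewrite divr_ge0// pi_ge0.
    exact: within_continuousT.
  exact: within_continuousT.
Qed.

Lemma ek_continuous t : t \in `](- (pi / 2)), (pi / 2)[ -> {for t, continuous (ek r q)}.
Proof.
move=> tpi; apply: cvgM; last exact: dnV_cont.
exact: der_cont (der_cos_powR (2 * r - 1) tpi).
Qed.

Lemma ek_gt0 t : t \in `](- (pi / 2)), (pi / 2)[ -> 0 < ek r q t.
Proof.
move=> tpi; rewrite /ek divr_gt0 ?dn_gt0// powR_gt0// normr_gt0.
by rewrite gt_eqF// cos_gt0_itv.
Qed.

End arc_length.

(** * Monotonicity of the elliptic integrals in the modulus *)

Section elliptic_constants.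
Context {R : realType}.
Variable r : R.
Hypotheses (r0 : 0 < r) (r1 : r < 1).
Implicit Types (q s t x y : R).

Definition intK q := seg_int 0 (pi / 2) (ek r q).
Definition intJ q := seg_int 0 (pi / 2) (ej r q).
Definition intJ' q := seg_int 0 (pi / 2)
  (fun t => `|cos t| `^ (2 * r + 1) * (q * sin t ^+ 2 / dn q t ^+ 3)).
(** The last factor is the cosine of the tangent angle of the elastica of modulus [q], so a zero of
    [intD] means that the leaf closes up. It also equals 2 E - K, which ties it to [q_star]. *)
Definition intD q := seg_int 0 (pi / 2) (fun t => ek r q t * (1 - 2 * q ^+ 2 * sin t ^+ 2)).

Let pi20 : 0 < pi / 2 :> R. Proof. by rewrite divr_gt0// pi_gt0. Qed.

Lemma sin_pos_itv t : t \in `[0, pi / 2] -> 0 <= cos t /\ 0 <= sin t.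
Proof.
rewrite in_itv/= => /andP[t0 t1]; have pi0 := @pi_gt0 R; split.
  by apply: cos_ge0_pihalf; apply/andP; split; lra.
by apply: sin_ge0_pi; apply/andP; split; lra.
Qed.

Lemma ek_arc q (S : R -> R) : 0 <= q -> q < 1 -> continuous S ->
  (forall t, t \in `](- (pi / 2)), (pi / 2)[ -> is_derive t 1 S (ek r q t)) ->
  L1 0 (pi / 2) (ek r q) /\ intK q = S (pi / 2) - S 0.
Proof.
move=> q0 q1 cS dS; have pi0 := @pi_gt0 R.
have itv t : t \in `[0, pi / 2[ -> t \in `](- (pi / 2)), (pi / 2)[.
  by rewrite !in_itv/= => /andP[? ->]; rewrite andbT; lra.
have c1 : {within `[0, pi / 2], continuous S} by exact: within_continuousT.
have c2 x : x \in `[0, pi / 2[ -> {for x, continuous (ek r q)}.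
  by move=> /itv xp; exact: (ek_continuous q0 q1 xp).
have c3 x : x \in `[0, pi / 2[ -> 0 <= ek r q x.
  by move=> /itv xp; apply/ltW; exact: (ek_gt0 r q0 q1 xp).
have c4 x : x \in `]0, pi / 2[ -> is_derive x 1 S (ek r q x).
  by move=> xp; apply/dS/itv; move: xp; rewrite !in_itv/= => /andP[/ltW -> ->].
exact (improper_FTC2 pi20 c1 c2 c3 c4).
Qed.

Lemma ek_L1 q : 0 <= q -> q < 1 -> L1 0 (pi / 2) (ek r q).
Proof.
move=> q0 q1; have [S [cS _ dS _]] := arc_length_primitive q0 q1 r0.
by have [] := ek_arc q0 q1 cS dS.
Qed.

Lemma dnV_continuous q : 0 <= q -> q < 1 -> continuous (fun t => (dn q t)^-1).
Proof.
move=> q0 q1 t; apply: cvgV; first by rewrite gt_eqF// dn_gt0.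
exact: dn_continuous.
Qed.

Lemma ej_continuous q : 0 <= q -> q < 1 -> continuous (ej r q).
Proof.
move=> q0 q1 t; apply: cvgM; last exact: dnV_continuous.
by apply: cos_powR_continuous; rewrite addr_gt0// mulr_gt0.
Qed.

Lemma sin2_continuous : continuous (fun t : R => sin t ^+ 2).
Proof.
by apply: (@is_derive_continuous R _ (fun t => 2 * sin t * cos t)) => t; apply: derX2.
Qed.

Lemma ej'_continuous q : 0 <= q -> q < 1 ->
  continuous (fun t => `|cos t| `^ (2 * r + 1) * (q * sin t ^+ 2 / dn q t ^+ 3)).
Proof.
move=> q0 q1 t; apply: cvgM.
  by apply: cos_powR_continuous; rewrite addr_gt0// mulr_gt0.
apply: cvgM; first by apply: cvgM; [exact: cvg_cst|exact: sin2_continuous].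
have -> : (fun t => (dn q t ^+ 3)^-1) = (fun t => (dn q t)^-1 * (dn q t)^-1 * (dn q t)^-1).
  by apply/funext => u; rewrite -!invfM !exprS expr0 mulr1 mulrA.
have -> : (dn q t ^+ 3)^-1 = (dn q t)^-1 * (dn q t)^-1 * (dn q t)^-1.
  by rewrite -!invfM !exprS expr0 mulr1 mulrA.
by apply: cvgM; [apply: cvgM|]; exact: dnV_continuous.
Qed.

(** Integration of the derivative of cos^(2r) sin / dn over the quarter period: the boundary term
    vanishes at 0 through the sine and at pi / 2 through the cosine. *)
Lemma intK_intJ q : 0 <= q -> q < 1 ->
  2 * r * intK q = (2 * r + 1) * intJ q + q * intJ' q.
Proof.
move=> q0 q1; have [S [cS Sodd dS SE]] := arc_length_primitive q0 q1 r0.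
have [_ ->] := ek_arc q0 q1 cS dS.
have S0 : S 0 = 0 by have := Sodd 0; rewrite oppr0; lra.
rewrite S0 subr0 SE -!seg_intZl; [|exact: continuous_L1 (ej'_continuous q0 q1)
  |exact: continuous_L1 (ej_continuous q0 q1)].
rewrite -seg_intD; last 2 first.
- by apply: L1Zl; exact: continuous_L1 (ej_continuous q0 q1).
- by apply: L1Zl; exact: continuous_L1 (ej'_continuous q0 q1).
apply: eq_seg_int => t _; rewrite /ej; field.
by rewrite gt_eqF// dn_gt0.
Qed.

Lemma intD_KJ q : 0 <= q -> q < 1 ->
  intD q = (1 - 2 * q ^+ 2) * intK q + 2 * q ^+ 2 * intJ q.
Proof.
move=> q0 q1; have Ki := ek_L1 q0 q1.
have Ji : L1 0 (pi / 2) (ej r q) by exact: continuous_L1 (ej_continuous q0 q1).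
rewrite -!seg_intZl// -seg_intD; [|exact: L1Zl..].
apply: eq_seg_int => t _; rewrite /ej /ek cos_powR_shift2// sin2cos2; ring.
Qed.

Lemma intD_L1 q : 0 <= q -> q < 1 ->
  L1 0 (pi / 2) (fun t => ek r q t * (1 - 2 * q ^+ 2 * sin t ^+ 2)).
Proof.
move=> q0 q1.
have c : {within `[0, pi / 2], continuous (fun t : R => 1 - 2 * q ^+ 2 * sin t ^+ 2)}.
  apply: within_continuousT => t; apply: cvgB; first exact: cvg_cst.
  by apply: cvgM; [exact: cvg_cst|exact: sin2_continuous].
by apply: eq_L1 (L1_contM c (ek_L1 q0 q1)) => t _; exact: mulrC.
Qed.

Lemma intE_K q : 0 <= q -> q < 1 ->
  2 * seg_int 0 (pi / 2) (fun t => dn q t * `|cos t| `^ (2 * r - 1)) - intK q = intD q.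
Proof.
move=> q0 q1; have Ki := ek_L1 q0 q1.
have Ei : L1 0 (pi / 2) (fun t => dn q t * `|cos t| `^ (2 * r - 1)).
  have c : {within `[0, pi / 2], continuous (fun t : R => dn q t * dn q t)}.
    by apply: within_continuousT => t; apply: cvgM; exact: dn_continuous.
  apply: eq_L1 (L1_contM c Ki) => t _.
  by rewrite /ek; field; rewrite gt_eqF// dn_gt0.
rewrite -seg_intZl// -seg_intB//; last exact: L1Zl.
apply: eq_seg_int => t _; rewrite /ek; set C := _ `^ _.
have -> : 1 - 2 * q ^+ 2 * sin t ^+ 2 = 2 * dn q t ^+ 2 - 1 by rewrite dn_sqr//; ring.
by field; rewrite gt_eqF// dn_gt0.
Qed.

Lemma dn_anti q1 q2 t : 0 <= q1 -> q1 <= q2 -> q2 < 1 -> dn q2 t <= dn q1 t.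
Proof.
move=> q10 q12 q21; apply: ler_wsqrtr; rewrite lerB// ler_wpM2r ?sqr_ge0//.
by apply: lerXn2r; rewrite ?nnegrE// (le_trans q10).
Qed.

Lemma dn_le1 q t : dn q t <= 1.
Proof.
rewrite -[leRHS]sqrtr1; apply: ler_wsqrtr.
by rewrite gerBl mulr_ge0// sqr_ge0.
Qed.

Lemma cos_le_powR t : t \in `[0, pi / 2] -> cos t <= `|cos t| `^ (2 * r - 1).
Proof.
move=> /sin_pos_itv[c0 _]; rewrite (ger0_norm c0).
move: c0; rewrite le_eqVlt => /predU1P[<-|c0]; first exact: powR_ge0.
have r21 : 2 * r - 1 <= 1 by move: r1; lra.
by apply: ger1_powR => //; rewrite c0 cos_le1.
Qed.

(** The integrand is |cos|^(2r - 1) (2 dn - 1 / dn), which increases with dn, while dn decreases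
    with the modulus. *)
Lemma intD_decr q1 q2 : 0 <= q1 -> q1 < q2 -> q2 < 1 -> intD q2 < intD q1.
Proof.
move=> q10 q12 q21; have q20 := le_trans q10 (ltW q12).
have q11 := lt_trans q12 q21.
rewrite -subr_gt0 -seg_intB; [|exact: intD_L1..].
(* A continuous minorant of the difference, positive inside, gives strictness in spite of the
   singular factor. With a and b the values of dn at q1 and q2, it comes from (a - b)(2 + 1/(ab)) >=
   3 (a - b) >= 3/2 (a^2 - b^2), and from replacing the power of the cosine by the cosine. *)
pose g t := 3 / 2 * (q2 ^+ 2 - q1 ^+ 2) * (sin t ^+ 2 * cos t) : R.
have cg : continuous g.
  move=> t; apply: cvgM; first exact: cvg_cst.
  by apply: cvgM; [exact: sin2_continuous|exact: continuous_cos].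
have k0 : 0 < 3 / 2 * (q2 ^+ 2 - q1 ^+ 2).
  by rewrite mulr_gt0 ?divr_gt0// subr_gt0 ltrXn2r.
apply: (@lt_le_trans _ _ (seg_int 0 (pi / 2) g)).
  apply: seg_int_gt0 => //; first exact: within_continuousT.
  move=> t; rewrite in_itv/= => /andP[t0 t1]; rewrite /g mulr_gt0// mulr_gt0//.
    by rewrite exprn_gt0// sin_gt0_pihalf// t0.
  by apply: cos_gt0_pihalf; rewrite t1 andbT; have := @pi_gt0 R; lra.
apply: le_seg_int; first exact: continuous_L1.
  by apply: L1B; exact: intD_L1.
move=> t tpi; have Cc := cos_le_powR tpi; have [c0 _] := sin_pos_itv tpi.
rewrite /g /ek; move: Cc; set C := _ `^ _ => Cc.
have u1 := dn_gt0 t q10 q11; have u2 := dn_gt0 t q20 q21.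
have u12 := dn_anti t q10 (ltW q12) q21.
have u11 := dn_le1 q1 t.
have e1 := dn_sqr t q10 q11; have e2 := dn_sqr t q20 q21.
have -> : 1 - 2 * q1 ^+ 2 * sin t ^+ 2 = 2 * dn q1 t ^+ 2 - 1 by rewrite e1; ring.
have -> : 1 - 2 * q2 ^+ 2 * sin t ^+ 2 = 2 * dn q2 t ^+ 2 - 1 by rewrite e2; ring.
have -> : 3 / 2 * (q2 ^+ 2 - q1 ^+ 2) * (sin t ^+ 2 * cos t) =
  3 / 2 * (dn q1 t ^+ 2 - dn q2 t ^+ 2) * cos t by rewrite e1 e2; ring.
move: u1 u2 u12 u11; set a := dn q1 t; set b := dn q2 t => a0 b0 ba a1.
have -> : C / a * (2 * a ^+ 2 - 1) - C / b * (2 * b ^+ 2 - 1) =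
  C * ((a - b) * (2 + (a * b)^-1)) by field; rewrite !gt_eqF.
rewrite (mulrC _ (cos t)); apply: ler_pM => //.
  by rewrite !mulr_ge0//; nra.
have -> : 3 / 2 * (a ^+ 2 - b ^+ 2) = (a - b) * (3 / 2 * (a + b)) by ring.
apply: ler_wpM2l; first lra.
have : 1 <= (a * b)^-1 by rewrite invf_ge1 ?mulr_gt0//; nra.
nra.
Qed.

Lemma der_ej q t : 0 <= q -> q < 1 -> is_derive q 1 (fun x => ej r x t)
  (`|cos t| `^ (2 * r + 1) * (q * sin t ^+ 2 / dn q t ^+ 3)).
Proof.
move=> q0 q1; have d0 := dn_gt0 t q0 q1.
have dN : dn q t != 0 by rewrite gt_eqF.
apply: (der_eq (derZ _ (derV (f := fun x => dn x t) dN (der_dn_q t q0 q1)))).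
by field.
Qed.

Lemma der_intJ q : 0 < q -> q < 1 -> is_derive q 1 intJ (intJ' q).
Proof.
move=> q0 q1.
(* Moduli are kept below [v] < 1, so that dn is bounded below by [d] and the derivative of the
   integrand is dominated by the constant d^-3. *)
pose v := (1 + q) / 2; have v1 : v < 1 by rewrite /v; lra.
have qv : q < v by rewrite /v; lra.
have v0 : 0 <= v by lra.
pose d := Num.sqrt (1 - v ^+ 2).
have d0 : 0 < d by rewrite sqrtr_gt0; nra.
pose B : set (measurableTypeR R) := `[0, pi / 2]%classic.
have mB : measurable B by exact: measurable_itv.
have Iq : `]0, v[%classic q by rewrite /= in_itv/= q0.
have itf x : `]0, v[%classic x -> lebesgue_measure.-integrable B (EFin \o ej r x).
  rewrite /= in_itv/= => /andP[x0 xv].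
  by apply: continuous_L1; apply: ej_continuous; lra.
have derf x y : `]0, v[%classic x -> B y -> derivable (ej r ^~ y) x 1.
  rewrite /= in_itv/= => /andP[x0 xv] _.
  by have [] := der_ej y (ltW x0) (lt_trans xv v1).
have part x y : `]0, v[%classic x ->
    partial1of2 (ej r) x y = `|cos y| `^ (2 * r + 1) * (x * sin y ^+ 2 / dn x y ^+ 3).
  rewrite /= in_itv/= => /andP[x0 xv].
  by rewrite partial1of2E; have [_ ->] := der_ej y (ltW x0) (lt_trans xv v1).
pose G (_ : measurableTypeR R) : R := (d ^+ 3)^-1.
have G0 y : 0 <= G y by rewrite invr_ge0 exprn_ge0// ltW.
have Gi : lebesgue_measure.-integrable B (EFin \o G).
  by apply: (@continuous_L1 R 0 (pi / 2) (fun=> (d ^+ 3)^-1)) => x; exact: cvg_cst.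
have Gub x y : `]0, v[%classic x -> B y -> `|partial1of2 (ej r) x y| <= G y.
  move=> xI By; rewrite part//; move: xI; rewrite /= in_itv/= => /andP[x0 xv].
  have dx := dn_gt0 y (ltW x0) (lt_trans xv v1).
  have s1 : sin y ^+ 2 <= 1 by have := cos2Dsin2 y; have := sqr_ge0 (cos y); lra.
  have s0 := sqr_ge0 (sin y).
  have ddn : d <= dn x y by apply: ler_wsqrtr; nra.
  have h0 : 0 <= x * sin y ^+ 2 / dn x y ^+ 3.
    exact: divr_ge0 (mulr_ge0 (ltW x0) s0) (exprn_ge0 3 (ltW dx)).
  rewrite ger0_norm; last exact: mulr_ge0 (powR_ge0 _ _) h0.
  rewrite /G -[leRHS]mul1r; apply: ler_pM.
  - exact: powR_ge0.
  - exact: h0.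
  - have c1 : `|cos y| <= 1 by exact: cos_max.
    have r2 : 0 <= 2 * r + 1 by move: r0; lra.
    by have := ge0_ler_powR r2 (_ : `|cos y| \in Num.nneg) (_ : 1 \in Num.nneg) c1; rewrite powR1 !nnegrE; apply.
  - rewrite -[leRHS]mul1r; apply: ler_pM.
    + exact: mulr_ge0 (ltW x0) s0.
    + by rewrite invr_ge0 exprn_ge0// ltW.
    + nra.
    + rewrite lef_pV2 ?posrE ?exprn_gt0//.
      by apply: lerXn2r; rewrite ?nnegrE//; exact: ltW.
apply: DeriveDef; first exact: (derivable_under_integral mB Iq itf derf G0 Gi Gub).
rewrite -derive1E.
rewrite [LHS](differentiation_under_integral mB Iq itf derf G0 Gi Gub).
by apply: eq_seg_int => y _; rewrite part.
Qed.

(** Up to the factor 2^(r + 1), this is the angle integral of (1 + y cos)^r over the range where 1 +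
    y cos is nonnegative, for y = 1 / (2 q^2 - 1), written in the modulus. Using [intJ] rather than
    [intK] allows differentiation under the integral. *)
Definition Psi q := q `^ (2 * r + 1) * intJ q * (2 * q ^+ 2 - 1) `^ (- r).

(** The identity [intK_intJ] eliminates [intJ'], and [intD] is what remains. As [intD] is
    decreasing, its zero is the minimum point of [Psi]. *)
Lemma der_Psi q : 0 < q -> q < 1 -> 0 < 2 * q ^+ 2 - 1 -> is_derive q 1 Psi
  (- (2 * r * q `^ (2 * r) * (2 * q ^+ 2 - 1) `^ (- r - 1) * intD q)).
Proof.
move=> q0 q1 c0.
have dc : is_derive q 1 (fun x => 2 * x ^+ 2 - 1) (2 * (2 * q * 1) - 0).
  exact: derB (derZ _ (derX2 (der_id q))) (der_cst _ _).
have dcp := der_comp (f := fun x => x `^ (- r)) (g := fun x => 2 * x ^+ 2 - 1) (is_derive1_powR _ c0) dc.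
have d := derM (derM (is_derive1_powR (2 * r + 1) q0) (der_intJ q0 q1)) dcp.
apply: (der_eq d).
have e := intK_intJ (ltW q0) q1.
rewrite intD_KJ ?(ltW q0)//.
rewrite (_ : 2 * r + 1 - 1 = 2 * r); last by ring.
have -> : q `^ (2 * r + 1) = q `^ (2 * r) * q.
  rewrite powRD; last by rewrite (gt_eqF q0) implybT.
  by rewrite powRr1// ltW.
have -> : (2 * q ^+ 2 - 1) `^ (- r) = (2 * q ^+ 2 - 1) `^ (- r - 1) * (2 * q ^+ 2 - 1).
  rewrite -[X in _ = _ * X]powRr1 ?(ltW c0)// -powRD; last first.
    by rewrite (gt_eqF c0) implybT.
  by congr powR; ring.
set Q := q `^ (2 * r); set C := (_ `^ (- r - 1)).
transitivity (Q * C * ((2 * q ^+ 2 - 1) * ((2 * r + 1) * intJ q + q * intJ' q)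
   - 4 * r * q ^+ 2 * intJ q)); first by ring.
by rewrite -e; ring.
Qed.

Let P x := - (2 * r * x `^ (2 * r) * (2 * x ^+ 2 - 1) `^ (- r - 1) * intD x).

Let Psi_mvt a b : 0 < a -> 0 < 2 * a ^+ 2 - 1 -> a < b -> b < 1 ->
  exists x, [/\ a < x, x < b & Psi b - Psi a = P x * (b - a)].
Proof.
move=> a0 ca ab b1.
have dP x : a <= x -> x <= b -> is_derive x 1 Psi (P x).
  by move=> ax xb; apply: der_Psi; nra.
have h1 x : x \in `]a, b[ -> is_derive x 1 Psi (P x).
  by rewrite in_itv/= => /andP[/ltW ax /ltW xb]; exact: dP.
have h2 : {within `[a, b], continuous Psi}.
  apply/subspace_continuousP => x; rewrite /= in_itv/= => /andP[ax xb].
  by apply: cvg_within_filter; exact: der_cont (dP x ax xb).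
have [x] := MVT ab h1 h2.
by rewrite in_itv/= => /andP[ax xb] E; exists x.
Qed.

Let P_sign x : 0 < x -> 0 < 2 * x ^+ 2 - 1 -> exists2 k, 0 < k & P x = - (k * intD x).
Proof.
move=> x0 cx; exists (2 * r * x `^ (2 * r) * (2 * x ^+ 2 - 1) `^ (- r - 1)) => //.
by rewrite !mulr_gt0// powR_gt0.
Qed.

Lemma Psi_incr q0 a b : 0 < q0 -> 0 < 2 * q0 ^+ 2 - 1 -> intD q0 = 0 ->
  q0 <= a -> a < b -> b < 1 -> Psi a < Psi b.
Proof.
move=> q00 c00 D0 qa ab b1.
have [x [ax xb E]] := Psi_mvt (lt_le_trans q00 qa) ltac:(nra) ab b1.
have [k k0 Pk] := @P_sign x ltac:(lra) ltac:(nra).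
have := intD_decr (ltW q00) (le_lt_trans qa ax) (lt_trans xb b1); rewrite D0 => Dx.
rewrite -subr_gt0 E Pk; have := mulr_gt0 k0 (_ : 0 < - intD x); nra.
Qed.

Lemma Psi_min q0 q : 0 < q0 -> q0 < 1 -> 0 < 2 * q0 ^+ 2 - 1 -> intD q0 = 0 ->
  0 < q -> q < 1 -> 0 < 2 * q ^+ 2 - 1 -> q != q0 -> Psi q0 < Psi q.
Proof.
move=> q00 q01 c00 D0 q_0 q_1 c_0; rewrite neq_lt => /orP[qq|qq].
  have [x [qx xq E]] := Psi_mvt q_0 c_0 qq q01.
  have [k k0 Pk] := @P_sign x ltac:(lra) ltac:(nra).
  have := intD_decr (ltW (lt_trans q_0 qx)) xq q01; rewrite D0 => Dx.
  rewrite -subr_lt0 E Pk; have := mulr_gt0 k0 Dx; nra.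
exact: (Psi_incr q00).
Qed.

Lemma intJ_gt0 q : 0 <= q -> q < 1 -> 0 < intJ q.
Proof.
move=> q0 q1; apply: seg_int_gt0 => //.
  by apply: within_continuousT; exact: ej_continuous.
move=> t; rewrite in_itv/= => /andP[t0 t1].
have c0 : 0 < cos t by apply: cos_gt0_pihalf; rewrite t1 andbT; have := @pi_gt0 R; lra.
by rewrite /ej divr_gt0 ?dn_gt0// powR_gt0// normr_gt0 gt_eqF.
Qed.

Lemma Psi_gt0 q : 0 < q -> q < 1 -> 0 < 2 * q ^+ 2 - 1 -> 0 < Psi q.
Proof.
by move=> q0 q1 c0; rewrite /Psi !mulr_gt0 ?powR_gt0// intJ_gt0// ltW.
Qed.

End elliptic_constants.

(** * Integrals over the tangent angle and their least value *)

Section angle_integrals.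
Context {R : realType}.
Variable r : R.
Hypotheses (r0 : 0 < r) (r1 : r < 1).
Implicit Types (q s t x y z : R).

(* [kfun y] is, up to scaling, the (p-1)-st power of the curvature of the
   free elastica as a function of its tangent angle. *)
Definition kfun y x : R := `|Num.max 0 (1 + y * cos x)| `^ r.
Definition intP y := seg_int 0 pi (kfun y).

Lemma kfun_ge0 y x : 0 <= kfun y x. Proof. exact: powR_ge0. Qed.

Lemma kfunN y x : kfun y (- x) = kfun y x. Proof. by rewrite /kfun cosN. Qed.

Lemma kfun_continuous y : continuous (kfun y).
Proof.
move=> x; apply: (@cvg_comp _ _ _ (fun x => Num.max 0 (1 + y * cos x)) (fun z => `|z| `^ r));
  last exact: continuous_norm_powR.
have -> : (fun x : R => Num.max 0 (1 + y * cos x)) =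
    (fun x => (0 + (1 + y * cos x) + `|0 - (1 + y * cos x)|) / 2).
  by apply/funext => t; rewrite maxr_absE.
rewrite maxr_absE.
have cc : (1 + y * cos x) @[x --> x] --> (1 + y * cos x).
  apply: cvgD; first exact: cvg_cst.
  by apply: cvgM; [exact: cvg_cst|exact: continuous_cos].
apply: cvgM; last exact: cvg_cst.
apply: cvgD; first by apply: cvgD; [exact: cvg_cst|exact: cc].
by apply: cvg_norm; apply: cvgB; [exact: cvg_cst|exact: cc].
Qed.

Lemma kfun_gt0 y x : 0 < 1 + y * cos x -> 0 < kfun y x.
Proof.
by move=> h; rewrite /kfun powR_gt0// normr_gt0 gt_eqF// lt_max h orbT.
Qed.

Lemma cos_2asin x : -1 <= x -> x <= 1 -> cos (2 * asin x) = 1 - 2 * x ^+ 2.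
Proof.
move=> x1 x2; rewrite mulr_natl cos_mulr2n cos2sin2 asinK ?in_itv/= ?x1//.
by rewrite -mulr_natl; ring.
Qed.

Lemma asin_0 : asin 0 = 0 :> R.
Proof.
by rewrite -[X in asin X](@sin0 R) sinK// in_itv/= oppr_le0 divr_ge0// pi_ge0.
Qed.

Lemma asin_itv q : 0 < q -> q < 1 -> 0 < asin q /\ asin q < pi / 2.
Proof.
move=> q0 q1; have qi : -1 <= q < 1 by rewrite q1 andbT; lra.
split; last exact: asin_ltpi2.
have qi' : -1 <= q <= 1 by apply/andP; split; lra.
have pi0 := @pi_gt0 R.
have := asin_geNpi2 qi'; have := asin_ltpi2 qi => h1 h2.
rewrite ltNge; apply/negP => h3.
have : sin (asin q) <= sin 0.
  have [->//|/eqP h4] := eqVneq (asin q) 0.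
  apply/ltW; rewrite ltr_sin ?in_itv/= ?lt_neqAle ?h4//; apply/andP; split; lra.
by rewrite sin0 asinK ?in_itv//= leNgt q0.
Qed.

Lemma sin_dn_lt1 q t : 0 <= q -> q < 1 -> -1 < q * sin t < 1.
Proof.
move=> q0 q1; have := sin_le1 t; have := sin_geN1 t => h1 h2.
by apply/andP; split; nra.
Qed.

(* The tangent angle of the elastica in the elliptic parameter. *)
Definition elangle q t := 2 * asin (q * sin t).

Lemma cos_elangle q t : 0 <= q -> q < 1 ->
  cos (elangle q t) = 1 - 2 * q ^+ 2 * sin t ^+ 2.
Proof.
move=> q0 q1; have /andP[/ltW h1 /ltW h2] := sin_dn_lt1 t q0 q1.
by rewrite /elangle cos_2asin// exprMn mulrA.
Qed.

Lemma der_elangle q t : 0 <= q -> q < 1 ->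
  is_derive t 1 (elangle q) (2 * q * cos t / dn q t).
Proof.
move=> q0 q1; have h := sin_dn_lt1 t q0 q1.
have d := derZ 2 (der_comp (g := fun t => q * sin t) (is_derive1_asin h) (derZ q (is_derive_sin t))).
apply: (der_eq d); rewrite exprMn -/(dn q t); ring.
Qed.

Lemma kfun_elangle q t : 0 < q -> q < 1 -> 0 < 2 * q ^+ 2 - 1 ->
  1 + (2 * q ^+ 2 - 1)^-1 * cos (elangle q t) = 2 * q ^+ 2 * (2 * q ^+ 2 - 1)^-1 * cos t ^+ 2.
Proof.
move=> q0 q1 c0; rewrite cos_elangle ?(ltW q0)// sin2cos2.
by field; rewrite gt_eqF.
Qed.

(** The substitution x = [elangle q t] turns 1 + y cos x into 2 q^2 y (cos t)^2. The image 2 asin q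
    of t = pi / 2 is the zero of the weight, beyond which the truncation makes [kfun] vanish. *)
Lemma intP_Psi q : 0 < q -> q < 1 -> 0 < 2 * q ^+ 2 - 1 ->
  seg_int 0 (2 * asin q) (kfun (2 * q ^+ 2 - 1)^-1) = intP (2 * q ^+ 2 - 1)^-1 /\
  intP (2 * q ^+ 2 - 1)^-1 = 2 `^ (r + 1) * Psi r q.
Proof.
move=> q0 q1 c0; set c := 2 * q ^+ 2 - 1; set y := c^-1.
have [a0 a1] := asin_itv q0 q1.
have pi0 := @pi_gt0 R.
have ci a b : L1 a b (kfun y) by apply: continuous_L1; exact: kfun_continuous.
have cos1 : cos (2 * asin q) = - c by rewrite cos_2asin /c; lra.
have E1 : seg_int 0 (2 * asin q) (kfun y) = intP y.
  rewrite /intP (@seg_int_split _ 0 pi (2 * asin q))//; [|lra..].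
  rewrite (@eq_seg_int _ (2 * asin q) pi _ (fun=> 0)).
    by rewrite seg_int_cst ?mul0r ?addr0//; lra.
  move=> t; rewrite in_itv/= => /andP[t1 t2].
  have : cos t <= - c by rewrite -cos1 ler_cos; lra.
  have y0 : 0 < y by rewrite invr_gt0.
  move=> h; have h2 : 1 + y * cos t <= 0.
    have yc : y * c = 1 by rewrite mulVf// gt_eqF.
    nra.
  by rewrite /kfun max_l// normr0 powR0 ?gt_eqF.
split => //; rewrite -E1.
have [A A0 dA] := continuous_primitive (@kfun_continuous y).
have cA := is_derive_continuous dA.
have ck := @kfun_continuous y.
have -> : seg_int 0 (2 * asin q) (kfun y) = A (2 * asin q) - A 0.
  by apply: seg_int_FTC2 => //; [lra|exact: within_continuousT..].
(* The factor (2 q^2 y)^r of the weight times the factor 2 q of the Jacobian, with y = 1 / c. *)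
pose k : R := 2 `^ (r + 1) * q `^ (2 * r + 1) * c `^ (- r).
have E2 : seg_int 0 (pi / 2) (fun t => k * ej r q t) = A (elangle q (pi / 2)) - A (elangle q 0).
  have cej := ej_continuous r0 (ltW q0) q1.
  have ca : continuous (fun t => k * ej r q t).
    by move=> t; apply: cvgM; [exact: cvg_cst|exact: cej].
  have dAe t : is_derive t 1 (fun t => A (elangle q t)) (kfun y (elangle q t) * (2 * q * cos t / dn q t)).
    exact: der_comp (dA _) (der_elangle t (ltW q0) q1).
  have cb := is_derive_continuous dAe.
  have dAe' t : t \in `]0, (pi / 2)[ -> is_derive t 1 (fun t => A (elangle q t)) (k * ej r q t).
    rewrite in_itv/= => /andP[t0 t1]; apply: (der_eq (dAe t)).
    have ct : 0 < cos t by apply: cos_gt0_pihalf; rewrite t1 andbT; lra.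
    have q20 : 0 < 2 * q ^+ 2 * y * cos t ^+ 2.
      by rewrite !mulr_gt0 ?invr_gt0 ?exprn_gt0.
    rewrite /kfun kfun_elangle// max_r ?(ltW q20)// (gtr0_norm q20) /k /ej (gtr0_norm ct).
    have yp : 0 <= y by rewrite invr_ge0 ltW.
    have p1 : 0 <= 2 * q ^+ 2 by rewrite mulr_ge0// sqr_ge0.
    have p2 : 0 <= 2 * q ^+ 2 * y by rewrite mulr_ge0.
    rewrite (powRM _ p2 (sqr_ge0 (cos t))) (powRM _ p1 yp) (powRM _ _ (sqr_ge0 q))//.
    have e2 (z : R) : 0 < z -> (z ^+ 2) `^ r = z `^ (2 * r).
      by move=> z0; rewrite -powR_mulrn ?(ltW z0)// -powRrM.
    have e3 (z : R) : 0 < z -> z `^ (2 * r + 1) = z `^ (2 * r) * z.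
      move=> z0; rewrite powRD; last by rewrite (gt_eqF z0) implybT.
      by rewrite powRr1// ltW.
    rewrite !e2// !e3//.
    have -> : y `^ r = c `^ (- r) by rewrite /y -powR_inv1 ?(ltW c0)// -powRrM mulN1r.
    have -> : 2 `^ (r + 1) = 2 `^ r * 2 :> R.
      rewrite powRD; last by rewrite pnatr_eq0 implybT.
      by rewrite powRr1.
    by ring.
  apply: seg_int_FTC2 => //; [lra|exact: within_continuousT..].
have -> : A (2 * asin q) - A 0 = A (elangle q (pi / 2)) - A (elangle q 0).
  by rewrite /elangle sin_pihalf sin0 mulr1 mulr0 asin_0 mulr0.
rewrite -E2 seg_intZl; last exact: continuous_L1 (ej_continuous r0 (ltW q0) q1).
by rewrite /k /Psi -/c -/(intJ r q); ring.
Qed.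

Lemma intP_gt0 q : 0 < q -> q < 1 -> 0 < 2 * q ^+ 2 - 1 -> 0 < intP (2 * q ^+ 2 - 1)^-1.
Proof.
by move=> q0 q1 c0; have [_ ->] := intP_Psi q0 q1 c0; rewrite mulr_gt0 ?powR_gt0// Psi_gt0.
Qed.

(** After multiplication by c = 2 q^2 - 1 the weight becomes c + cos, which is at most 1 + cos. *)
Lemma intP_le1 q : 0 < q -> q < 1 -> 0 < 2 * q ^+ 2 - 1 ->
  (2 * q ^+ 2 - 1) `^ r * intP (2 * q ^+ 2 - 1)^-1 <= intP 1.
Proof.
move=> q0 q1 c0; set c := 2 * q ^+ 2 - 1 in c0 *.
have ci a b y : L1 a b (kfun y) by apply: continuous_L1; exact: kfun_continuous.
rewrite -seg_intZl//; apply: le_seg_int => //; first exact: L1Zl.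
move=> t _; rewrite /kfun -powRM ?(ltW c0)//.
have c1 : c <= 1 by rewrite /c; nra.
have m0 (z : R) : `|Num.max 0 z| = Num.max 0 z by rewrite ger0_norm// le_max lexx.
rewrite !m0; apply: ge0_ler_powR; first exact: ltW.
- by rewrite nnegrE mulr_ge0 ?(ltW c0)// le_max lexx.
- by rewrite nnegrE le_max lexx.
rewrite maxr_pMr ?(ltW c0)// mulr0 ge_max le_max lexx/=.
rewrite mulrDr mulr1 mulrA mulfV ?gt_eqF// mul1r le_max; apply/orP; right.
by rewrite lerD2r.
Qed.

(** Solving y = 1 / (2 q^2 - 1) for the modulus. The excluded value y = 1 would give q = 1. *)
Lemma sqrt_half y : 1 < y -> exists q, [/\ 0 < q, q < 1, 0 < 2 * q ^+ 2 - 1 &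
  y = (2 * q ^+ 2 - 1)^-1].
Proof.
move=> y1; have y0 : 0 < y by lra.
have yi0 : 0 < y^-1 by rewrite invr_gt0.
have yi1 : y^-1 < 1 by rewrite invf_lt1.
exists (Num.sqrt ((1 + y^-1) / 2)).
have qE : Num.sqrt ((1 + y^-1) / 2) ^+ 2 = (1 + y^-1) / 2 by rewrite sqr_sqrtr//; lra.
split; first by rewrite sqrtr_gt0; lra.
- by rewrite -[ltRHS]sqrtr1 ltr_sqrt; lra.
- by rewrite qE; lra.
- by rewrite qE (_ : 2 * _ - 1 = y^-1) ?invrK//; field; rewrite gt_eqF.
Qed.

(** This replaces the limit c -> 1: as X0 / X1 < 1, some c < 1 already satisfies c^r > X0 / X1. *)
Lemma powR_scale_lt (c1 X0 X1 Y : R) : c1 < 1 -> 0 < X0 -> X0 < X1 ->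
  (forall c, c1 < c -> c < 1 -> c `^ r * X1 <= Y) -> X0 < Y.
Proof.
move=> c11 X00 X01 cY; have X10 := lt_trans X00 X01.
have d1 : X0 / X1 < 1 by rewrite ltr_pdivrMr// mul1r.
have d0 : 0 < X0 / X1 by rewrite divr_gt0.
pose rho := (X0 / X1) `^ r^-1.
have rho_r : rho `^ r = X0 / X1.
  by rewrite /rho -powRrM mulVf ?gt_eqF// powRr1// ltW.
have ri0 : 0 < r^-1 by rewrite invr_gt0.
have rho1 : rho < 1.
  have := gt0_ltr_powR ri0 (_ : X0 / X1 \in Num.nneg) (_ : 1 \in Num.nneg) d1.
  by rewrite powR1; apply; rewrite nnegrE// ltW.
have rho0 : 0 <= rho by exact: powR_ge0.
clearbody rho; pose c := (1 + Num.max c1 rho) / 2.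
have m1 : Num.max c1 rho < 1 by rewrite gt_max c11.
have mc1 : c1 <= Num.max c1 rho by rewrite le_max lexx.
have mrho : rho <= Num.max c1 rho by rewrite le_max lexx orbT.
have cc : c1 < c by rewrite /c; move: mc1 m1; move: (Num.max _ _) => z; lra.
have rc : rho < c by rewrite /c; move: mrho m1; move: (Num.max _ _) => z; lra.
have c_1 : c < 1 by rewrite /c; move: m1; move: (Num.max _ _) => z; lra.
clearbody c; apply: lt_le_trans (cY _ cc c_1).
rewrite -ltr_pdivrMr// -rho_r.
by apply: (gt0_ltr_powR r0 _ _ rc); rewrite nnegrE// (le_trans rho0)// ltW.
Qed.

(** For y > 1 this is the minimum of [Psi] in the modulus. For y = 1 a fixed modulus [q1] strictly
    between [q0] and 1 provides a gap, which survives the comparison of y = 1 with moduli close to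
    1. *)
Lemma intP_min q0 y : 0 < q0 -> q0 < 1 -> 0 < 2 * q0 ^+ 2 - 1 -> intD r q0 = 0 ->
  1 <= y -> y != (2 * q0 ^+ 2 - 1)^-1 -> intP (2 * q0 ^+ 2 - 1)^-1 < intP y.
Proof.
move=> q00 q01 c00 D0.
have two0 : 0 < 2 `^ (r + 1) :> R by exact: powR_gt0.
rewrite le_eqVlt => /predU1P[<- _|y1 yy]; last first.
  have [q [qq0 qq1 cq0 yE]] := sqrt_half y1.
  rewrite yE; have [_ ->] := intP_Psi q00 q01 c00; have [_ ->] := intP_Psi qq0 qq1 cq0.
  rewrite ltr_pM2l//; apply: Psi_min => //.
  by apply: contra yy => /eqP <-; rewrite yE.
pose q1 := (1 + q0) / 2.
have q1q0 : q0 < q1 by rewrite /q1; lra.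
have q11 : q1 < 1 by rewrite /q1; lra.
have q10 := lt_trans q00 q1q0.
have c10 : 0 < 2 * q1 ^+ 2 - 1 by nra.
have c11 : 2 * q1 ^+ 2 - 1 < 1 by nra.
clearbody q1.
apply: (powR_scale_lt c11 (X1 := intP (2 * q1 ^+ 2 - 1)^-1)).
- exact: intP_gt0.
- have [_ ->] := intP_Psi q00 q01 c00; have [_ ->] := intP_Psi q10 q11 c10.
  by rewrite ltr_pM2l//; exact: (Psi_incr r0 r1 q00).
move=> c c1c c_1.
have c0 := lt_trans c10 c1c.
have y1 : 1 < c^-1 by rewrite invf_gt1.
have [q [qq0 qq1 cq0 /invr_inj cE]] := sqrt_half y1.
have q1q : q1 < q.
  clear -c1c cE q10 qq0; rewrite ltNge; apply/negP => qq.
  have : 2 * q ^+ 2 - 1 <= 2 * q1 ^+ 2 - 1 by nra.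
  rewrite -cE; lra.
apply: le_trans (intP_le1 qq0 qq1 cq0).
rewrite -cE ler_pM2l ?powR_gt0// cE; apply/ltW.
have [_ ->] := intP_Psi q10 q11 c10; have [_ ->] := intP_Psi qq0 qq1 cq0.
by rewrite ltr_pM2l//; exact: (Psi_incr r0 r1 q00 c00 D0 (ltW q1q0)).
Qed.

End angle_integrals.

(** * The critical modulus and the sharp constant *)

Section critical_modulus.
Context {R : realType}.
Variable p : R.
Hypothesis p1 : 1 < p.
Let r := 1 - p^-1.

Let p0 : 0 < p. Proof. exact: lt_trans p1. Qed.
Lemma conj_exp_gt0 : 0 < r. Proof. by rewrite subr_gt0 invf_lt1. Qed.
Lemma conj_exp_lt1 : r < 1. Proof. by rewrite gtrBl invr_gt0. Qed.

Lemma ellK1_intK q : ellK1 p q = intK r q.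
Proof.
apply: eq_seg_int => t _; rewrite /ek /dn; congr (_ `^ _ / _).
by rewrite /r; ring.
Qed.

Lemma ellE1_intD q : 0 <= q -> q < 1 -> 2 * ellE1 p q - ellK1 p q = intD r q.
Proof.
move=> q0 q1; rewrite -(intE_K conj_exp_gt0 q0 q1) ellK1_intK; congr (2 * _ - _).
apply: eq_seg_int => t _; rewrite /dn; congr (_ * _ `^ _).
by rewrite /r; ring.
Qed.

(** Without a root the default value 0 of [q_star] would give [phi_star p = pi], so the hypothesis
    on [phi_star] forces a genuine root. The last sign holds because 2 q^2 - 1 = cos (pi / m) with m
    at least 3. *)
Lemma q_star_spec (m : nat) : (3 <= m)%N -> phi_star p = pi / m%:R ->
  [/\ 0 < q_star p, q_star p < 1, intD r (q_star p) = 0,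
      2 * asin (q_star p) = pi - pi / m%:R & 0 < 2 * q_star p ^+ 2 - 1].
Proof.
move=> m3; rewrite /phi_star => phi; have pi0 := @pi_gt0 R.
have m0 : 0 < m%:R :> R by rewrite ltr0n (leq_trans _ m3).
have m3' : (3 : R) <= m%:R by rewrite ler_nat.
have pim : pi / m%:R <= pi / 3 :> R.
  by rewrite ler_pdivlMr// mulrAC ler_pdivrMr// ler_pM2l.
pose Q := [set q : R | 0 < q < 1 /\ 2 * ellE1 p q = ellK1 p q].
have [[/andP[q0 q1] EK]|q0] : Q (q_star p) \/ q_star p = 0.
  rewrite /q_star; have [[q Qq]|nQ] := pselect (exists q, Q q).
    by left; apply: xgetPex; exists q.
  right; apply: xgetPN => q Qq; apply: nQ; by exists q.
- have aE : 2 * asin (q_star p) = pi - pi / m%:R by lra.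
  split => //.
    by rewrite -ellE1_intD ?(ltW q0)// EK subrr.
  have -> : 2 * q_star p ^+ 2 - 1 = cos (pi / m%:R).
    have h : cos (2 * asin (q_star p)) = 1 - 2 * q_star p ^+ 2 by apply: cos_2asin; lra.
    have -> : cos (pi / m%:R) = - cos (2 * asin (q_star p)).
      by rewrite aE addrC cosDpi cosN opprK.
    by rewrite h; ring.
  have pm0 : 0 < pi / m%:R :> R by rewrite divr_gt0.
  by apply: cos_gt0_pihalf; apply/andP; split; lra.
- by move: phi; rewrite q0 asin_0; lra.
Qed.

(** At the critical modulus K = 2 E, and the vanishing of [intD] becomes J = (2 q^2 - 1) E / q^2.
    The rest compares exponents through r p = p - 1. *)
Lemma varpi_intP q : q = q_star p -> 0 < q -> q < 1 -> intD r q = 0 -> 0 < 2 * q ^+ 2 - 1 ->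
  varpi_star p = (2 * intP r (2 * q ^+ 2 - 1)^-1) `^ p.
Proof.
move=> qE q0 q1 D0 c0; have r0 := conj_exp_gt0; have r1 := conj_exp_lt1.
have EK := ellE1_intD (ltW q0) q1; rewrite D0 ellK1_intK in EK.
have := intD_KJ r0 (ltW q0) q1; rewrite D0 => DJ.
rewrite /varpi_star -qE.
have [_ ->] := intP_Psi r0 q0 q1 c0.
rewrite /Psi; set c := 2 * q ^+ 2 - 1 in c0 *.
set E := ellE1 p q in EK *; set J := intJ r q in DJ *; set K := intK r q in EK DJ.
have KE : K = 2 * E by lra.
have JE : J = c * E / q ^+ 2.
  have q2 : q ^+ 2 != 0 by rewrite gt_eqF// exprn_gt0.
  apply: (mulIf q2); rewrite divfK//; rewrite KE in DJ; rewrite /c; lra.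
have J0 : 0 < J by exact: (intJ_gt0 r0 (ltW q0) q1).
have E0 : 0 < E.
  have : 0 < c * E / q ^+ 2 by rewrite -JE.
  by rewrite pmulr_lgt0 ?invr_gt0 ?exprn_gt0// pmulr_rgt0.
clearbody E J K c; rewrite JE; clear JE J0 DJ EK KE J K.
have -> : 2 * (2 `^ (r + 1) * (q `^ (2 * r + 1) * (c * E / q ^+ 2) * c `^ (- r))) =
    2 `^ (r + 2) * q `^ (2 * r - 1) * c `^ (1 - r) * E.
  have -> : 2 `^ (r + 2) = 2 `^ (r + 1) * 2 :> R.
    rewrite -[X in _ = _ * X]powRr1// -powRD ?pnatr_eq0 ?implybT//.
    by congr powR; ring.
  have -> : c `^ (1 - r) = c * c `^ (- r).
    rewrite -[X in _ = X * _]powRr1 ?(ltW c0)// -powRD//.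
    by rewrite (gt_eqF c0) implybT.
  have -> : q `^ (2 * r + 1) = q `^ (2 * r - 1) * q ^+ 2.
    rewrite -powR_mulrn ?(ltW q0)// -powRD; last by rewrite (gt_eqF q0) implybT.
    by congr powR; ring.
  by field; rewrite gt_eqF.
have pr : r * p = p - 1 by rewrite /r mulrBl mul1r mulVf// gt_eqF.
rewrite !powRM ?powR_ge0 ?mulr_ge0 ?powR_ge0 ?(ltW E0)// -!powRrM.
have -> : (r + 2) * p = 3 * p - 1 by rewrite mulrDl pr; ring.
have -> : (2 * r - 1) * p = p - 2 by rewrite mulrBl -mulrA pr; ring.
have -> : (1 - r) * p = 1 by rewrite mulrBl pr; ring.
by rewrite powRr1// ltW.
Qed.

(** Young's inequality for the conjugate exponents p and 1 / r, multiplied by p. Its equality case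
    x^p = u is the curvature law of the optimal leaf. *)
Lemma young_powR x u : 0 <= x -> 0 <= u -> p * (u `^ r * x) <= x `^ p + (p - 1) * u.
Proof.
move=> x0 u0; have r0 := conj_exp_gt0.
have ri : 0 < r^-1 by rewrite invr_gt0.
have := @conjugate_powR R x (u `^ r) p r^-1 x0 (powR_ge0 _ _) p0 ri.
rewrite invrK /r subrKC => /(_ erefl).
rewrite -/r -powRrM mulfV ?gt_eqF// powRr1// => h.
have := ler_wpM2l (ltW p0) h; rewrite mulrDr [p * (_ / p)]mulrC divfK ?gt_eqF//.
have -> : p * (u * r) = (p - 1) * u.
  by rewrite /r; field; rewrite gt_eqF.
by rewrite [x * _]mulrC.
Qed.

End critical_modulus.

(** * The energy of a single leaf *)

Section leaf_inequality.
Context {R : realType}.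
Implicit Types (a b t u v w x y : R).

Lemma seg_int_eq0_ge0 a b (f : R -> R) : {within `[a, b], continuous f} ->
  (forall x, x \in `[a, b] -> 0 <= f x) -> seg_int a b f = 0 ->
  forall x, x \in `]a, b[ -> f x = 0.
Proof.
move=> cf f0 F0 x xab.
have fi := L1_cont cf.
have Fz y : y \in `]a, b[ -> seg_int a y f = 0.
  rewrite in_itv/= => /andP[/ltW ay /ltW yb]; apply/eqP; rewrite eq_le.
  have h1 : 0 <= seg_int y b f.
    apply: seg_int_ge0 => t; rewrite in_itv/= => /andP[yt tb]; apply: f0.
    by rewrite in_itv/= tb (le_trans ay).
  have h2 : 0 <= seg_int a y f.
    apply: seg_int_ge0 => t; rewrite in_itv/= => /andP[at_ ty]; apply: f0.
    by rewrite in_itv/= at_ (le_trans ty).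
  by rewrite h2 andbT; move: F0; rewrite (@seg_int_split _ a b y)//; lra.
have d1 := seg_int_FTC1 cf xab.
have d2 : is_derive x 1 (fun y => seg_int a y f) 0.
  apply: near_eq_is_derive (der_cst 0 x).
  by near=> y; rewrite Fz//; near: y; exact: near_in_itvoo.
by rewrite -(@derive_val _ _ _ _ _ _ _ d1) (@derive_val _ _ _ _ _ _ _ d2).
Unshelve. all: by end_near. Qed.

Lemma ler_cos_norm w x : `|x| <= w -> w <= pi -> cos w <= cos x.
Proof.
move=> xw wpi; rewrite -(cos_norm x) ler_cos//; last exact: le_trans wpi.
by rewrite (le_trans _ xw).
Qed.

Lemma ltr_cos_norm w x : `|x| < w -> w <= pi -> cos w < cos x.
Proof.
move=> xw wpi; rewrite -(cos_norm x) ltr_cos// in_itv/=.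
  by rewrite normr_ge0 (le_trans (ltW xw)).
by rewrite wpi andbT (le_trans _ (ltW xw)).
Qed.

(** Equality between the two ends of the chain forces equality in each link. The conclusions kept
    are those that later identify the weight and the end angles. *)
Lemma chain_le (k P0 P1 A V S : R) : 0 < k -> P0 <= P1 -> P1 <= A -> 2 * A <= V ->
  k * V <= S -> k * (2 * P0) <= S /\ (k * (2 * P0) = S -> P1 = P0 /\ V = 2 * A).
Proof.
move=> k0 h1 h2 h3 h4.
have h5 : k * (2 * P0) <= k * V by rewrite ler_pM2l//; lra.
split; first exact: le_trans h4.
move=> E; have /(mulfI (lt0r_neq0 k0)) h6 : k * (2 * P0) = k * V.
  by apply/eqP; rewrite eq_le h5/= E.
by split; lra.
Qed.

Section fixed_exponent.
Variables (p q0 : R).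
Hypotheses (p1 : 1 < p) (q00 : 0 < q0) (q01 : q0 < 1).
Let r := 1 - p^-1.
Hypotheses (D0 : intD r q0 = 0) (c00 : 0 < 2 * q0 ^+ 2 - 1).
Let y0 := (2 * q0 ^+ 2 - 1)^-1.
Let r0 : 0 < r. Proof. exact: conj_exp_gt0. Qed.
Let r1 : r < 1. Proof. exact: conj_exp_lt1. Qed.

Let kprim y : exists A : R -> R, [/\ forall x, is_derive x 1 A (kfun r y x),
  forall x, A (- x) = - A x, forall u v, u <= v -> A u <= A v &
  forall v, 0 <= v -> A v = seg_int 0 v (kfun r y)].
Proof.
have ck := @kfun_continuous R r r0 y.
have [A A0 dA] := continuous_primitive ck.
have cA := is_derive_continuous dA.
have FTC u v : u <= v -> A v - A u = seg_int u v (kfun r y).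
  by move=> uv; apply/esym/seg_int_FTC2 => //; exact: within_continuousT.
exists A; split => //.
- move=> x; have : A x + A (- x) = A 0 + A (- 0).
    apply: (@is_derive_0_is_cst R (fun t => A t + A (- t)) x 0) => z.
    apply: (der_eq (derD (dA z) (der_comp (dA _) (derN (der_id z))))).
    by rewrite kfunN; ring.
  by rewrite oppr0 A0 addr0 addrC => /eqP; rewrite addr_eq0 => /eqP.
- move=> u v uv; rewrite -subr_ge0 FTC//; apply: seg_int_ge0 => t _; exact: kfun_ge0.
- by move=> v v0; rewrite -FTC// A0 subr0.
Qed.

(** A weight positive inside the range makes its primitive strictly increasing up to the extremes,
    where the weight itself may vanish. In the equality case this locates the end angles of the
    leaf. *)
Let kprim_inj y w (A : R -> R) : (forall x, is_derive x 1 A (kfun r y x)) ->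
  (forall x, `|x| < w -> 0 < 1 + y * cos x) ->
  forall x, `|x| <= w -> (A x = A w -> x = w) /\ (A x = A (- w) -> x = - w).
Proof.
move=> dA ypos x xw; have := xw; rewrite ler_norml => /andP[xw1 xw2].
have strict u v : - w <= u -> u < v -> v <= w -> A u < A v.
  move=> wu uv vw.
  have cA : {within `[u, v], continuous A}.
    by apply: within_continuousT; exact: is_derive_continuous dA.
  have [c] := MVT uv (fun x _ => dA x) cA.
  rewrite in_itv/= => /andP[uc cv] AE; rewrite -subr_gt0 AE mulr_gt0 ?subr_gt0//.
  by apply: kfun_gt0; apply: ypos; rewrite ltr_norml; apply/andP; split; lra.
split => AE; apply/eqP; apply: contraT.
  rewrite neq_lt => /orP[h|h]; last lra.
  by have := strict _ _ xw1 h (lexx w); rewrite AE ltxx.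
rewrite neq_lt => /orP[h|h]; first lra.
by have := strict _ _ (lexx _) h xw2; rewrite AE ltxx.
Qed.

(* [1 + y cos] calibrates a leaf whose angle stays within [w] of its mean
   direction: [y] makes it vanish at the extreme angles. *)
Let calib_width w : 0 <= w -> (w < pi -> cos w < 0) -> exists2 y, 1 <= y &
  [/\ forall x, `|x| <= w -> 0 <= 1 + y * cos x,
      forall A : R -> R, (forall u v, u <= v -> A u <= A v) ->
        (forall v, 0 <= v -> A v = seg_int 0 v (kfun r y)) -> intP r y <= A w &
      y = y0 -> w = 2 * asin q0 /\ forall x, `|x| < w -> 0 < 1 + y * cos x].
Proof.
move=> w0 cw; have pi0 := @pi_gt0 R.
have [wpi|wpi] := ltP w pi; last first.
  exists 1 => //; split.
  - by move=> x _; rewrite mul1r; have := cos_geN1 x; lra.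
  - by move=> A mA Ai; rewrite /intP -Ai ?pi_ge0//; exact: mA.
  (* The wide case y = 1 never meets [y0], because 2 q0^2 - 1 < 1. *)
  - move=> /esym/eqP; rewrite /y0 invr_eq1 => /eqP h; exfalso.
    by move: q00 q01 h; nra.
have {}cw := cw wpi.
pose y := (- cos w)^-1; have ncw : 0 < - cos w by rewrite oppr_gt0.
have y_0 : 0 < y by rewrite invr_gt0.
have yc : y * cos w = - 1 by rewrite /y invrN mulNr mulVf// lt_eqF.
have yV : y^-1 = - cos w by rewrite /y invrK.
have y_1 : 1 <= y by rewrite invf_ge1//; have := cos_geN1 w; lra.
clearbody y; exists y => //.
split.
- move=> x xw; have := ler_cos_norm xw (ltW wpi); nra.
- move=> A _ Ai; rewrite Ai// /intP.
  have ki a b : L1 a b (kfun r y) by apply: continuous_L1; exact: kfun_continuous.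
  rewrite (@seg_int_split _ 0 pi w)//; last exact: ltW.
  rewrite (@eq_seg_int _ w pi _ (fun=> 0)).
    by rewrite seg_int_cst ?mul0r ?addr0// ltW.
  move=> t; rewrite in_itv/= => /andP[t1 t2].
  have h : cos t <= cos w by rewrite ler_cos; lra.
  have h2 : 1 + y * cos t <= 0 by nra.
  by rewrite /kfun max_l// normr0 powR0 ?gt_eqF.
- move=> yy0; split.
    have cw0 : cos w = cos (2 * asin q0).
      rewrite cos_2asin; [|move: q00 q01; lra..].
      by have := yV; rewrite yy0 /y0 invrK; lra.
    have [a0 a1] := asin_itv q00 q01.
    by apply: cos_inj => //; rewrite in_itv/=; apply/andP; split; lra.
  by move=> x xw; have := ltr_cos_norm xw (ltW wpi); nra.
Qed.

Variables (a b lam : R) (nu theta kappa : R -> R).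
Hypotheses (ab : a < b) (cnu : {within `[a, b], continuous nu})
  (nu0 : forall t, t \in `[a, b] -> 0 < nu t) (acT : AC a b theta kappa)
  (int_cos : seg_int a b (fun t => nu t * cos (theta t)) = 0)
  (int_sin : seg_int a b (fun t => nu t * sin (theta t)) = 0)
  (Ei : L1 a b (fun t => `|kappa t / nu t| `^ p * nu t)) (lam0 : 0 < lam).

Let cT := AC_cont (ltW ab) acT.

Let int_cos_rot m : seg_int a b (fun t => nu t * cos (theta t - m)) = 0.
Proof.
have ci (g : R -> R) : continuous g -> L1 a b (fun t => nu t * g (theta t)).
  move=> cg; apply: L1_cont; apply: within_contM => //.
  exact: within_cont_comp cT.
have i1 := ci _ (@continuous_cos R); have i2 := ci _ (@continuous_sin R).
rewrite (@eq_seg_int _ _ _ _ (fun t => cos m * (nu t * cos (theta t)) + sin m * (nu t * sin (theta t)))).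
  by rewrite seg_intD ?seg_intZl ?int_cos ?int_sin ?mulr0 ?addr0//; exact: L1Zl.
by move=> t _; rewrite cosB; ring.
Qed.

Lemma leaf_inequality :
  2 * p * lam `^ r * intP r y0 <=
    seg_int a b (fun t => `|kappa t / nu t| `^ p * nu t) + (p - 1) * lam * seg_int a b nu /\
  (2 * p * lam `^ r * intP r y0 =
    seg_int a b (fun t => `|kappa t / nu t| `^ p * nu t) + (p - 1) * lam * seg_int a b nu ->
   theta b - theta a = 2 * (2 * asin q0) \/ theta b - theta a = - (2 * (2 * asin q0))).
Proof.
have pi0 := @pi_gt0 R; have ab_ := ab.
have aab : a \in `[a, b] by rewrite in_itv/= lexx ltW.
have bab : b \in `[a, b] by rewrite in_itv/= lexx ltW.
have [ta taab tamin] := EVT_min (ltW ab) cT.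
have [tb tbab tbmax] := EVT_max (ltW ab) cT.
pose m := (theta ta + theta tb) / 2; pose w := (theta tb - theta ta) / 2.
pose vt t := theta t - m.
have w0 : 0 <= w by rewrite /w; have := tamin _ tbab; lra.
have vtw t : t \in `[a, b] -> `|vt t| <= w.
  move=> tab; have := tamin _ tab; have := tbmax _ tab.
  by rewrite /vt /m /w ler_norml => ? ?; apply/andP; split; lra.
have vta : vt ta = - w by rewrite /vt /m /w; lra.
have vtb : vt tb = w by rewrite /vt /m /w; lra.
have cvt : {within `[a, b], continuous vt}.
  by apply: within_contB => //; exact: within_cont_cst.
have acV : AC a b vt kappa.
  have c0 : {within `[a, b], continuous (fun=> 0 : R)} by exact: within_cont_cst.
  have cm : {within `[a, b], continuous (fun=> m)} by exact: within_cont_cst.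
  have := ACB acT (C1_AC c0 cm (fun x _ => der_cst m x)).
  by apply: AC_ext => t _ //; rewrite subr0.
(* Otherwise the tangent stays within a right angle of the central direction: nu cos is nonnegative
   with zero integral, so it vanishes inside, yet it equals nu > 0 wherever the centred angle is
   0. *)
have cosw : w < pi -> cos w < 0.
  move=> wpi; rewrite ltNge; apply/negP => cw.
  have wpi2 : w <= pi / 2.
    rewrite leNgt; apply/negP => h.
    have : cos w < cos (pi / 2) by rewrite ltr_cos// in_itv/=; apply/andP; split; lra.
    by rewrite cos_pihalf ltNge cw.
  (* The zero has to be interior, since the integrand is only known to vanish on the open
     segment. *)
  have [t0 t0ab vt0] : exists2 t, t \in `]a, b[ & vt t = 0.
    have [w_0|wn0] := eqVneq w 0.
      have mid : (a + b) / 2 \in `[a, b] by rewrite in_itv/=; apply/andP; split; lra.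
      exists ((a + b) / 2); first by rewrite in_itv/=; apply/andP; split; lra.
      by have := vtw _ mid; rewrite w_0 normr_le0 => /eqP.
    have wp : 0 < w by rewrite lt0r wn0.
    have inside t : t \in `[a, b] -> vt t = 0 -> vt a != 0 -> vt b != 0 -> t \in `]a, b[.
      rewrite !in_itv/= => /andP[at_ tb'] vt0 va vb.
      rewrite !lt_neqAle at_ tb' !andbT; apply/andP; split.
        by apply: contra va => /eqP ->; apply/eqP.
      by apply: contra vb => /eqP <-; apply/eqP.
    have /andP[? ?] : a <= ta <= b by move: taab; rewrite in_itv.
    have /andP[? ?] : a <= tb <= b by move: tbab; rewrite in_itv.
    have [tt|tt] := leP ta tb.
      have [||c] := @IVT _ vt ta tb 0 tt.
      - exact: within_cont_subset cvt.
      - by rewrite vta vtb ge_min le_max; apply/andP; split; apply/orP; [left|right]; lra.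
      rewrite in_itv/= => /andP[tac ctb] vc; exists c => //.
      rewrite in_itv/= !lt_neqAle (le_trans _ tac)// (le_trans ctb)// !andbT.
      apply/andP; split; apply/eqP => cE.
        have : ta = c by apply/eqP; rewrite eq_le tac -cE.
        by move=> tc; move: vta; rewrite tc vc; lra.
      have : tb = c by apply/eqP; rewrite eq_le ctb cE andbT.
      by move=> tc; move: vtb; rewrite tc vc; lra.
    have [||c] := @IVT _ vt tb ta 0 (ltW tt).
    - exact: within_cont_subset cvt.
    - by rewrite vta vtb ge_min le_max; apply/andP; split; apply/orP; [right|left]; lra.
    rewrite in_itv/= => /andP[tac ctb] vc; exists c => //.
    rewrite in_itv/= !lt_neqAle (le_trans _ tac)// (le_trans ctb)// !andbT.
    apply/andP; split; apply/eqP => cE.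
      have : tb = c by apply/eqP; rewrite eq_le tac -cE.
      by move=> tc; move: vtb; rewrite tc vc; lra.
    have : ta = c by apply/eqP; rewrite eq_le ctb cE andbT.
    by move=> tc; move: vta; rewrite tc vc; lra.
  have t0ab' : t0 \in `[a, b] by move: t0ab; rewrite !in_itv/= => /andP[/ltW -> /ltW ->].
  have : nu t0 * cos (vt t0) = 0.
    apply: (@seg_int_eq0_ge0 a b (fun t => nu t * cos (vt t))) => //.
    - apply: within_contM => //; apply: within_cont_comp cvt.
      exact: continuous_cos.
    - move=> t tab; apply: mulr_ge0; first exact/ltW/nu0.
      by apply: le_trans cw (ler_cos_norm (vtw _ tab) (ltW wpi)).
    - exact: int_cos_rot.
  by rewrite vt0 cos0 mulr1 => h; have := nu0 t0ab'; rewrite h ltxx.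
have [y y1 [ycos yA yw]] := calib_width w0 cosw.
have [A [dA Aodd Amon Aint]] := kprim y.
have ck := @kfun_continuous R r r0 y.
have {}yA := yA A Amon Aint.
pose V t1 t2 := seg_int t1 t2 (fun t => kfun r y (vt t) * `|kappa t|).
have cki : {within `[a, b], continuous (fun t => kfun r y (vt t))}.
  exact: within_cont_comp cvt.
have ki := AC_L1 acT.
have Vi : L1 a b (fun t => kfun r y (vt t) * `|kappa t|).
  by apply: L1_contM => //; exact: L1_norm.
have Vge t1 t2 : a <= t1 -> t1 <= t2 -> t2 <= b -> `|A (vt t2) - A (vt t1)| <= V t1 t2.
  move=> at1 t12 t2b.
  rewrite (@AC_chain R A (kfun r y) vt kappa t1 t2 t12 dA ck (AC_sub at1 t2b acV)).
  have i : L1 t1 t2 (fun t => kfun r y (vt t) * kappa t).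
    by apply: (L1S at1 t2b); exact: L1_contM.
  apply: (le_trans (seg_int_norm i)); rewrite /V.
  rewrite le_eqVlt; apply/orP; left; apply/eqP; apply: eq_seg_int => t _.
  by rewrite normrM ger0_norm// kfun_ge0.
have /andP[ata tab'] : a <= ta <= b by move: taab; rewrite in_itv.
have /andP[atb tbb'] : a <= tb <= b by move: tbab; rewrite in_itv.
have Vsplit t1 t2 : a <= t1 -> t1 <= t2 -> t2 <= b -> V a b = V a t1 + V t1 t2 + V t2 b.
  move=> at1 t12 t2b; rewrite /V (@seg_int_split _ a b t1)//; last exact: le_trans t2b.
  rewrite (@seg_int_split _ t1 b t2)//; last exact: L1S Vi.
  by rewrite addrA.
have A2w : A w - A (- w) = 2 * A w by rewrite Aodd; ring.
have A2w' : 0 <= 2 * A w.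
  by rewrite -A2w subr_ge0; apply: Amon; lra.
(* [V a b] dominates the variation of [A] along the monotone piece plus the two
   end pieces. *)
have Vab : 2 * A w <= V a b /\ (V a b = 2 * A w ->
    (A (vt a) = A (- w) /\ A (vt b) = A w) \/ (A (vt a) = A w /\ A (vt b) = A (- w))).
  have [tt|tt] := leP ta tb.
    have v1 := Vge _ _ (lexx a) ata tab'.
    have v2 := Vge _ _ ata tt tbb'.
    have v3 := Vge _ _ atb tbb' (lexx b).
    rewrite (Vsplit _ _ ata tt tbb'); rewrite vta vtb A2w (ger0_norm A2w') in v1 v2 v3 *.
    have n1 := normr_ge0 (A (- w) - A (vt a)); have n3 := normr_ge0 (A (vt b) - A w).
    split; first lra.
    move=> E; left; split; apply/eqP; rewrite -subr_eq0 -normr_eq0.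
      by rewrite distrC eq_le n1 andbT; lra.
    by rewrite eq_le n3 andbT; lra.
  have {}tt := ltW tt.
  have v1 := Vge _ _ (lexx a) atb tbb'.
  have v2 := Vge _ _ atb tt tab'.
  have v3 := Vge _ _ ata tab' (lexx b).
  rewrite (Vsplit _ _ atb tt tab'); rewrite vta vtb in v1 v2 v3.
  rewrite -normrN opprB A2w (ger0_norm A2w') in v2.
  have n1 := normr_ge0 (A w - A (vt a)); have n3 := normr_ge0 (A (vt b) - A (- w)).
  split; first lra.
  move=> E; right; split; apply/eqP; rewrite -subr_eq0 -normr_eq0.
    by rewrite distrC eq_le n1 andbT; lra.
  by rewrite eq_le n3 andbT; lra.
set B := seg_int a b _; set L := seg_int a b nu.
have p0 : 0 < p by exact: lt_trans p1.
have young : p * lam `^ r * V a b <= B + (p - 1) * lam * L.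
  have nui : L1 a b nu by exact: L1_cont.
  have cosi : L1 a b (fun t => nu t * cos (vt t)).
    apply: L1_cont; apply: within_contM => //; apply: within_cont_comp cvt.
    exact: continuous_cos.
  have -> : B + (p - 1) * lam * L = seg_int a b (fun t => `|kappa t / nu t| `^ p * nu t +
      ((p - 1) * lam * nu t + (p - 1) * lam * y * (nu t * cos (vt t)))).
    rewrite seg_intD//; last by apply: L1D; exact: L1Zl.
    rewrite seg_intD; [|exact: L1Zl..].
    by rewrite !seg_intZl// int_cos_rot mulr0 addr0.
  rewrite -seg_intZl//; apply: le_seg_int.
  - exact: L1Zl.
  - by apply: L1D => //; apply: L1D; exact: L1Zl.
  - move=> t tab; have nt := nu0 tab; have u0 := ycos _ (vtw _ tab).
    have lu0 : 0 <= lam * (1 + y * cos (vt t)) by rewrite mulr_ge0// ltW.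
    have := young_powR p1 (normr_ge0 (kappa t / nu t)) lu0.
    rewrite powRM ?(ltW lam0)// -/r /kfun max_r// (ger0_norm u0).
    set u := (1 + _) `^ r => h.
    have := ler_wpM2r (ltW nt) h.
    rewrite normrM normfV (gtr0_norm nt).
    have -> : p * (lam `^ r * u * (`|kappa t| / nu t)) * nu t = p * lam `^ r * (u * `|kappa t|).
      by field; rewrite gt_eqF.
    by move=> /le_trans; apply; rewrite le_eqVlt; apply/orP; left; apply/eqP; ring.
have plam : 0 < p * lam `^ r by rewrite mulr_gt0// powR_gt0.
have Pmin : intP r y0 <= intP r y.
  have [->//|yy] := eqVneq y y0.
  by apply/ltW; exact: intP_min.
have [Vab1 Vab2] := Vab.
have [S1 S2] := chain_le plam Pmin yA Vab1 young.
have E0 : 2 * p * lam `^ r * intP r y0 = p * lam `^ r * (2 * intP r y0) by ring.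
rewrite E0; split; first exact: S1.
move=> /S2[ePy e1].
(* The minimizer of [intP] is unique, so equality determines y. This fixes the half-range to 2 asin
   q0, and injectivity of [A] puts the two ends of the leaf at opposite extremes. *)
have yy0 : y = y0.
  apply/eqP; apply: contraT => yy; have := intP_min r0 r1 q00 q01 c00 D0 y1 yy.
  by rewrite ePy ltxx.
have [wE ypos] := yw yy0.
have Ainj := kprim_inj dA ypos.
have [Aa1 Aa2] := Ainj _ (vtw _ aab); have [Ab1 Ab2] := Ainj _ (vtw _ bab).
have vd : theta b - theta a = vt b - vt a by rewrite /vt; ring.
rewrite vd -wE; case: (Vab2 e1) => -[ea eb]; [left|right].
  by rewrite (Ab1 eb) (Aa2 ea); ring.
by rewrite (Ab2 eb) (Aa1 ea); ring.
Qed.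

End fixed_exponent.
End leaf_inequality.

(** * Curves as chains of leaves *)

Section gluing_integrals.
Context {R : realType}.
Implicit Types (a b c t x y k : R) (f g : R -> R).

Let integral_oo a b (h : R -> \bar R) : measurable_fun `]a, b[ h ->
  (\int[lebesgue_measure]_(x in `[a, b]) h x =
   \int[lebesgue_measure]_(x in `]a, b[) h x)%E.
Proof.
move=> mh; have mh' : measurable_fun `[a, b[ h by apply/emeasurable_fun_itv_obnd_cbndP.
by rewrite integral_itv_obnd_cbnd// integral_itv_bndo_bndc.
Qed.

(** Endpoints are negligible for measurability as well as for the integral. This absorbs the
    junction at 1, where [circle_shift f] takes the value f 0 instead of f 1. *)
Lemma eq_oo_L1 a b f g : (forall x, x \in `]a, b[ -> f x = g x) ->
  L1 a b f -> L1 a b g /\ seg_int a b f = seg_int a b g.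
Proof.
move=> fg fi; have mf := L1_measurable fi.
have sub : `]a, b[%classic `<=` `[a, b]%classic.
  by move=> x /=; rewrite !in_itv/= => /andP[/ltW -> /ltW ->].
have mfo : measurable_fun `]a, b[ f by exact: measurable_funS sub mf.
have mgo : measurable_fun `]a, b[ g.
  apply: eq_measurable_fun mfo => x; rewrite inE; exact: fg.
have mg : measurable_fun `[a, b] g.
  by apply/measurable_fun_itv_bndo_bndcP; apply/measurable_fun_itv_obnd_cbndP.
split.
  apply/integrableP; split; first exact/measurable_EFinP.
  have /integrableP[_] := fi; apply: le_lt_trans.
  rewrite !integral_oo; [|by apply/measurable_EFinP; exact: measurableT_comp..].
  rewrite le_eqVlt; apply/orP; left; apply/eqP; apply: eq_integral => x.
  by rewrite inE/= => /fg ->.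
rewrite /seg_int /Rintegral !integral_oo; [|by apply/measurable_EFinP..].
by congr fine; apply: eq_integral => x; rewrite inE/= => /fg ->.
Qed.

Lemma L1_union a c b f : a <= c -> c <= b -> L1 a c f -> L1 c b f -> L1 a b f.
Proof.
move=> ac cb f1 f2.
have f2' : lebesgue_measure.-integrable `]c, b] (EFin \o f).
  apply: integrableS f2 => // x /=; rewrite !in_itv/= => /andP[/ltW -> ->] //.
have U : `[a, b]%classic = `[a, c]%classic `|` `]c, b]%classic.
  by rewrite -itv_bndbnd_setU// bnd_simp.
rewrite /L1 U; apply/integrableP.
have /integrableP[m1 i1] := f1; have /integrableP[m2 i2] := f2'.
have mU : measurable_fun (`[a, c] `|` `]c, b]) (EFin \o f).
  by apply/measurable_funU => //; split.
split => //.
have mUn : measurable_fun (`[a, c] `|` `]c, b]) (fun x => `|(EFin \o f) x|)%E.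
  exact: measurableT_comp.
rewrite ge0_integral_setU//; first exact: lte_add_pinfty.
apply/disj_setPS => y [/=]; rewrite 2!in_itv/= => /andP[_ yx] /andP[].
by rewrite ltNge yx.
Qed.

(* [circle_shift f] repeats [f] on (1, 2]. *)
Definition circle_shift f t := if t < 1 then f t else f (t - 1).

Lemma circle_shift_L1 f : L1 0 1 f -> L1 0 2 (circle_shift f).
Proof.
move=> fi; apply: (@L1_union 0 1 2); rewrite ?ler1n//.
  have [] := @eq_oo_L1 0 1 f (circle_shift f) _ fi => //.
  by move=> x; rewrite in_itv/= /circle_shift => /andP[_ ->].
have := @L1_shift R (- 1) 1 2 f; rewrite subrr (_ : 2 - 1 = 1) => [/(_ fi)|]; last by lra.
apply: eq_L1 => x; rewrite in_itv/= /circle_shift => /andP[x1 _].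
by rewrite ltNge x1.
Qed.

Lemma seg_int_circle_shift1 f t : L1 0 1 f -> 1 <= t -> t <= 2 ->
  seg_int 1 t (circle_shift f) = seg_int 0 (t - 1) f.
Proof.
move=> fi t1 t2.
have fi' : L1 (1 - 1) (t - 1) f by apply: L1S fi; lra.
rewrite -[in RHS](subrr 1) -(seg_int_shift fi').
apply: eq_seg_int => x; rewrite in_itv/= /circle_shift => /andP[x1 _].
by rewrite ltNge x1.
Qed.

Lemma seg_int_circle_shift0 f t : L1 0 1 f -> 0 <= t -> t <= 1 ->
  seg_int 0 t (circle_shift f) = seg_int 0 t f.
Proof.
move=> fi t0 t1; have fi' : L1 0 t f by apply: L1S fi.
have [] := @eq_oo_L1 0 t f (circle_shift f) _ fi' => //.
by move=> x; rewrite in_itv/= /circle_shift => /andP[_ xt]; rewrite (lt_le_trans xt).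
Qed.

Lemma seg_int_circle_shift f t : L1 0 1 f -> 0 <= t -> t <= 1 ->
  seg_int t (t + 1) (circle_shift f) = seg_int 0 1 f.
Proof.
move=> fi t0 t1; have si := circle_shift_L1 fi.
have h1 : seg_int 0 1 (circle_shift f) = seg_int 0 t f + seg_int t 1 (circle_shift f).
  by rewrite (@seg_int_split _ 0 1 t)//; [rewrite seg_int_circle_shift0|apply: L1S si; lra].
rewrite (@seg_int_split _ t (t + 1) 1)//; [|lra|by apply: L1S si; lra].
rewrite seg_int_circle_shift1//; [|lra..].
rewrite addrK -(@seg_int_circle_shift0 f 1)//.
by rewrite h1 addrC.
Qed.

Lemma AC_circle_shift f g : periodic f 1 -> AC 0 1 f g -> AC 0 2 f (circle_shift g).
Proof.
move=> pf [gi fE]; split; first exact: circle_shift_L1.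
have f1 : f 1 = f 0 by rewrite -[X in f X = _](add0r 1) pf.
have g0 : seg_int 0 1 g = 0.
  have := fE 1; rewrite in_itv/= lexx ler01 f1 => /(_ isT); lra.
move=> x; rewrite in_itv/= => /andP[x0 x2]; have [x1|x1] := leP x 1.
  by rewrite seg_int_circle_shift0//; apply: fE; rewrite in_itv/= x0.
have si := circle_shift_L1 gi.
rewrite (@seg_int_split _ 0 x 1)//; [|lra|by apply: L1S si; lra].
rewrite seg_int_circle_shift0// g0 add0r seg_int_circle_shift1//; last exact: ltW.
rewrite -[in LHS](subrK 1 x) pf; apply: fE.
by rewrite in_itv/=; apply/andP; split; lra.
Qed.

End gluing_integrals.

(** * Lifting a velocity to a tangent angle *)

Section polar_coordinates.
Context {R : realType}.
Implicit Types (t x y : R).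

Lemma expRN_der x : is_derive x 1 (fun u : R => expR (- u)) (- expR (- x)).
Proof.
by apply: (der_eq (der_comp (g := fun u => - u) (is_derive_expR _) (derN (der_id x)))); ring.
Qed.

Lemma continuous_expRN : continuous (fun u : R => - expR (- u)).
Proof.
move=> x; apply: cvgN.
by have := der_cont (expRN_der x).
Qed.

(** The derivative of the argument of X + i Y. For a velocity (X, Y) it is the curvature times the
    speed. *)
Definition turning (X Y x' y' : R -> R) t :=
  (X t * y' t - Y t * x' t) / (X t ^+ 2 + Y t ^+ 2).

(* [X + i Y = exp (u + i theta) (X a + i Y a)], where u + i theta integrates the
   logarithmic derivative. *)
Lemma polar_lift a b (X Y x' y' : R -> R) : a < b -> AC a b X x' -> AC a b Y y' ->
  (forall t, t \in `[a, b] -> 0 < X t ^+ 2 + Y t ^+ 2) ->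
  exists theta : R -> R, AC a b theta (turning X Y x' y') /\
    let v t := Num.sqrt (X t ^+ 2 + Y t ^+ 2) in
    forall t, t \in `[a, b] ->
      v t * cos (theta t) = (X a * X t + Y a * Y t) / v a /\
      v t * sin (theta t) = (X a * Y t - Y a * X t) / v a.
Proof.
move=> ab acX acY S0; have ab' := ltW ab.
have cX := AC_cont ab' acX; have cY := AC_cont ab' acY.
have cS : {within `[a, b], continuous (fun t => X t ^+ 2 + Y t ^+ 2)}.
  apply: (within_cont_eq (f := fun t => X t * X t + Y t * Y t)) => //.
  by apply: within_contD; exact: within_contM.
have cSV : {within `[a, b], continuous (fun t => (X t ^+ 2 + Y t ^+ 2)^-1)}.
  apply: (within_cont_comp_at (g := fun z => z^-1)) cS => t tab.
  by apply: inv_continuous; rewrite gt_eqF// S0.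
pose mu t := (X t * x' t + Y t * y' t) / (X t ^+ 2 + Y t ^+ 2).
have mui : L1 a b mu.
  apply: (eq_L1 (f := fun t => (X t ^+ 2 + Y t ^+ 2)^-1 * (X t * x' t + Y t * y' t))).
    by move=> t _; rewrite /mu mulrC.
  by apply: L1_contM => //; apply: L1D; apply: L1_contM => //; first [exact: AC_L1 acX|exact: AC_L1 acY].
have ki : L1 a b (turning X Y x' y').
  apply: (eq_L1 (f := fun t => (X t ^+ 2 + Y t ^+ 2)^-1 * (X t * y' t - Y t * x' t))).
    by move=> t _; rewrite /turning mulrC.
  by apply: L1_contM => //; apply: L1B; apply: L1_contM => //; first [exact: AC_L1 acX|exact: AC_L1 acY].
pose u t := 0 + seg_int a t mu; pose theta t := 0 + seg_int a t (turning X Y x' y').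
have acu : AC a b u mu by exact: AC_int.
have act : AC a b theta (turning X Y x' y') by exact: AC_int.
have u0 : u a = 0 by rewrite /u seg_int_aa addr0.
have t0 : theta a = 0 by rewrite /theta seg_int_aa addr0.
exists theta; split=> [//|v].
have cNs : continuous (fun x : R => - sin x) by move=> x; apply: cvgN; exact: continuous_sin.
have ac_cos := AC_comp (fun x => is_derive_cos x) cNs ab' act.
have ac_sin := AC_comp (fun x => is_derive_sin x) (@continuous_cos R) ab' act.
have ac_exp := AC_comp expRN_der continuous_expRN ab' acu.
(* [Z1] and [Z2] are the real and imaginary parts of exp (- u - i theta) (X + i Y). Its derivative
   vanishes by the choice of [mu] and [turning], so it keeps its value at [a]. *)
have Z1 : forall t, t \in `[a, b] -> expR (- u t) * (X t * cos (theta t) + Y t * sin (theta t)) = X a.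
  have := ACM ab' ac_exp (ACD (ACM ab' acX ac_cos) (ACM ab' acY ac_sin)).
  set f := (X in AC _ _ X _); set g := (X in AC _ _ _ X) => acf.
  have {}acf : AC a b f (fun=> 0).
    apply: AC_ext acf => // t tab; rewrite /g /mu /turning.
    by field; rewrite gt_eqF// S0.
  move=> t tab; rewrite -[LHS]/(f t) (AC0_cst acf tab) /f u0 t0 oppr0 expR0 cos0 sin0; ring.
have Z2 : forall t, t \in `[a, b] -> expR (- u t) * (Y t * cos (theta t) - X t * sin (theta t)) = Y a.
  have := ACM ab' ac_exp (ACB (ACM ab' acY ac_cos) (ACM ab' acX ac_sin)).
  set f := (X in AC _ _ X _); set g := (X in AC _ _ _ X) => acf.
  have {}acf : AC a b f (fun=> 0).
    apply: AC_ext acf => // t tab; rewrite /g /mu /turning.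
    by field; rewrite gt_eqF// S0.
  move=> t tab; rewrite -[LHS]/(f t) (AC0_cst acf tab) /f u0 t0 oppr0 expR0 cos0 sin0; ring.
move=> t tab; have aab : a \in `[a, b] by rewrite in_itv/= lexx ab'.
have z1 := Z1 t tab; have z2 := Z2 t tab.
have e0 := expR_gt0 (u t).
have ee : expR (u t) * expR (- u t) = 1 by rewrite expRxMexpNx_1.
have cs := cos2Dsin2 (theta t).
have v0 : 0 < v a by rewrite sqrtr_gt0 S0.
have va2 : v a ^+ 2 = X a ^+ 2 + Y a ^+ 2 by rewrite sqr_sqrtr// ltW// S0.
move: z1 z2 ee cs; set E := expR (- u t); set e := expR (u t) in e0 *.
set C := cos _; set s := sin _ => z1 z2 ee cs.
have hX : X t = e * (X a * C - Y a * s).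
  rewrite -z1 -z2 -[LHS]mul1r -[X in X * _]ee -[X in _ = _ * (X)]mul1r.
  by transitivity (e * E * (X t * (C ^+ 2 + s ^+ 2))); [rewrite cs; ring|ring].
have hY : Y t = e * (X a * s + Y a * C).
  rewrite -z1 -z2 -[LHS]mul1r -[X in X * _]ee.
  by transitivity (e * E * (Y t * (C ^+ 2 + s ^+ 2))); [rewrite cs; ring|ring].
have vE : v t = e * v a.
  rewrite /v; have -> : X t ^+ 2 + Y t ^+ 2 = e ^+ 2 * (X a ^+ 2 + Y a ^+ 2).
    rewrite hX hY; transitivity (e ^+ 2 * ((X a ^+ 2 + Y a ^+ 2) * (C ^+ 2 + s ^+ 2))); first by ring.
    by rewrite cs mulr1.
  by rewrite sqrtrM ?sqr_ge0// sqrtr_sqr gtr0_norm.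
split.
  have -> : X a * X t + Y a * Y t = e * C * v a ^+ 2 by rewrite hX hY va2; ring.
  by rewrite vE; field; rewrite gt_eqF.
have -> : X a * Y t - Y a * X t = e * s * v a ^+ 2 by rewrite hX hY va2; ring.
by rewrite vE; field; rewrite gt_eqF.
Qed.

End polar_coordinates.

(** * Summation over the leaves *)

Section leaf_chain.
Context {R : realType}.
Implicit Types (a b t x y z : R).

Lemma cos_lt1 x : 0 < x -> x < 2 * pi -> cos x < 1.
Proof.
move=> x0 x2; have s0 : 0 < sin (x / 2) by apply: sin_gt0_pi; apply/andP; split; lra.
rewrite (_ : x = x / 2 *+ 2); last by rewrite -mulr_natr divfK.
by rewrite cos_mulr2n cos2sin2; have := exprn_gt0 2 s0; lra.
Qed.

Lemma cos_2pi_int x (n : int) : cos (2 * pi * (x + n%:~R)) = cos (2 * pi * x).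
Proof. exact: (periodic_int x n (trig_periodic (@trig_cos R))). Qed.

(* The turning number of [S] signed leaves, each turning by [2 (pi - pi / m)], is
   an integer only if [m] divides [S]. *)
Lemma leaf_rotation (m : nat) (S : int) : (0 < m)%N -> (0 < `|S|)%N -> (`|S| < m)%N ->
  cos (S%:~R * (2 * (pi - pi / m%:R)) : R) < 1.
Proof.
move=> m0 S0 Sm; have mp : 0 < m%:R :> R by rewrite ltr0n.
have pi0 := @pi_gt0 R.
have -> : S%:~R * (2 * (pi - pi / m%:R)) = 2 * pi * (- (S%:~R / m%:R) + S%:~R) :> R.
  by field; rewrite gt_eqF.
rewrite cos_2pi_int -cos_norm.
have -> : `|2 * pi * - (S%:~R / m%:R)| = 2 * pi * (`|S|%N%:R / m%:R) :> R.
  rewrite normrM normrN (gtr0_norm (_ : 0 < 2 * pi)) ?mulr_gt0//.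
  by rewrite normrM normfV (gtr0_norm mp) -intr_norm natr_absz.
have s0 : 0 < `|S|%N%:R / m%:R :> R by rewrite divr_gt0// ltr0n.
have s1 : `|S|%N%:R / m%:R < 1 :> R by rewrite ltr_pdivrMr// mul1r ltr_nat.
by apply: cos_lt1; nra.
Qed.

Lemma abs_succ (S : int) : (`|(S + 1)%R| <= `|S|.+1)%N /\ odd `|(S + 1)%R| = ~~ odd `|S|.
Proof. by split; lia. Qed.

Lemma abs_pred (S : int) : (`|(S - 1)%R| <= `|S|.+1)%N /\ odd `|(S - 1)%R| = ~~ odd `|S|.
Proof. by split; lia. Qed.

Lemma uniq_points (B : set R) (m : nat) : (`I_m #<= B)%card ->
  exists s : seq R, [/\ uniq s, size s = m & forall x, x \in s -> B x].
Proof.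
move=> /pcard_leP[f]; exists [seq f i | i <- iota 0 m]; split.
- rewrite map_inj_in_uniq ?iota_uniq// => i j; rewrite !mem_iota/= !add0n => im jm.
  by move=> fij; apply: (@inj _ _ _ f); rewrite ?inE.
- by rewrite size_map size_iota.
- move=> x /mapP[i]; rewrite mem_iota/= add0n => im ->.
  exact: (@funS _ _ _ _ f).
Qed.

Lemma sorted_points (B : set R) (m : nat) : (`I_m #<= B)%card ->
  exists s : seq R, [/\ sorted <%R s, size s = m & forall x, x \in s -> B x].
Proof.
move=> /uniq_points[s [us sm sB]]; exists (sort <=%R s); split.
- by rewrite lt_sorted_uniq_le sort_uniq us sort_sorted//; exact: le_total.
- by rewrite size_sort.
- by move=> x; rewrite mem_sort; exact: sB.
Qed.

Section chain.
Variables (p q0 c lam : R) (nu theta kappa : R -> R) (Pt : R -> Prop).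
Hypotheses (p1 : 1 < p) (q00 : 0 < q0) (q01 : q0 < 1).
Let r := 1 - p^-1.
Hypotheses (D0 : intD r q0 = 0) (c00 : 0 < 2 * q0 ^+ 2 - 1).
Hypotheses (cnu : {within `[0, c], continuous nu})
  (nu0 : forall t, t \in `[0, c] -> 0 < nu t) (acT : AC 0 c theta kappa)
  (Ei : L1 0 c (fun t => `|kappa t / nu t| `^ p * nu t)) (lam0 : 0 < lam).
Hypothesis closed : forall s t, Pt s -> Pt t -> 0 <= s -> s < t -> t <= c ->
  seg_int s t (fun t => nu t * cos (theta t)) = 0 /\
  seg_int s t (fun t => nu t * sin (theta t)) = 0.

Let energy x y := seg_int x y (fun t => `|kappa t / nu t| `^ p * nu t) +
  (p - 1) * lam * seg_int x y nu.
Let K := 2 * p * lam `^ r * intP r (2 * q0 ^+ 2 - 1)^-1.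

Let energy_split x y z : 0 <= x -> x <= y -> y <= z -> z <= c ->
  energy x z = energy x y + energy y z.
Proof.
move=> x0 xy yz zc; have nui := L1_cont cnu.
rewrite /energy (@seg_int_split _ x z y)//; last by apply: L1S Ei.
rewrite (@seg_int_split _ x z y nu)//; last by apply: L1S nui.
by ring.
Qed.

Let path_le_last x s : path <%R x s -> x <= last x s.
Proof.
elim: s x => [|y s IH] x /=; first by rewrite lexx.
by move=> /andP[/ltW xy /IH]; exact: le_trans.
Qed.

(** The first leaf and the remaining chain each satisfy their own lower bound, so equality for the
    sum forces equality for both. Every leaf then adds or subtracts 1 in [S], which flips its parity
    and changes its absolute value by at most 1. *)
Lemma leaf_chain x (s : seq R) : path <%R x s -> Pt x -> (forall y, y \in s -> Pt y) ->
  0 <= x -> last x s <= c ->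
  (size s)%:R * K <= energy x (last x s) /\
  ((size s)%:R * K = energy x (last x s) -> exists S : int,
    [/\ (`|S| <= size s)%N, odd `|S| = odd (size s) &
     theta (last x s) - theta x = S%:~R * (2 * (2 * asin q0))]).
Proof.
elim: s x => [|y s IH] x /=.
  move=> _ _ _ x0 xc; rewrite mul0r /energy !seg_int_aa mulr0 addr0; split => // _.
  by exists 0; rewrite subrr mul0r.
move=> /andP[xy ps] Px Ps x0 lc.
have yl := path_le_last ps.
have y0 : 0 <= y by rewrite (le_trans x0)// ltW.
have yc : y <= c := le_trans yl lc.
have Py : Pt y by apply: Ps; rewrite inE eqxx.
have [IH1 IH2] := IH y ps Py (fun z zs => Ps z (mem_behead (s := y :: s) zs)) y0 lc.
have [cl1 cl2] := closed Px Py x0 xy yc.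
have sub : {within `[x, y], continuous nu} by exact: within_cont_subset cnu.
have nup t : t \in `[x, y] -> 0 < nu t.
  rewrite in_itv/= => /andP[xt ty]; apply: nu0.
  by rewrite in_itv/= (le_trans x0)// (le_trans ty).
have [L1_ L2_] := leaf_inequality p1 q00 q01 D0 c00 xy sub nup (AC_sub x0 yc acT) cl1 cl2
  (L1S x0 yc Ei) lam0.
rewrite -/r -/(energy x y) -/K in L1_ L2_.
rewrite (energy_split x0 (ltW xy) yl lc) -natr1 mulrDl mul1r addrC; split; first exact: lerD.
move=> E; have [|S [S1 S2 S3]] := IH2; first by apply/eqP; rewrite eq_le IH1/=; lra.
have tE : theta (last y s) - theta x = theta (last y s) - theta y + (theta y - theta x) by ring.
have := L2_ ltac:(lra); case=> t1; rewrite tE S3 t1.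
  have [A1 A2] := abs_succ S; exists (S + 1); split.
  - exact: leq_trans A1 _.
  - by rewrite A2 S2.
  - by rewrite rmorphD/=; ring.
have [A1 A2] := abs_pred S; exists (S - 1); split.
- exact: leq_trans A1 _.
- by rewrite A2 S2.
- by rewrite rmorphB/=; ring.
Qed.

End chain.
End leaf_chain.

(** * Necessity of the condition on the multiplicity *)

Section only_if.
Context {R : realType}.
Implicit Types (t x y : R).

(* [lam] is chosen as the Lagrange multiplier of [m'] leaves of equal length. *)
Lemma multiplier_balance (p L B P0 M : R) : 1 < p -> 0 < L -> 0 < M -> 0 < P0 ->
  L `^ (p - 1) * B = (2 * P0) `^ p * M `^ p ->
  exists2 lam, 0 < lam &
    M * (2 * p * lam `^ (1 - p^-1) * P0) = B + (p - 1) * lam * L.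
Proof.
move=> p1 L0 M0 P00 LB; have p0 := lt_trans ltr01 p1.
have T0 : 0 < 2 * P0 by rewrite mulr_gt0.
pose a := 2 * P0 * M / L.
have a0 : 0 < a by rewrite divr_gt0// mulr_gt0.
have BE : B = a `^ p * L.
  have Lp : 0 < L `^ (p - 1) by exact: powR_gt0.
  apply: (mulfI (lt0r_neq0 Lp)); rewrite LB.
  have -> : L `^ (p - 1) * (a `^ p * L) = a `^ p * (L * L `^ (p - 1)) by ring.
  rewrite (mulr_powRB1 (ltW L0) p0) -(powRM _ (ltW a0) (ltW L0)).
  by rewrite /a divfK ?gt_eqF// (powRM _ (ltW T0) (ltW M0)).
exists (a `^ p); first exact: powR_gt0.
rewrite BE -powRrM.
have -> : p * (1 - p^-1) = p - 1 by field; rewrite gt_eqF.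
have -> : a `^ p = a * a `^ (p - 1) by rewrite mulr_powRB1// ltW.
have aL : a * L = 2 * P0 * M by rewrite /a divfK// gt_eqF.
transitivity (p * a `^ (p - 1) * (a * L)); first by rewrite aL; ring.
by ring.
Qed.

Variables (m : nat) (p : R) (gamma : R -> 'rV[R]_2) (P : 'rV[R]_2) (m' : nat).
Hypotheses (m3 : (3 <= m)%N) (p1 : 1 < p) (hphi : phi_star p = pi / m%:R).
Hypotheses (hm' : (2 <= m')%N) (hW : W2p_imm p gamma) (hmult : has_multiplicity gamma P m')
  (hE : normalized_bending_energy p gamma = (varpi_star p * m'%:R `^ p)%:E).

Lemma only_if_multiplicity : odd m -> ~~ odd m' \/ (m <= m')%N.
Proof.
move=> modd; have [Wi vel0] := hW; have p1' := p1.
have [X [cX pX dX acX]] := W2p_C1 (ltW p1) (Wi 0).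
have [Y [cY pY dY acY]] := W2p_C1 (ltW p1) (Wi 1).
set x' := weak_deriv _ in acX; set y' := weak_deriv _ in acY.
have XE : derive1 (component gamma 0) = X.
  by apply/funext => t; rewrite derive1E; exact: derive_val.
have YE : derive1 (component gamma 1) = Y.
  by apply/funext => t; rewrite derive1E; exact: derive_val.
have vX t : velocity gamma t 0 0 = X t by rewrite mxE XE.
have vY t : velocity gamma t 0 1 = Y t by rewrite mxE YE.
pose nu t := Num.sqrt (X t ^+ 2 + Y t ^+ 2).
have speedE t : speed gamma t = nu t.
  rewrite /speed /euclidean_norm !big_ord_recl big_ord0 addr0 vX.
  by rewrite (_ : lift ord0 ord0 = 1) ?vY//; exact: val_inj.
have S0 t : 0 < X t ^+ 2 + Y t ^+ 2.
  rewrite lt0r addr_ge0 ?sqr_ge0// andbT paddr_eq0 ?sqr_ge0// !sqrf_eq0.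
  apply: contra (vel0 t) => /andP[/eqP X0 /eqP Y0]; apply/eqP/rowP => i.
  rewrite mxE; case: i => -[|[|//]] ii; rewrite mxE.
    by rewrite (_ : Ordinal ii = 0) ?XE//; exact: val_inj.
  by rewrite (_ : Ordinal ii = 1) ?YE//; exact: val_inj.
have nu0 t : 0 < nu t by rewrite sqrtr_gt0.
have nu2 t : nu t ^+ 2 = X t ^+ 2 + Y t ^+ 2 by rewrite sqr_sqrtr// ltW.
have cnu : continuous nu.
  move=> t; apply: (@cvg_comp _ _ _ (fun t => X t ^+ 2 + Y t ^+ 2) Num.sqrt).
    have -> : (fun t => X t ^+ 2 + Y t ^+ 2) = (fun t => X t * X t + Y t * Y t) by [].
    by apply: cvgD; apply: cvgM; first [exact: cX|exact: cY].
  exact: sqrt_continuous.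
have pnu : periodic nu 1 by move=> t; rewrite /nu pX pY.
have nui a b : L1 a b nu by exact: continuous_L1.
have curvE t : curvature gamma t = (X t * y' t - Y t * x' t) / nu t ^+ 3.
  by rewrite /curvature speedE vX vY !mxE.
pose g t := `|curvature gamma t| `^ p * nu t.
have curv_m : measurable_fun `[(0 : R), 1] (curvature gamma).
  have ci : L1 0 1 (fun t => (nu t ^+ 3)^-1 * (X t * y' t - Y t * x' t)).
    apply: L1_contM.
      apply: within_continuousT => t; apply: cvgV; first by rewrite expf_neq0// gt_eqF.
      have -> : (fun t => nu t ^+ 3) = (fun t => nu t * (nu t * nu t)).
        by apply/funext => u; rewrite !exprS expr0 mulr1.
      have -> : nu t ^+ 3 = nu t * (nu t * nu t) by rewrite !exprS expr0 mulr1.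
      by apply: cvgM; [exact: cnu|apply: cvgM; exact: cnu].
    apply: L1B; apply: L1_contM; try exact: within_continuousT.
      exact: AC_L1 acY.
    exact: AC_L1 acX.
  apply: eq_measurable_fun (L1_measurable ci) => t _.
  by rewrite curvE mulrC.
have g_m : measurable_fun `[(0 : R), 1] g.
  apply: measurable_funM.
    apply: (measurableT_comp (measurable_powR _)) => //.
    exact: measurableT_comp.
  exact: L1_measurable (nui 0 1).
have g0 t : 0 <= g t by rewrite mulr_ge0 ?powR_ge0// ltW.
pose L := seg_int 0 1 nu.
have L0 : 0 < L by apply: seg_int_gt0 => //; exact: within_continuousT.
have lenE : curve_length gamma = L%:E.
  by rewrite /curve_length -(L1_EFin (nui 0 1)); apply: eq_integral => t _; rewrite speedE.
have bendE : bending_energy p gamma = (\int[lebesgue_measure]_(t in `[0%R, 1%R]) (g t)%:E)%E.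
  by apply: eq_integral => t _; rewrite speedE.
have Lp : 0 < L `^ (p - 1) by exact: powR_gt0.
(* An infinite bending energy, multiplied by a positive power of the length, would contradict the
   finite value in [hE]. *)
have gi : L1 0 1 g.
  apply/integrableP; split; first exact/measurable_EFinP.
  have -> : (\int[lebesgue_measure]_(t in `[0%R, 1%R]) `|(EFin \o g) t|)%E =
      bending_energy p gamma.
    by rewrite bendE; apply: eq_integral => t _ /=; rewrite ger0_norm.
  rewrite ltey; apply/eqP => Eoo; move: hE.
  rewrite /normalized_bending_energy lenE Eoo poweR_EFin.
  by rewrite gt0_muley// lte_fin.
pose B := seg_int 0 1 g.
have LB : L `^ (p - 1) * B = varpi_star p * m'%:R `^ p.
  move: hE; rewrite /normalized_bending_energy lenE bendE poweR_EFin (L1_EFin gi) -EFinM.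
  by move=> [].
have [q00 q01 D0 asinE c00] := q_star_spec p1 m3 hphi.
have vp := varpi_intP p1 erefl q00 q01 D0 c00.
set q0 := q_star p in q00 q01 D0 asinE c00 vp.
have r0 := conj_exp_gt0 p1; have r1 := conj_exp_lt1 p1.
have P00 := intP_gt0 r0 q00 q01 c00.
have mp0 : 0 < m'%:R :> R by rewrite ltr0n (leq_trans _ hm').
rewrite vp in LB.
have [lam lam0 bal] := multiplier_balance p1 L0 mp0 P00 LB.
have ac2X := AC_circle_shift pX acX; have ac2Y := AC_circle_shift pY acY.
have lt02 : 0 < 2 :> R by [].
(* Two periods are needed: the last leaf starts at the largest chosen parameter below 1, crosses 1
   and ends at x + 1. *)
have [theta [act polar]] := polar_lift lt02 ac2X ac2Y (fun t _ => S0 t).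
set kappa := turning _ _ _ _ in act.
have kE t : `|kappa t / nu t| `^ p * nu t = circle_shift g t.
  have h u : turning X Y x' y' u / nu u = curvature gamma u.
    rewrite /turning curvE -nu2; field; by rewrite gt_eqF.
  rewrite /circle_shift /kappa; case: ifPn => t1.
    have -> : turning X Y (circle_shift x') (circle_shift y') t = turning X Y x' y' t.
      by rewrite /turning /circle_shift t1.
    by rewrite h.
  have -> : turning X Y (circle_shift x') (circle_shift y') t = turning X Y x' y' (t - 1).
    by rewrite /turning /circle_shift (negbTE t1) -[in X t](subrK 1 t) -[in Y t](subrK 1 t) pX pY.
  have -> : nu t = nu (t - 1) by rewrite -[in LHS](subrK 1 t) pnu.
  by rewrite h.
have Ei : L1 0 2 (fun t => `|kappa t / nu t| `^ p * nu t).
  by apply: eq_L1 (circle_shift_L1 gi) => t _; rewrite kE.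
have nuE : nu = circle_shift nu.
  apply/funext => t; rewrite /circle_shift; case: ifPn => // _.
  by rewrite -[in LHS](subrK 1 t) pnu.
pose Pt t := gamma t = P.
have closed s t : Pt s -> Pt t -> 0 <= s -> s < t -> t <= 2 ->
  seg_int s t (fun t => nu t * cos (theta t)) = 0 /\
  seg_int s t (fun t => nu t * sin (theta t)) = 0.
  move=> Ps Pt_ s0 st t2.
  have FTC (F f : R -> R) : continuous f -> (forall x, is_derive x 1 F (f x)) ->
      F s = F t -> seg_int s t f = 0.
    move=> cf dF FE; rewrite -(subrr (F t)) -{2}FE.
    apply: seg_int_FTC2 => //; [exact: ltW|exact: within_continuousT|].
    by apply: within_continuousT; exact: is_derive_continuous dF.
  have iX : seg_int s t X = 0 by apply: (FTC _ _ cX dX); rewrite /component Ps Pt_.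
  have iY : seg_int s t Y = 0 by apply: (FTC _ _ cY dY); rewrite /component Ps Pt_.
  have Xi : L1 s t X by exact: continuous_L1.
  have Yi : L1 s t Y by exact: continuous_L1.
  have inn u : u \in `[s, t] -> u \in `[0, 2].
    by rewrite !in_itv/= => /andP[su ut]; rewrite (le_trans s0)// (le_trans ut).
  split.
    rewrite (@eq_seg_int _ _ _ _ (fun u => X 0 / nu 0 * X u + Y 0 / nu 0 * Y u)).
      by rewrite seg_intD ?seg_intZl ?iX ?iY ?mulr0 ?addr0//; exact: L1Zl.
    by move=> u /inn /polar[-> _]; rewrite -/(nu 0); ring.
  rewrite (@eq_seg_int _ _ _ _ (fun u => X 0 / nu 0 * Y u - Y 0 / nu 0 * X u)).
    by rewrite seg_intB ?seg_intZl ?iX ?iY ?mulr0 ?subr0//; exact: L1Zl.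
  by move=> u /inn /polar[_ ->]; rewrite -/(nu 0); ring.
have [[|x s] [ss sm sP]] := sorted_points hmult.
  by move: hm'; rewrite -sm.
have [x01 Px] := sP x (mem_head _ _).
have /andP[x0 x1] : 0 <= x < 1 by move: x01; rewrite /= in_itv.
have s1 y : y \in x :: s -> y < 1.
  by move=> /sP[+ _]; rewrite /= in_itv/= => /andP[].
have last1 : last x s < x + 1 by apply: (@lt_le_trans _ _ 1); [exact/s1/mem_last|lra].
have ps : path <%R x (rcons s (x + 1)) by rewrite rcons_path last1 andbT.
have perP t : gamma (t + 1) = gamma t.
  apply/rowP => i; rewrite -[LHS]/(component gamma i (t + 1)) -[RHS]/(component gamma i t).
  by have [pi_ _ _ _] := Wi i; exact: pi_.
have Ps y : y \in rcons s (x + 1) -> Pt y.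
  rewrite mem_rcons inE => /predU1P[->|ys]; first by rewrite /Pt perP.
  by have [] := sP y (mem_behead (s := x :: s) ys).
have lx : last x (rcons s (x + 1)) <= 2 by rewrite last_rcons; lra.
have [_ C] := leaf_chain p1 q00 q01 D0 c00 (within_continuousT cnu) (fun t _ => nu0 t)
  act Ei lam0 closed ps Px Ps x0 lx.
rewrite last_rcons size_rcons in C.
have sizeE : (size s).+1 = m' by rewrite -sm.
rewrite sizeE in C.
have e1 : seg_int x (x + 1) (fun t => `|kappa t / nu t| `^ p * nu t) = B.
  rewrite (@eq_seg_int _ _ _ _ (circle_shift g)) ?seg_int_circle_shift ?(ltW x1)//.
have e2 : seg_int x (x + 1) nu = L.
  by rewrite nuE seg_int_circle_shift ?(ltW x1)//.
rewrite e1 e2 in C.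
have [S [S1 S2 S3]] := C bal.
have xin : x \in `[0, 2] by rewrite in_itv/=; apply/andP; split; lra.
have x1in : x + 1 \in `[0, 2] by rewrite in_itv/=; apply/andP; split; lra.
have [c1 c2] := polar _ xin; have [c3 c4] := polar _ x1in.
rewrite -/(nu (x + 1)) pX pY pnu -/(nu x) in c1 c2 c3 c4.
have ccos : cos (theta (x + 1)) = cos (theta x).
  by apply: (mulfI (lt0r_neq0 (nu0 x))); rewrite c3 c1.
have csin : sin (theta (x + 1)) = sin (theta x).
  by apply: (mulfI (lt0r_neq0 (nu0 x))); rewrite c4 c2.
(* The velocity is periodic, so the total turning is a multiple of 2 pi. *)
have : cos (theta (x + 1) - theta x) = 1.
  by rewrite cosB ccos csin -!expr2 cos2Dsin2.
rewrite S3 asinE => cos1.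
have [m'odd|] := boolP (odd m'); last by left.
right; rewrite leqNgt; apply/negP => m'm.
have Spos : (0 < `|S|)%N by rewrite lt0n; apply: contraL m'odd => /eqP S_0; rewrite -S2 S_0.
have := @leaf_rotation R m S (leq_trans _ m3) Spos (leq_ltn_trans S1 m'm).
by rewrite cos1 ltxx => /(_ isT).
Qed.

End only_if.

(** * The optimal leaf *)

Section optimal_leaf.
Context {R : realType}.
Implicit Types (a b h s t x y : R).

(** This yields the elliptic parameter as a function of arclength. The derivative [e] may be
    singular at the ends, so the inverse is only differentiated inside and merely continuous up to
    the ends. *)
Lemma increasing_inverse (S e : R -> R) a b : a < b -> continuous S ->
  (forall t, t \in `]a, b[ -> is_derive t 1 S (e t)) ->
  (forall t, t \in `]a, b[ -> 0 < e t) -> exists tau : R -> R,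
  [/\ {within `[S a, S b], continuous tau}, {in `[a, b], cancel S tau},
      forall t, t \in `]a, b[ -> is_derive (S t) 1 tau (e t)^-1 &
      forall s, s \in `]S a, S b[ -> exists2 t, t \in `]a, b[ & S t = s].
Proof.
move=> ab cS dS e0.
have cSw u v : {within `[u, v], continuous S} by exact: within_continuousT.
have Sinc u v : a <= u -> u < v -> v <= b -> S u < S v.
  move=> au uv vb.
  have dS' t : t \in `]u, v[ -> t \in `]a, b[.
    by rewrite !in_itv/= => /andP[/(le_lt_trans au) -> /lt_le_trans ->].
  have [c cuv SE] := MVT uv (fun t tuv => dS t (dS' t tuv)) (cSw u v).
  by rewrite -subr_gt0 SE mulr_gt0 ?subr_gt0// e0// dS'.
have Sinj : {in `[a, b] &, injective S}.
  move=> u v; rewrite !in_itv/= => /andP[au ub] /andP[av vb] SE.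
  apply/eqP; apply: contraT; rewrite neq_lt => /orP[] uv.
    by have := Sinc _ _ au uv vb; rewrite SE ltxx.
  by have := Sinc _ _ av uv ub; rewrite SE ltxx.
pose tau s := xget 0 [set t | t \in `[a, b] /\ S t = s].
have tauK : {in `[a, b], cancel S tau}.
  move=> t tab; have [tab' E] : [set t' | t' \in `[a, b] /\ S t' = S t] (tau (S t)).
    by apply: xgetPex; exists t.
  exact: Sinj E.
exists tau; split => //.
- exact: segment_can_le_continuous (ltW ab) (cSw a b) tauK.
- move=> t tab; apply: is_derive_inverse.
  + near=> z; apply: tauK; apply: subset_itv_oo_cc.
    by near: z; exact: near_in_itvoo.
  + by near=> z; exact: cS.
  + exact: dS.
  + by rewrite gt_eqF// e0.
- move=> s; rewrite in_itv/= => /andP[s1 s2].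
  have [|t] := @IVT _ S a b s (ltW ab) (cSw a b).
    have Sab := lt_trans s1 s2.
    by rewrite ge_min le_max (ltW s1) (ltW s2) orbT.
  rewrite in_itv/= => /andP[at_ tb] E; exists t => //.
  rewrite in_itv/= !lt_neqAle at_ tb !andbT; apply/andP; split; apply/eqP => tE.
    by move: s1; rewrite -E -tE ltxx.
  by move: s2; rewrite -E tE ltxx.
Unshelve. all: by end_near. Qed.

Lemma asin_opp x : -1 <= x <= 1 -> asin (- x) = - asin x.
Proof.
move=> x1; rewrite -[in LHS](@asinK R x)// -sinN sinK//.
have := asin_geNpi2 x1; have := asin_lepi2 x1; rewrite in_itv/=; lra.
Qed.

Lemma sin_elangle u t : 0 <= u -> u < 1 ->
  sin (elangle u t) = 2 * (u * sin t) * dn u t.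
Proof.
move=> u0 u1; have /andP[h1 h2] := sin_dn_lt1 t u0 u1.
have hi : -1 <= u * sin t <= 1 by rewrite !ltW.
rewrite /elangle mulr_natl sin_mulr2n asinK// cos_asin// exprMn -/(dn u t).
by rewrite -mulr_natl; ring.
Qed.

Variables (p q : R).
Hypotheses (p1 : 1 < p) (q0 : 0 < q) (q1 : q < 1).
Let r := 1 - p^-1.
Hypotheses (D0 : intD r q = 0) (c0 : 0 < 2 * q ^+ 2 - 1).

Lemma optimal_leaf : exists phi k : R -> R,
  [/\ AC 0 1 phi k, {within `[0, 1], continuous k}, k 0 = 0 /\ k 1 = 0,
      phi 1 - phi 0 = 2 * (2 * asin q) &
      [/\ seg_int 0 1 (fun x => cos (phi x)) = 0,
          seg_int 0 1 (fun x => sin (phi x)) = 0 &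
          seg_int 0 1 (fun x => `|k x| `^ p) =
            (4 * intK r q * q) `^ p * ((2 * q ^+ 2 - 1) / (2 * q ^+ 2))]].
Proof.
have r0 : 0 < r by exact: conj_exp_gt0.
have q0' := ltW q0; have pi0 := @pi_gt0 R; have q0_ := q0; have q1_ := q1; have c0_ := c0.
have p0 := lt_trans ltr01 p1.
pose h : R := pi / 2; have h0 : 0 < h by rewrite /h; lra.
have [S0 [cS0 S0odd dS0 _]] := arc_length_primitive q0' q1 r0.
have [ki KE] := ek_arc q0' q1 cS0 dS0.
have S00 : S0 0 = 0 by have := S0odd 0; rewrite oppr0; lra.
rewrite S00 subr0 in KE.
set K := intK r q in KE *.
have K0 : 0 < K.
  have cS0w : {within `[0, pi / 2], continuous S0} by exact: within_continuousT.
  have tp t : t \in `]0, (pi / 2)[ -> t \in `](- (pi / 2)), (pi / 2)[.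
    by rewrite !in_itv/= => /andP[? ->]; rewrite andbT; lra.
  have [c cI SE] := MVT h0 (fun t tI => dS0 t (tp t tI)) cS0w.
  by move: SE; rewrite S00 !subr0 KE => ->; rewrite mulr_gt0// ek_gt0// tp.
(* Arclength normalized to run from 0 to 1: the unscaled leaf, over [- h, h], has length 2 K. *)
pose S t := (2 * K)^-1 * (S0 t + K).
have K2 : 2 * K != 0 by rewrite gt_eqF// mulr_gt0.
have cS : continuous S.
  move=> t; apply: cvgM; first exact: cvg_cst.
  by apply: cvgD; [exact: cS0|exact: cvg_cst].
have Kn0 : K != 0 by rewrite gt_eqF.
have S1 : S h = 1 by rewrite /S -KE; field.
have S0' : S (- h) = 0 by rewrite /S S0odd -KE; ring.
have dS t : t \in `](- h), h[ -> is_derive t 1 S ((2 * K)^-1 * ek r q t).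
  move=> th; apply: (der_eq (derZ _ (derD (dS0 t th) (der_cst K t)))).
  by rewrite addr0.
have eS t : t \in `](- h), h[ -> 0 < (2 * K)^-1 * ek r q t.
  move=> th; apply: mulr_gt0; last exact: (ek_gt0 r q0' q1 th).
  by rewrite invr_gt0 mulr_gt0.
have hh : - h < h by lra.
have [tau [ctau tauK dtau tauS]] := increasing_inverse hh cS dS eS.
rewrite S1 S0' in ctau tauS.
have tau0 : tau 0 = - h by rewrite -S0' tauK// in_itv/= lexx ltW.
have tau1 : tau 1 = h by rewrite -S1 tauK// in_itv/= lexx ltW.
have ctw (f : R -> R) : continuous f -> {within `[0, 1], continuous (fun x => f (tau x))}.
  by move=> cf; exact: within_cont_comp ctau.
have dcomp (F : R -> R) (f : R -> R) : (forall t, t \in `](- h), h[ -> is_derive t 1 F (f t)) ->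
    forall x, x \in `]0, 1[ -> exists t, [/\ t \in `](- h), h[, tau x = t &
     is_derive x 1 (fun x => F (tau x)) (f t * (2 * K / ek r q t))].
  move=> dF x /tauS[t th tE]; exists t.
  have tt : tau x = t by rewrite -tE tauK//; exact: subset_itv_oo_cc.
  split=> //.
  have d1 : is_derive x 1 tau ((2 * K)^-1 * ek r q t)^-1 by rewrite -tE; exact: dtau.
  have d2 : is_derive (tau x) 1 F (f t) by rewrite tt; exact: dF.
  apply: (der_eq (der_comp (g := tau) d2 d1)).
  by field; rewrite Kn0/= gt_eqF// ek_gt0.
(* Dividing the derivative of the angle by that of arclength leaves the power 1 - (2 r - 1) = 2 / p
   of the cosine. Its positivity makes the curvature vanish at both ends. *)
pose s := 2 - 2 * r.
have pV0 : 0 < p^-1 by rewrite invr_gt0.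
have s0 : 0 < s by rewrite /s /r; lra.
pose ks t := 4 * K * q * `|cos t| `^ s.
have cks : continuous ks.
  by move=> t; apply: cvgM; [exact: cvg_cst|exact: cos_powR_continuous].
have del t := der_elangle t q0' q1.
have cel := is_derive_continuous del.
have ratio t : t \in `](- h), h[ ->
    2 * q * cos t / dn q t * (2 * K / ek r q t) = ks t.
  move=> th; have ct := cos_gt0_itv th; have dnt := dn_gt0 t q0' q1.
  rewrite /ek /ks (gtr0_norm ct).
  have C0 : 0 < cos t `^ (2 * r - 1) by exact: powR_gt0.
  have -> : cos t `^ s = cos t / cos t `^ (2 * r - 1).
    rewrite -[X in _ = X / _]powRr1 ?(ltW ct)// -powRB; last by rewrite (gt_eqF ct) implybT.
    by congr powR; rewrite /s; ring.
  by field; rewrite !gt_eqF.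
have acphi : AC 0 1 (fun x => elangle q (tau x)) (fun x => ks (tau x)).
  have d1 x : x \in `]0, 1[ -> is_derive x 1 (fun x => elangle q (tau x)) (ks (tau x)).
    move=> x01; have [t [th tt d]] := dcomp _ _ (fun t _ => del t) x x01.
    by apply: (der_eq d); rewrite tt ratio.
  exact: (C1_AC (ctw _ cks) (ctw _ cel) d1).
exists (fun x => elangle q (tau x)), (fun x => ks (tau x)); split => //.
- exact: ctw.
- rewrite tau0 tau1 /ks cosN cos_pihalf normr0 powR0 ?gt_eqF// mulr0.
  by split.
- rewrite tau0 tau1 /elangle sinN sin_pihalf mulrN mulr1.
  have qi : -1 <= q <= 1 by apply/andP; split; lra.
  by rewrite (asin_opp qi); ring.
have cej := ej_continuous r0 q0' q1.
have [J J0 dJ] := continuous_primitive cej.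
have cJ := is_derive_continuous dJ.
have Jodd : J (- h) = - J h.
  have : J h + J (- h) = J 0 + J (- 0).
    apply: (@is_derive_0_is_cst R (fun t => J t + J (- t)) h 0) => z.
    apply: (der_eq (derD (dJ z) (der_comp (dJ _) (derN (der_id z))))).
    have -> : ej r q (- z) = ej r q z by rewrite /ej /dn cosN sinN sqrrN.
    by ring.
  by rewrite oppr0 J0 addr0; lra.
have JE : J h = intJ r q.
  have w1 : {within `[0, pi / 2], continuous (ej r q)} by exact: within_continuousT.
  have w2 : {within `[0, pi / 2], continuous J} by exact: within_continuousT.
  by have := seg_int_FTC2 (ltW h0) w1 w2 (fun x _ => dJ x); rewrite J0 subr0 => <-.
(* [XC] and [XS] are primitives of cos and sin of the tangent angle in the
   elliptic parameter; [D0] closes the leaf in the first direction and the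
   vanishing of [cos] at both ends in the second. *)
pose XC t := (1 - 2 * q ^+ 2) * S0 t + 2 * q ^+ 2 * J t.
have cXC : continuous XC.
  by move=> t; apply: cvgD; apply: cvgM; first [exact: cvg_cst|exact: cS0|exact: cJ].
have dXC t : t \in `](- h), h[ -> is_derive t 1 XC (ek r q t * cos (elangle q t)).
  move=> th; apply: (der_eq (derD (derZ _ (dS0 t th)) (derZ _ (dJ t)))).
  rewrite cos_elangle// /ej cos_powR_shift2// -[X in X / _]/(_ * _) cos2sin2 /ek; ring.
have XCend : XC h - XC (- h) = 0.
  have := intD_KJ r0 q0' q1; rewrite D0 -JE -/K KE => DK.
  by rewrite /XC Jodd S0odd; lra.
have ek_n0 t : t \in `](- h), h[ -> ek r q t != 0 by move=> th; rewrite gt_eqF// ek_gt0.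
have icos : seg_int 0 1 (fun x => cos (elangle q (tau x))) = 0.
  have cc : {within `[0, 1], continuous (fun x => cos (elangle q (tau x)))}.
    by apply: (within_cont_comp (g := fun x => cos x)); [exact: continuous_cos|exact: ctw].
  have dX x : x \in `]0, 1[ ->
      is_derive x 1 (fun x => XC (tau x)) (2 * K * cos (elangle q (tau x))).
    move=> x01; have [t [th tt d]] := dcomp _ _ dXC x x01.
    by apply: (der_eq d); rewrite tt; field; exact: ek_n0.
  have c1 : {within `[0, 1], continuous (fun x => 2 * K * cos (elangle q (tau x)))}.
    by apply: within_contM => //; exact: within_cont_cst.
  have E := seg_int_FTC2 ler01 c1 (ctw _ cXC) dX.
  rewrite tau0 tau1 XCend seg_intZl in E; last exact: L1_cont.
  by move/eqP: E; rewrite mulf_eq0 (negbTE K2) => /eqP.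
pose XS t := - (q / r) * `|cos t| `^ (2 * r).
have r20 : 0 < 2 * r by lra.
have cXS : continuous XS.
  by move=> t; apply: cvgM; [exact: cvg_cst|exact: cos_powR_continuous].
have dXS t : t \in `](- h), h[ -> is_derive t 1 XS (ek r q t * sin (elangle q t)).
  move=> th; apply: (der_eq (derZ _ (der_cos_powR (2 * r) th))).
  rewrite sin_elangle// /ek; field.
  by rewrite !gt_eqF// dn_gt0.
have isin : seg_int 0 1 (fun x => sin (elangle q (tau x))) = 0.
  have cc : {within `[0, 1], continuous (fun x => sin (elangle q (tau x)))}.
    by apply: (within_cont_comp (g := fun x => sin x)); [exact: continuous_sin|exact: ctw].
  have dX x : x \in `]0, 1[ ->
      is_derive x 1 (fun x => XS (tau x)) (2 * K * sin (elangle q (tau x))).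
    move=> x01; have [t [th tt d]] := dcomp _ _ dXS x x01.
    by apply: (der_eq d); rewrite tt; field; exact: ek_n0.
  have c1 : {within `[0, 1], continuous (fun x => 2 * K * sin (elangle q (tau x)))}.
    by apply: within_contM => //; exact: within_cont_cst.
  have E := seg_int_FTC2 ler01 c1 (ctw _ cXS) dX.
  rewrite tau0 tau1 /XS cosN subrr seg_intZl in E; last exact: L1_cont.
  by move/eqP: E; rewrite mulf_eq0 (negbTE K2) => /eqP.
split => //.
have sp : s * p = 2 by rewrite /s /r; field; rewrite gt_eqF.
(* This is the equality case of Young's inequality: |k|^p is affine in the cosine of the angle, and
   the cosine integrates to zero over the leaf. *)
have kE x : `|ks (tau x)| `^ p = (4 * K * q) `^ p *
    ((2 * q ^+ 2 - 1) / (2 * q ^+ 2) + (2 * q ^+ 2)^-1 * cos (elangle q (tau x))).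
  rewrite /ks ger0_norm; last by rewrite mulr_ge0 ?powR_ge0// ltW// !mulr_gt0.
  rewrite powRM ?powR_ge0//; last by rewrite ltW// !mulr_gt0.
  rewrite -powRrM sp powR_mulrn// real_normK ?num_real// cos_elangle// cos2sin2.
  by congr (_ * _); field; rewrite gt_eqF.
have cc : L1 0 1 (fun x => cos (elangle q (tau x))).
  apply: L1_cont.
  by apply: (within_cont_comp (g := fun x => cos x)); [exact: continuous_cos|exact: ctw].
have -> : seg_int 0 1 (fun x => `|ks (tau x)| `^ p) = seg_int 0 1 (fun x => (4 * K * q) `^ p *
    ((2 * q ^+ 2 - 1) / (2 * q ^+ 2) + (2 * q ^+ 2)^-1 * cos (elangle q (tau x)))).
  by apply: eq_seg_int => x _; exact: kE.
have Lc : L1 0 1 (fun=> (2 * q ^+ 2 - 1) / (2 * q ^+ 2) : R) by exact: continuous_L1 (fun=> cvg_cst _).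
have Lz := L1Zl (2 * q ^+ 2)^-1 cc.
rewrite seg_intZl; last exact: L1D.
by rewrite (seg_intD Lc Lz) (seg_intZl _ cc) icos mulr0 addr0 seg_int_cst// subr0 mulr1.
Qed.

Lemma optimal_leaf_energy :
  (4 * intK r q * q) `^ p * ((2 * q ^+ 2 - 1) / (2 * q ^+ 2)) =
  2 `^ (3 * p - 1) * q `^ (p - 2) * (2 * q ^+ 2 - 1) * ellE1 p q `^ p.
Proof.
have KE : intK r q = 2 * ellE1 p q.
  have := ellE1_intD p1 (ltW q0) q1; rewrite -/r D0 ellK1_intK -/r; lra.
have E0 : 0 <= ellE1 p q.
  by apply: seg_int_ge0 => t _; rewrite mulr_ge0 ?sqrtr_ge0 ?powR_ge0.
rewrite KE (_ : 4 * (2 * ellE1 p q) * q = 2 ^+ 3 * (q * ellE1 p q)); last by ring.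
rewrite powRM ?exprn_ge0 ?mulr_ge0 ?(ltW q0)// powRM ?(ltW q0)//.
rewrite -powR_mulrn// -powRrM.
rewrite powRB; last by rewrite pnatr_eq0 implybT.
rewrite (@powRB _ q); last by rewrite (gt_eqF q0) implybT.
rewrite powRr1// (powR_mulrn 2 (ltW q0)); field.
by rewrite gt_eqF.
Qed.

End optimal_leaf.

(** * Gluing optimal leaves into a closed curve *)

Section ae_derivative.
Context {R : realType}.
Implicit Types (a b x y : R) (f g h : R -> R).

(** All integrals of the difference from [a] vanish, and Lebesgue differentiation recovers the
    difference almost everywhere. *)
Lemma AC_ae_unique a b f g h : AC a b f g -> AC a b f h ->
  {ae lebesgue_measure, forall x, `[a, b]%classic x -> g x = h x}.
Proof.
move=> [gi gE] [hi hE].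
pose u x := g x - h x.
have ui : L1 a b u by exact: L1B.
have u0 y : y <= b -> seg_int a y u = 0.
  move=> yb; have [ya|ay] := ltP y a.
    by rewrite /seg_int set_itv_ge ?Rintegral_set0// bnd_simp -ltNge.
  have yab : y \in `[a, b] by rewrite in_itv/= ay.
  have := gE _ yab; rewrite (hE _ yab) => /addrI E.
  by rewrite seg_intB ?E ?subrr//; [exact: L1S gi|exact: L1S hi].
pose U := u \_ `[a, b].
have Ui : lebesgue_measure.-integrable setT (EFin \o U).
  by rewrite /U -restrict_EFin; apply/integrable_restrict => //; rewrite setTI.
(* the integral starts at [a - 1] so that [FTC1] covers the endpoint [a] *)
have Uy y : L1 (a - 1) y U by apply: integrableS Ui.
have F0 y : \int[lebesgue_measure]_(t in `[a - 1, y]) U t = 0.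
  rewrite -(u0 (Num.min y b)) ?ge_min ?lexx ?orbT// /U /seg_int.
  rewrite -Rintegral_mkcondr; congr Rintegral.
  apply/seteqP; split => x /=; rewrite !in_itv/= le_min.
    by move=> [/andP[_ ->] /andP[-> ->]].
  by move=> /and3P[ax -> ->]; rewrite ax (le_trans _ ax)// lerBlDr lerDl.
have := @FTC1 R U (BLeft (a - 1)) Uy (integrable_locally (measurable_itv _) ui).
apply: filterS; first exact: (ae_filter_ringOfSetsType lebesgue_measure).
move=> x D xab; have := xab; rewrite /= in_itv/= => /andP[ax xb].
have ax1 : a - 1 < x by lra.
have [_] := D ax1.
rewrite (_ : (fun _ => _) = cst 0); last by apply/funext => y; exact: F0.
rewrite derive1_cst /U patchE mem_set// /u => /esym/eqP.
by rewrite subr_eq0 => /eqP.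
Qed.

End ae_derivative.

(** * Sobolev regularity and energy of curves with constant speed *)

Section constant_speed_curves.
Context {R : realType}.
Implicit Types (p t x y : R) (f g h : R -> R).

Lemma C2_W2p p f g h : 1 <= p -> periodic f 1 -> periodic g 1 -> periodic h 1 ->
  (forall x, is_derive x 1 f (g x)) -> (forall x, is_derive x 1 g (h x)) ->
  continuous h -> W2p p f /\ is_weak_deriv g h.
Proof.
move=> p1 pf pg ph df dg ch.
have cf := is_derive_continuous df; have cg := is_derive_continuous dg.
have per u : periodic u 1 -> u 0 = u 1 by move=> pu; rewrite -[in RHS](add0r 1) pu.
have lr : (1 : R) <= 1 by [].
have acf : AC 0 1 f g.
  exact: (C1_AC (within_continuousT cg) (within_continuousT cf) (fun x _ => df x)).
have acg : AC 0 1 g h.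
  exact: (C1_AC (within_continuousT ch) (within_continuousT cg) (fun x _ => dg x)).
have wg : is_weak_deriv g h.
  by apply: AC_weak_deriv => //; [exact: periodic_Lfun|exact: periodic_Lfun|exact: per].
split => //; split => //; first exact: periodic_Lfun.
exists g, h; split => //; try exact: periodic_Lfun.
by apply: AC_weak_deriv => //; [exact: periodic_Lfun|exact: periodic_Lfun|exact: per].
Qed.

Definition plane_curve (X Y : R -> R) t : 'rV[R]_2 :=
  \row_(i < 2) (if i == 0 then X t else Y t).

Lemma component0 X Y : component (plane_curve X Y) 0 = X.
Proof. by apply/funext => t; rewrite /component mxE. Qed.

Lemma component1 X Y : component (plane_curve X Y) 1 = Y.
Proof. by apply/funext => t; rewrite /component mxE. Qed.

Variables (M p : R) (X Y theta k : R -> R).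
Hypotheses (M0 : 0 < M) (p1 : 1 < p) (ck : continuous k).
Hypotheses (dX : forall x, is_derive x 1 X (cos (theta x)))
  (dY : forall x, is_derive x 1 Y (sin (theta x)))
  (dtheta : forall x, is_derive x 1 theta (k x)).
Hypotheses (pX : periodic X M) (pY : periodic Y M) (pk : periodic k M)
  (pcos : periodic (fun x => cos (theta x)) M) (psin : periodic (fun x => sin (theta x)) M).

Let gamma := plane_curve (fun t => X (M * t)) (fun t => Y (M * t)).

Let per f : periodic f M -> periodic (fun t => f (M * t)) 1.
Proof. by move=> pf t; rewrite mulrDr mulr1 pf. Qed.

Let dscale f g t : (forall x, is_derive x 1 f (g x)) ->
  is_derive t 1 (fun t => f (M * t)) (M * g (M * t)).
Proof.
move=> df; apply: (der_eq (der_comp (g := fun t => M * t) (df _) (derZ M (der_id t)))).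
by ring.
Qed.

Let ctheta : continuous theta. Proof. exact: is_derive_continuous dtheta. Qed.

Let dcos x : is_derive x 1 (fun x => cos (theta x)) (- sin (theta x) * k x).
Proof. exact: (der_comp (is_derive_cos _) (dtheta x)). Qed.

Let dsin x : is_derive x 1 (fun x => sin (theta x)) (cos (theta x) * k x).
Proof. exact: (der_comp (is_derive_sin _) (dtheta x)). Qed.

Let VX t := M * cos (theta (M * t)).
Let VY t := M * sin (theta (M * t)).
Let AX t := M * (M * (- sin (theta (M * t)) * k (M * t))).
Let AY t := M * (M * (cos (theta (M * t)) * k (M * t))).

Let cscale f : continuous f -> continuous (fun t => f (M * t)).
Proof.
move=> cf t; apply: (@cvg_comp _ _ _ (fun t => M * t) f); last exact: cf.
by apply: cvgM; [exact: cvg_cst|exact: cvg_id].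
Qed.

Let W2pX : W2p p (fun t => X (M * t)) /\ is_weak_deriv VX AX.
Proof.
have ca : continuous (fun x => M * (M * (- sin (theta x) * k x))).
  move=> x; apply: cvgM; first exact: cvg_cst.
  apply: cvgM; first exact: cvg_cst.
  apply: cvgM; last exact: ck.
  by apply: cvgN; apply: (@cvg_comp _ _ _ theta sin); [exact: ctheta|exact: continuous_sin].
apply: (C2_W2p (ltW p1) (per pX) _ _ (fun t => dscale t dX) _ (cscale ca)).
- by move=> t; rewrite /VX mulrDr mulr1 pcos.
- by move=> t; rewrite mulrDr mulr1 pk psin.
- by move=> t; exact: (derZ M (dscale t dcos)).
Qed.

Let W2pY : W2p p (fun t => Y (M * t)) /\ is_weak_deriv VY AY.
Proof.
have ca : continuous (fun x => M * (M * (cos (theta x) * k x))).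
  move=> x; apply: cvgM; first exact: cvg_cst.
  apply: cvgM; first exact: cvg_cst.
  apply: cvgM; last exact: ck.
  by apply: (@cvg_comp _ _ _ theta cos); [exact: ctheta|exact: continuous_cos].
apply: (C2_W2p (ltW p1) (per pY) _ _ (fun t => dscale t dY) _ (cscale ca)).
- by move=> t; rewrite /VY mulrDr mulr1 psin.
- by move=> t; rewrite mulrDr mulr1 pk pcos.
- by move=> t; exact: (derZ M (dscale t dsin)).
Qed.

Let velocity0 : derive1 (component gamma 0) = VX.
Proof.
rewrite component0; apply/funext => t; rewrite derive1E.
by have := dscale t dX => ?; exact: derive_val.
Qed.

Let velocity1 : derive1 (component gamma 1) = VY.
Proof.
rewrite component1; apply/funext => t; rewrite derive1E.
by have := dscale t dY => ?; exact: derive_val.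
Qed.

Let speedE t : speed gamma t = M.
Proof.
rewrite /speed /euclidean_norm !big_ord_recl big_ord0 addr0 !mxE velocity0.
rewrite (_ : lift ord0 ord0 = 1); last exact: val_inj.
rewrite velocity1 /VX /VY !exprMn -mulrDr cos2Dsin2 mulr1 sqrtr_sqr.
by rewrite ger0_norm// ltW.
Qed.

Lemma constant_speed_W2p_imm : W2p_imm p gamma.
Proof.
split=> [i|t].
  have [i0|i1] := eqVneq i 0; first by rewrite i0 component0; have [] := W2pX.
  suff -> : i = 1 by rewrite component1; have [] := W2pY.
  by apply: val_inj; move: i i1 => [[|[|]]].
apply/eqP => v0; have := speedE t.
rewrite /speed /euclidean_norm v0 big1 ?sqrtr0 => [M0'|i _]; last by rewrite mxE expr0n.
by move: M0; rewrite -M0' ltxx.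
Qed.

Lemma constant_speed_energy :
  normalized_bending_energy p gamma =
    (M `^ (p - 1) * seg_int 0 1 (fun t => M * `|k (M * t)| `^ p))%:E.
Proof.
have p0 := lt_trans ltr01 p1.
have cst1 : L1 0 1 (fun=> M) by apply: continuous_L1 => t; exact: cvg_cst.
have lenE : curve_length gamma = M%:E.
  rewrite /curve_length (eq_integral (fun=> M%:E)); last by move=> t _; rewrite speedE.
  by rewrite (L1_EFin cst1) seg_int_cst// subr0 mulr1.
(* The curvature is built on the representative chosen by [weak_deriv], which agrees with the
   classical second derivative only almost everywhere. *)
have acc (V A : R -> R) : continuous V -> is_weak_deriv V A ->
    L1 0 1 (weak_deriv V) /\
    {ae lebesgue_measure, forall t, `[0, 1]%classic t -> weak_deriv V t = A t}.
  move=> cV wV.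
  have ac1 := weak_deriv_AC (within_continuousT cV) (weak_derivP wV).
  have ac2 := weak_deriv_AC (within_continuousT cV) wV.
  by split; [exact: AC_L1 ac1|exact: AC_ae_unique ac1 ac2].
have cVX : continuous VX.
  move=> t; apply: cvgM; first exact: cvg_cst.
  apply: (@cvg_comp _ _ _ (fun t => theta (M * t)) cos); last exact: continuous_cos.
  exact: cscale.
have cVY : continuous VY.
  move=> t; apply: cvgM; first exact: cvg_cst.
  apply: (@cvg_comp _ _ _ (fun t => theta (M * t)) sin); last exact: continuous_sin.
  exact: cscale.
have [xi xae] := acc _ _ cVX W2pX.2; have [yi yae] := acc _ _ cVY W2pY.2.
have curvE t : curvature gamma t =
    (VX t * weak_deriv VY t - VY t * weak_deriv VX t) / M ^+ 3.
  by rewrite /curvature speedE !mxE velocity0 velocity1.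
have fE : bending_energy p gamma =
    (seg_int 0 1 (fun t => M * `|k (M * t)| `^ p))%:E.
  rewrite -L1_EFin; last first.
    apply: L1Zl; apply: continuous_L1 => t.
    apply: (@cvg_comp _ _ _ (fun t => k (M * t)) (fun x => `|x| `^ p)).
      exact: cscale.
    exact: continuous_norm_powR.
  apply: ge0_ae_eq_integral => //=.
  - apply/measurable_EFinP; apply: measurable_funM.
      apply: (measurableT_comp (measurable_powR _)) => //.
      apply: measurableT_comp => //.
      rewrite (_ : curvature gamma =
        fun t => (VX t * weak_deriv VY t - VY t * weak_deriv VX t) * (M ^+ 3)^-1); last exact/funext.
      apply: measurable_funM => //; apply: measurable_funB.
        apply: measurable_funM; last exact: L1_measurable yi.
        by apply: measurable_funTS; exact: continuous_measurable_fun.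
      apply: measurable_funM; last exact: L1_measurable xi.
      by apply: measurable_funTS; exact: continuous_measurable_fun.
    by rewrite (_ : speed gamma = fun=> M)//; exact/funext.
  - apply/measurable_EFinP; apply: measurable_funM => //.
    apply: (measurableT_comp (measurable_powR _)) => //.
    apply: measurableT_comp => //.
    apply: measurable_funTS; apply: continuous_measurable_fun; exact: cscale.
  - by move=> t _; rewrite lee_fin mulr_ge0 ?powR_ge0// speedE ltW.
  - by move=> t _; rewrite lee_fin mulr_ge0 ?powR_ge0// ltW.
  - move: xae yae; apply: filterS2; first exact: (ae_filter_ringOfSetsType lebesgue_measure).
    move=> t hx hy t01; rewrite speedE curvE hx// hy//; congr _%:E.
    rewrite mulrC; congr (_ * `|_| `^ _).
    transitivity (k (M * t) * (cos (theta (M * t)) ^+ 2 + sin (theta (M * t)) ^+ 2)).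
      by rewrite /VX /VY /AX /AY; field; rewrite gt_eqF.
    by rewrite cos2Dsin2 mulr1.
by rewrite /normalized_bending_energy lenE fE poweR_EFin -EFinM.
Qed.

End constant_speed_curves.

Section gluing.
Context {R : realType}.
Implicit Types (x y t : R) (f F phi k : R -> R) (n : int) (eps : int -> R).

(** Since [k] vanishes at both ends of the leaf, its sign may change across integers without
    breaking continuity. Reversing the sign reflects the leaf, which preserves the closing integrals
    and |k|. *)
Lemma glued_angle phi k eps (M : nat) : AC 0 1 phi k ->
  {within `[0, 1], continuous k} -> k 0 = 0 -> k 1 = 0 ->
  seg_int 0 1 (fun x => cos (phi x)) = 0 -> seg_int 0 1 (fun x => sin (phi x)) = 0 ->
  (forall n, eps n = 1 \/ eps n = -1) -> (forall n, eps (n + M) = eps n) ->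
  exists theta G : R -> R,
  [/\ continuous G, periodic G M%:R, forall x, is_derive x 1 theta (G x),
      forall n, theta (1 + n%:~R) = theta n%:~R + eps n * (phi 1 - phi 0) &
      forall n, [/\ seg_int 0 1 (fun x => cos (theta (x + n%:~R))) = 0,
        seg_int 0 1 (fun x => sin (theta (x + n%:~R))) = 0 &
        forall p, seg_int 0 1 (fun x => `|G (x + n%:~R)| `^ p) =
                  seg_int 0 1 (fun x => `|k x| `^ p)]].
Proof.
move=> ack ck k0 k1 icos isin eps1 pe.
have k01 : k 0 = k 1 by rewrite k0.
pose G x := eps (Num.floor x) * periodic_ext k x.
have GE n x : x \in `[0, 1] -> G (x + n%:~R) = eps n * k x.
  rewrite in_itv/= => /andP[x0 x1]; rewrite /G.
  rewrite (@periodic_ext_seg _ k n) ?addrK//; [|lra..].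
  (* At x = 1 the floor has already moved to n + 1 and selects the next sign, which is harmless
     because k 1 = 0. *)
  move: x1; rewrite le_eqVlt => /predU1P[->|x1]; first by rewrite k1 !mulr0.
  by rewrite (@floor_def _ _ n)// rmorphD/=; apply/andP; split; lra.
have cG : continuous G.
  apply: continuous_int_segments => n.
  apply: (within_cont_eq (f := fun x => eps n * periodic_ext k x)).
    move=> x /=; rewrite in_itv/= => /andP[nx xn].
    rewrite -(subrK n%:~R x) GE; last by rewrite in_itv/=; apply/andP; split; lra.
    by rewrite (periodic_ext_seg (n := n))// ?subrK// addrK.
  apply: within_contM; first exact: within_cont_cst.
  by apply: within_continuousT; exact: periodic_ext_continuous.
have [theta _ dtheta] := continuous_primitive cG.
have ctheta := is_derive_continuous dtheta.
have theta_n n x : x \in `[0, 1] ->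
    theta (x + n%:~R) = theta n%:~R + eps n * (phi x - phi 0).
  move=> x01; have := x01; rewrite in_itv/= => /andP[x0 x1].
  have d y : is_derive y 1 (fun y => theta (y + n%:~R)) (G (y + n%:~R)).
    apply: (der_eq (der_comp (g := fun t => t + n%:~R) (dtheta _) (derD (der_id y) (der_cst _ _)))).
    by rewrite addr0 mulr1.
  have cGn : {within `[0, 1], continuous (fun y => G (y + n%:~R))}.
    apply: (within_cont_eq (f := fun x => eps n * k x)).
      by move=> y yi; rewrite GE.
    by apply: within_contM => //; exact: within_cont_cst.
  have ac := C1_AC cGn (within_continuousT (is_derive_continuous d)) (fun y _ => d y).
  have := AC_diff ac (lexx _) x0 x1; rewrite add0r.
  rewrite (@eq_seg_int _ _ _ _ (fun y => eps n * k y)); last first.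
    by move=> y; rewrite in_itv/= => /andP[y0 yx]; apply: GE; rewrite in_itv/= y0 (le_trans yx).
  rewrite seg_intZl; last exact: L1S (AC_L1 ack).
  by rewrite -(AC_diff ack (lexx _) x0 x1) => <-; ring.
exists theta, G; split => //.
- move=> x; rewrite /G floorDrz ?natr_int// [M%:R]pmulrn intrKfloor pe; congr (_ * _).
  exact: (periodic_int x (Posz M) (@periodic_ext_periodic R k)).
- by move=> n; apply: theta_n; rewrite in_itv/= lexx ler01.
move=> n.
have cphi := AC_cont ler01 ack.
have Lc : L1 0 1 (fun x => cos (phi x)).
  by apply/L1_cont/(within_cont_comp (g := cos)) => //; exact: continuous_cos.
have Ls : L1 0 1 (fun x => sin (phi x)).
  by apply/L1_cont/(within_cont_comp (g := sin)) => //; exact: continuous_sin.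
(* On the n-th leaf the angle is [A + eps n * phi], a rotation of the model leaf, preceded by a
   reflection when the sign is -1. *)
pose A := theta n%:~R - eps n * phi 0.
have cosE x : cos (A + eps n * phi x) = cos A * cos (phi x) - eps n * sin A * sin (phi x).
  by have [->|->] := eps1 n; rewrite ?mul1r ?mulN1r cosD ?cosN ?sinN; ring.
have sinE x : sin (A + eps n * phi x) = sin A * cos (phi x) + eps n * cos A * sin (phi x).
  by have [->|->] := eps1 n; rewrite ?mul1r ?mulN1r sinD ?cosN ?sinN; ring.
have thE x : x \in `[0, 1] -> theta (x + n%:~R) = A + eps n * phi x.
  by move=> /theta_n ->; rewrite /A; ring.
split.
- rewrite (@eq_seg_int _ _ _ _ (fun x => cos A * cos (phi x) - eps n * sin A * sin (phi x))).
    rewrite (seg_intB (L1Zl _ Lc) (L1Zl _ Ls)) (seg_intZl _ Lc) (seg_intZl _ Ls).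
    by rewrite icos isin !mulr0 subrr.
  by move=> x /thE ->.
- rewrite (@eq_seg_int _ _ _ _ (fun x => sin A * cos (phi x) + eps n * cos A * sin (phi x))).
    rewrite (seg_intD (L1Zl _ Lc) (L1Zl _ Ls)) (seg_intZl _ Lc) (seg_intZl _ Ls).
    by rewrite icos isin !mulr0 addr0.
  by move=> x /thE ->.
- move=> p; apply: eq_seg_int => x /GE ->; rewrite normrM.
  by have [->|->] := eps1 n; rewrite ?normrN normr1 mul1r.
Qed.

Lemma primitive_nat F f c : continuous f -> (forall x, is_derive x 1 F (f x)) ->
  (forall n, seg_int 0 1 (fun x => f (x + n%:~R)) = c) ->
  forall i : nat, F i%:R = F 0 + i%:R * c.
Proof.
move=> cf dF fc; elim=> [|i IH]; first by rewrite mul0r addr0.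
have d y : is_derive y 1 (fun y => F (y + i%:~R)) (f (y + i%:~R)).
  apply: (der_eq (der_comp (g := fun t => t + i%:~R) (dF _) (derD (der_id y) (der_cst _ _)))).
  by rewrite addr0 mulr1.
have cfi : continuous (fun y => f (y + i%:~R)).
  move=> y; apply: (@cvg_comp _ _ _ (fun t => t + i%:~R) f); last exact: cf.
  by apply: cvgD; [exact: cvg_id|exact: cvg_cst].
have := seg_int_FTC2 ler01 (within_continuousT cfi)
  (within_continuousT (is_derive_continuous d)) (fun y _ => d y).
rewrite fc add0r => E.
have -> : F i.+1%:R = F (1 + i%:~R) by rewrite -pmulrn addrC natr1.
by move: E; rewrite -!pmulrn IH -natr1 mulrDl mul1r => E; lra.
Qed.

End gluing.

(** * Construction of the extremal curves *)

Section if_direction.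
Context {R : realType}.
Implicit Types (t x y : R).

(** The m' glued leaves have unit length and energy [varpi_star p] each, so length^(p - 1) times
    energy is m'^(p - 1) m' times that constant. All junctions lie at the origin. *)
Lemma closed_leaf_curve (m m' : nat) (p : R) : (3 <= m)%N -> odd m -> 1 < p ->
  phi_star p = pi / m%:R -> (2 <= m')%N -> ~~ odd m' \/ (m <= m')%N ->
  exists gamma : R -> 'rV[R]_2,
     [/\ W2p_imm p gamma, has_multiplicity gamma 0 m' &
         normalized_bending_energy p gamma = (varpi_star p * m'%:R `^ p)%:E].
Proof.
move=> m3 modd p1 hphi m'2 par; have p0 := lt_trans ltr01 p1.
have [q0 q1 D0 asinE c0] := q_star_spec p1 m3 hphi.
have [phi [k [ack ck [k0 k1] dphi [icos isin ien]]]] := optimal_leaf p1 q0 q1 D0 c0.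
have {}ien : seg_int 0 1 (fun x => `|k x| `^ p) = varpi_star p.
  by rewrite ien (optimal_leaf_energy p1 q0 q1 D0).
(* [s] is the intended sum of signs. It has the parity of [m'] because [m] is odd, so [P] leaves of
   sign +1 followed by m' - P leaves of sign -1 realize it. *)
pose s := if odd m' then m else 0%N.
pose P := ((m' + s)./2)%N.
have sm' : (s <= m')%N by rewrite /s; case: (odd m') par => // -[].
have P2 : (P * 2 = m' + s)%N.
  rewrite muln2 /P -[RHS]odd_double_half oddD (_ : odd s = odd m') ?addbb//.
  by rewrite /s; case: (odd m').
have Pm' : (P <= m')%N by lia.
pose eps (n : int) : R := if (n %% m')%Z < P then 1 else -1.
have [|n|theta [G [cG pG dth thn ints]]] := @glued_angle R phi k eps m' ack ck k0 k1 icos isin.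
- by move=> n; rewrite /eps; case: ifP; [left|right].
- by rewrite /eps modzDr.
set delta := phi 1 - phi 0 in dphi thn.
have th_nat (i : nat) : (i <= m')%N ->
    theta i%:R = theta 0 + (2 * (minn i P)%:R - i%:R) * delta.
  elim: i => [|i IH] im; first by rewrite min0n; ring.
  have -> : theta i.+1%:R = theta (1 + i%:~R) by rewrite -pmulrn addrC natr1.
  rewrite thn -pmulrn IH; last exact: ltnW.
  rewrite /eps modz_small; last by rewrite lez_nat ltz_nat.
  rewrite ltz_nat -[i.+1%:R]natr1; case: ltnP => iP.
    by rewrite (minn_idPl iP) -natr1; ring.
  by rewrite (minn_idPr (leqW iP)); ring.
have thM : theta m'%:R - theta 0 = (s%:R) * delta.
  rewrite th_nat// (minn_idPr Pm') -natrM mulnC P2 natrD; ring.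
have thP x : theta (x + m'%:R) = theta x + s%:R * delta.
  by have := primitive_translate x pG dth; rewrite thM => <-; ring.
(* In the odd case, m turnings of 2 (pi - pi / m) add up to 2 pi (m - 1). *)
have [j jE] : exists j : nat, s%:R * delta = pi *+ 2 *+ j.
  rewrite /s; case: ifP => _; last by exists 0%N; rewrite mul0r.
  exists m.-1; rewrite dphi asinE -mulr_natl -[pi *+ 2]mulr_natl.
  have -> : m%:R = m.-1%:R + 1 :> R by rewrite natr1 prednK// (leq_trans _ m3).
  field; rewrite natr1 prednK ?(leq_trans _ m3)//.
  by rewrite pnatr_eq0 -lt0n (leq_trans _ m3).
have pcos : periodic (fun x => cos (theta x)) m'%:R.
  by move=> x; rewrite thP jE (periodicn (@cosD2pi R)).
have psin : periodic (fun x => sin (theta x)) m'%:R.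
  by move=> x; rewrite thP jE (periodicn (@sinD2pi R)).
have cth := is_derive_continuous dth.
have ccos : continuous (fun x => cos (theta x)).
  by move=> x; apply: (@cvg_comp _ _ _ theta cos); [exact: cth|exact: continuous_cos].
have csin : continuous (fun x => sin (theta x)).
  by move=> x; apply: (@cvg_comp _ _ _ theta sin); [exact: cth|exact: continuous_sin].
have cGp : continuous (fun x => `|G x| `^ p).
  move=> x; apply: (@cvg_comp _ _ _ G (fun x => `|x| `^ p)); first exact: cG.
  exact: continuous_norm_powR.
have [X X0 dX] := continuous_primitive ccos.
have [Y Y0 dY] := continuous_primitive csin.
have [E E0 dE] := continuous_primitive cGp.
have Xn (i : nat) : X i%:R = 0.
  by rewrite (primitive_nat ccos dX (c := 0)) ?mulr0 ?addr0// => n; have [] := ints n.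
have Yn (i : nat) : Y i%:R = 0.
  by rewrite (primitive_nat csin dY (c := 0)) ?mulr0 ?addr0// => n; have [] := ints n.
have En : E m'%:R = m'%:R * varpi_star p.
  rewrite (primitive_nat cGp dE (c := varpi_star p)) ?E0 ?add0r// => n.
  by have [_ _ ->] := ints n.
have pX : periodic X m'%:R.
  by move=> x; have := primitive_translate x pcos dX; rewrite Xn X0 subrr => /subr0_eq.
have pY : periodic Y m'%:R.
  by move=> x; have := primitive_translate x psin dY; rewrite Yn Y0 subrr => /subr0_eq.
have M0 : 0 < m'%:R :> R by rewrite ltr0n (leq_trans _ m'2).
have Mn0 : m'%:R != 0 :> R by rewrite gt_eqF.
exists (plane_curve (fun t => X (m'%:R * t)) (fun t => Y (m'%:R * t))); split.
- exact: constant_speed_W2p_imm dth pX pY pG pcos psin.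
- pose f (i : nat) : R := i%:R / m'%:R.
  have finj : {in `I_m' &, injective f}.
    by move=> i j' _ _ /(mulIf (invr_neq0 Mn0))/eqP; rewrite eqr_nat => /eqP.
  have : (f @` `I_m' #<= (`[0%R, 1%R[ `&` [set t |
      plane_curve (fun t => X (m'%:R * t)) (fun t => Y (m'%:R * t)) t = 0]))%card.
    apply: subset_card_le => _ [i im <-]; split => /=.
      rewrite in_itv/= /f divr_ge0//= ltr_pdivrMr// mul1r ltr_nat.
      exact: im.
    apply/rowP => l; rewrite !mxE /f mulrCA divff// mulr1.
    by case: ifP.
  apply: card_le_trans.
  by have := inj_card_eq finj; rewrite card_eq_le => /andP[].
- rewrite (constant_speed_energy M0 p1 cG dX dY dth pX pY pG pcos psin).
  have -> : seg_int 0 1 (fun t => m'%:R * `|G (m'%:R * t)| `^ p) = m'%:R * varpi_star p.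
    have d t : is_derive t 1 (fun t => E (m'%:R * t)) (m'%:R * `|G (m'%:R * t)| `^ p).
      apply: (der_eq (der_comp (g := fun t => m'%:R * t) (dE _) (derZ m'%:R (der_id t)))).
      by ring.
    have cs : continuous (fun t => m'%:R * `|G (m'%:R * t)| `^ p).
      move=> t; apply: cvgM; first exact: cvg_cst.
      apply: (@cvg_comp _ _ _ (fun t => m'%:R * t) (fun x => `|G x| `^ p)); last exact: cGp.
      by apply: cvgM; [exact: cvg_cst|exact: cvg_id].
    rewrite (seg_int_FTC2 ler01 (within_continuousT cs)
      (within_continuousT (is_derive_continuous d)) (fun t _ => d t)).
    by rewrite mulr1 mulr0 E0 subr0 En.
  congr _%:E; rewrite mulrA mulrC [_ `^ _ * _]mulrC; congr (_ * _).
  by rewrite mulr_powRB1// ltW.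
Qed.

End if_direction.

Theorem theorem5p12 (R : realType) (m : nat) (hm : (3 <= m)%N) (hmodd : odd m)
    (p_m : R) (hp : 1 < p_m) (hphi : phi_star p_m = pi / m%:R)
    (m' : nat) (hm' : (2 <= m')%N) :
  (exists gamma : R -> 'rV[R]_2,
     [/\ W2p_imm p_m gamma,
         exists P : 'rV[R]_2, has_multiplicity gamma P m' &
         normalized_bending_energy p_m gamma =
           (varpi_star p_m * m'%:R `^ p_m)%:E])
  <-> ~~ odd m' \/ (m <= m')%N.
Proof.
split=> [[gamma [hW [P hP] hE]]|par].
  exact: (only_if_multiplicity hm hp hphi hm' hW hP hE).
have [gamma [hW hP hE]] := closed_leaf_curve hm hmodd hp hphi hm' par.
by exists gamma; split => //; exists 0.
Qed.
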